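(* Let $n,q,N\in\mathbb{N}$, let $f\colon\mathbb{R}^n\times\mathbb{R}^q\to\mathbb{R}^n$ and $g\colon\mathbb{R}^n\to\mathbb{R}$, and consider the discrete-time optimal control problem with dynamics $x^+=f(x,u)$, terminal cost $g$, no stage costs, and horizon $N$, i.e. with cost functional $J(x,U)=g(f^N(x,\cdot)(U))$. Assume that $(f,\mathcal{G}^f,\mathcal{L}^f)$ and $(g,\mathcal{G}^g,\mathcal{L}^g)$ are compositional functions that satisfy Assumption A (see context), and that all the functions in the nodes of the compositional graphs of $f$ and $g$ are twice continuously differentiable. Let $\Omega\subset\mathbb{R}^n$ be a compact set of initial values and $\mathcal{U}\subset\mathbb{R}^{qN}$ a convex set of admissible control values. Assume that $J\colon\Omega\times\mathcal{U}\to\mathbb{R}$ is convex in $U$ for all $x\in\Omega$. Suppose that there exist $U_0\in\mathcal{U}$ and $\gamma>0$ with $\mathcal{B}_{3\gamma}(U_0)\subset\mathcal{U}$ such that for all $x\in\Omega$ there exists some $U^*(x)\in\mathcal{B}_\gamma(U_0)$ satisfying $$\inf_{U\in\mathcal{U}}J(x,U)=J(x,U^*(x)).$$ Let $R>1$ be a constant large enough so that $\mathcal{B}_{2\gamma}(U_0)\subset[-R,R]^{qN}$ and $$f^k(x,\cdot)(U)\in\left[-\tfrac R2,\tfrac R2\right]^n\qquad\text{for all }x\in\Omega,\ U\in\mathcal{B}_{2\gamma}(U_0),\ 0\le k\le N-1 .$$ Let $(r_{\max}^f,\Lambda^f,L_{\max}^f,|\mathcal{V}_G^f|)$ and $(r_{\max}^g,\Lambda^g,L_{\max}^g,|\mathcal{V}_G^g|)$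 be compositional features of $f\colon[-R,R]^{n+q}\to\mathbb{R}^n$ and $g\colon[-R,R]^n\to\mathbb{R}$, let $L^f$ and $L^g$ be Lipschitz constants of $f$ and $g$, respectively, let $r:=\max\{r_{\max}^f,r_{\max}^g\}$, and let $$L_1:=\max_{x\in\Omega,\,U\in\mathcal{B}_{3\gamma}(U_0)}\left\|\frac{\partial J}{\partial U}(x,U)\right\|,\qquad L_2:=\max_{x\in\Omega,\,U\in\mathcal{B}_{2\gamma}(U_0)}\left\|\frac{\partial^2J}{\partial U^2}(x,U)\right\| .$$ Then, for any $\varepsilon\in(0,1)$, there exists a neural network $U_\varepsilon^{*\mathrm{NN}}\colon\Omega\to\mathcal{U}$ such that for all $x\in\Omega$ $$J(x,U_\varepsilon^{*\mathrm{NN}}(x))-J(x,U^*(x))\le\varepsilon,$$ and whose complexity is bounded by $$\operatorname{size}(U_\varepsilon^{*\mathrm{NN}})\le C_1^r\,C_2\left(N|\mathcal{V}_G^f|+|\mathcal{V}_G^g|\right)\left(1+\mathfrak{C}^r\right)\frac{(qN)^{r+1}}{\varepsilon^{4r+1}},$$ where $C_1$ and $C_2$ are constants that depend at most polynomially on $\gamma$, $L_1$ and $L_2$, and $\mathfrak{C}$ is a constant depending linearly on $L^g,C_f,L_{\max}^f,\Lambda^f,|\mathcal{V}_G^f|,C_g,L_{\max}^g,\Lambda^g,|\mathcal{V}_G^g|$ and polynomially of order $N$ on $L^f$. Here $C_f$ and $C_g$ are constants determined by $\{(d_{i,j},m_{i,j})\in\mathbb{N}^2:f_{i,j}\in\mathcal{V}_G^f\}$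 and $\{(d_{i,j},m_{i,j})\in\mathbb{N}^2:g_{i,j}\in\mathcal{V}_G^g\}$, respectively.
   Context: For $U=(u_0,\dots,u_{N-1})\in\mathbb{R}^{qN}$ with $u_k\in\mathbb{R}^q$, set $f^0(x,\cdot)(U)=x$ and $f^{k+1}(x,\cdot)(U)=f(f^k(x,\cdot)(U),u_k)$ for $0\le k\le N-1$ (the state at time $k$ from initial state $x$ under control sequence $U$ is $f^k(x,\cdot)(U)$). $\|\cdot\|$ is the Euclidean norm for vectors and the induced norm for matrices; $\mathcal{B}_\rho(y)$ is the closed Euclidean ball of radius $\rho$ centered at $y$. Compositional functions. A compositional function is a triplet $(f,\mathcal{G}^f,\mathcal{L}^f)$, where $\mathcal{G}^f=(\mathcal{V}^f,\mathcal{E}^f)$ is a directed acyclic graph and $\mathcal{L}^f\colon\mathcal{V}^f\to\mathbb{N}$ assigns layer numbers with $(g,h)\in\mathcal{E}^f\Rightarrow\mathcal{L}^f(g)<\mathcal{L}^f(h)$. Nodes without inward edges are input nodes and have layer number $0$; nodes without outward edges are output nodes and have the maximal layer number $l_{\max}^f$; all other nodes are hidden. The nodes of layer $i$ are $f_{i,1},\dots,f_{i,N_i}$. Each node $f_{i,j}$ with $i>0$ is a function of $d_{i,j}$ real variables with values in $\mathbb{R}$, where $d_{i,j}$ is the number of incoming edges of $f_{i,j}$. With $d=N_0$, an input $x\in\mathbb{R}^d$ is assigned to the input nodes, and recursively $z_{i,j}(x)$ is $f_{i,j}$ applied to the vector of the values of all predecessors of $f_{i,j}$. With $q=N_{l_{\max}^f}$,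 $f(x)=(z_{l_{\max}^f,1}(x),\dots,z_{l_{\max}^f,q}(x))$. $\mathcal{V}_L^f$ is the set of nodes that are input nodes or affine linear functions; $\mathcal{V}_G^f=\mathcal{V}^f\setminus\mathcal{V}_L^f$ is the set of general nodes. Sobolev space. $W_m^\infty(K)$, for compact $K\subset\mathbb{R}^d$, is the space of functions $K\to\mathbb{R}$ whose derivatives up to order $m$ exist almost everywhere and have finite essential supremum norm $\|\cdot\|_{\infty,K}$. Assumption A. $(f,\mathcal{G}^f,\mathcal{L}^f)$ is a compositional function with $f\colon[-R,R]^d\to\mathbb{R}^q$ for some $R>0$, $d,q\in\mathbb{N}_{>0}$; each general node $f_{i,j}\in\mathcal{V}_G^f$ lies in $W_{m_{i,j}}^\infty([-R_{i,j},R_{i,j}]^{d_{i,j}})$ for some $m_{i,j},d_{i,j}\in\mathbb{N}_{>0}$, $R_{i,j}>0$; ranges and domains are compatible: if $(f_{i,j},f_{l,k})$ is an edge, the range of $f_{i,j}$ is contained in the interior of the domain of $f_{l,k}$. (Functions given on a whole Euclidean space are understood restricted to the cube.) Node Lipschitz constants. For a node $f_{i,j}$, the truncation of $f$ along layer $i$ is the function obtained by treating the values of all nodes in layers $\le i$ as free input variables and evaluating the remaining layers of the graph to the output; a Lipschitz constant $L_{i,j}^f$ associated to $f_{i,j}$ is a Lipschitz constant of this truncation with respect to the single variable replacing the value of $f_{i,j}$. Features. If $f$ satisfies Assumption A, numbers $(r_{\max}^f,\Lambda^f,L_{\max}^f,|\mathcal{V}_G^f|)\in(0,\infty)^4$ are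 called (compositional) features of $f$ if for all $f_{i,j}\in\mathcal{V}_G^f$: $d_{i,j}/m_{i,j}\le r_{\max}^f$; $\max\{R_{i,j}^{m_{i,j}},1\}\sum_{|\alpha|\le m_{i,j}}\|D_\alpha f_{i,j}\|_{\infty,[-R_{i,j},R_{i,j}]^{d_{i,j}}}\le\Lambda^f$; and $|L_{i,j}^f|\le L_{\max}^f$. Neural networks. A neural network (NN) with activation function $\sigma\colon\mathbb{R}\to\mathbb{R}$ is a compositional function $f^{\mathrm{NN}}$ in which every general node has the form $x\mapsto\sigma(w^\top x+b)$ with parameters $w\in\mathbb{R}^{d_{i,j}}$, $b\in\mathbb{R}$, and each function in the output layer is a weighted sum of the nodes in the previous layer. Its complexity $\operatorname{size}(f^{\mathrm{NN}})$ is the total number of hidden nodes. Throughout, $\sigma$ is a fixed activation function for which the following known approximation theorem (Kang and Gong) holds: if $f$ satisfies Assumption A with features $(r_{\max}^f,\Lambda^f,L_{\max}^f,|\mathcal{V}_G^f|)$, then for every positive integer $n_w$ there is an NN $f^{\mathrm{NN}}$ with $\operatorname{size}(f^{\mathrm{NN}})=n_w|\mathcal{V}_G^f|$ and $\|f(x)-f^{\mathrm{NN}}(x)\|\le C\Lambda^fL_{\max}^f|\mathcal{V}_G^f|\,n_w^{-1/r_{\max}^f}$ for all $x\in[-R,R]^d$, where $C>0$ is determined by $\{(d_{i,j},m_{i,j}):f_{i,j}\in\mathcal{V}_G^f\}$. The constants $C_f$, $C_g$ in the claim are the constants $C$ of this theorem for $f$ and $g$.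
   Formalization: Also assumes f^N(x,·)(U) ∈ [-R,R]^n for x∈Ω, U∈B_{2γ}(U_0), without which features of g on [-R,R]^n do not control J; Sobolev nodes have Lipschitz derivatives of order below m; output nodes of a network may read nodes of any earlier layer. *)

(* Defs.v *)
From mathcomp Require Import all_boot all_order all_algebra.
From mathcomp Require Import all_classical all_reals all_analysis.
From mathcomp Require mpoly.
(* The notations of mpoly clash with those of mathcomp-analysis. *)
Export -(notations) mpoly.
Export Order.TTheory GRing.Theory Num.Theory numFieldNormedType.Exports.

Set Implicit Arguments.
Unset Strict Implicit.
Unset Printing Implicit Defensive.

Local Open Scope classical_set_scope.
Local Open Scope ring_scope.

(* Matrices carry the sup norm in mathcomp-analysis: the Euclidean norm, its
   closed balls and the induced matrix norm have to be introduced. *)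
Section euclidean.
Context {R : realType}.

Definition enorm k (x : 'rV[R]_k) : R := Num.sqrt (\sum_i x 0 i ^+ 2).

Definition eball k (y : 'rV[R]_k) (r : R) : set 'rV[R]_k :=
  [set x | enorm (x - y) <= r].

Definition opnorm k (A : 'M[R]_k) : R :=
  sup [set enorm (x *m A^T) | x in [set x : 'rV[R]_k | enorm x <= 1]].

Definition elipschitz k l (L : R) (A : set 'rV[R]_k)
    (h : 'rV[R]_k -> 'rV[R]_l) : Prop :=
  forall x y, A x -> A y -> enorm (h x - h y) <= L * enorm (x - y).

Definition cube k (r : R) : set 'rV[R]_k := [set x | forall i, `|x 0 i| <= r].

Definition open_cube k (r : R) : set 'rV[R]_k :=
  [set x | forall i, `|x 0 i| < r].

Definition is_max (A : set R) (a : R) : Prop := A a /\ ubound A a.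

End euclidean.
Arguments cube {R k} r.
Arguments open_cube {R k} r.

Section derivatives.
Context {R : realType} {k : nat}.
Implicit Types h : 'rV[R]_k -> R.

Definition partial (i : 'I_k) h : 'rV[R]_k -> R :=
  fun x => 'D_(delta_mx 0 i) h x.

Definition gradient h (x : 'rV[R]_k) : 'rV[R]_k := \row_i partial i h x.

Definition hessian h (x : 'rV[R]_k) : 'M[R]_k :=
  \matrix_(i, j) partial i (partial j h) x.

Definition cont_diff h : Prop :=
  forall i, (forall x, derivable h x (delta_mx 0 i)) /\
            continuous (partial i h).

Definition twice_cont_diff h : Prop :=
  cont_diff h /\ forall i, cont_diff (partial i h).

(* mathcomp-analysis has no Lebesgue measure on R^k; only its null sets are
   needed, in their usual description by countable covers by boxes. *)
Definition lebesgue_null (A : set 'rV[R]_k) : Prop :=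
  forall e : R, 0 < e -> exists a b : nat -> 'rV[R]_k,
    [/\ forall j i, a j 0 i <= b j 0 i,
        A `<=` \bigcup_j [set x | forall i, a j 0 i <= x 0 i <= b j 0 i]
      & forall p, \sum_(j < p) \prod_i (b j 0 i - a j 0 i) <= e].

Definition ess_norm (A : set 'rV[R]_k) h : \bar R :=
  ereal_inf [set M%:E |
    M in [set M : R | lebesgue_null (A `&` [set x | M < `|h x|])]].

(* D_a h for a multi-index a of order at most m *)
Definition multi_partial m (a : {ffun 'I_k -> 'I_m.+1}) h :=
  foldr (fun i u => iter (a i) (partial i) u) h (enum 'I_k).

Definition multi_order m (a : {ffun 'I_k -> 'I_m.+1}) : nat :=
  (\sum_i a i)%N.

(* h belongs to W_m^oo of the cube of radius r.  As 'D is a total operator, the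
   existence of the derivatives is stated separately.  Almost everywhere
   existence of classical derivatives does not by itself give a Sobolev
   function (step functions and the Cantor function satisfy it); what is missing
   is that each derivative of order less than m has a Lipschitz
   representative.  Since compositional functions are evaluated pointwise,
   h is the continuous representative of its class. *)
Definition sobolev (m : nat) (r : R) h : Prop :=
  [/\ {within cube r, continuous h},
      forall s : seq 'I_k, (size s < m)%N ->
        (exists M : R, M.-lipschitz_(open_cube r) (foldr partial h s)) /\
        (forall i, lebesgue_null (cube r `&`
           [set x | ~ derivable (foldr partial h s) x (delta_mx 0 i)]))
    & forall a : {ffun 'I_k -> 'I_m.+1}, (multi_order a <= m)%N ->
        (ess_norm (cube r) (multi_partial a h) < +oo)%E].

Definition sobolev_sum (m : nat) (r : R) h : \bar R :=
  (\sum_(a : {ffun 'I_k -> 'I_m.+1} | (multi_order a <= m)%N)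
     ess_norm (cube r) (multi_partial a h))%E.

End derivatives.

Definition is_source (V : finType) (e : rel V) (v : V) : bool :=
  [forall u, ~~ e u v].
Definition is_sink (V : finType) (e : rel V) (v : V) : bool :=
  [forall u, ~~ e v u].

(* Acyclicity follows from edge_layer.  The arguments of fnode v are the values
   of the predecessors of v, in the order in which enum_val lists them; fnode v
   is meaningless when v is an input node. *)
Record compfun (R : realType) (d q : nat) := Compfun {
  node : finType;
  edge : rel node;
  layer : node -> nat;
  inode : 'I_d -> node;
  onode : 'I_q -> node;
  fnode : forall v : node, 'rV[R]_#|[pred u | edge u v]| -> R;
  edge_layer : forall u v, edge u v -> (layer u < layer v)%N;
  source_layer : forall v, is_source edge v -> layer v = 0;
  sink_layer : forall v, is_sink edge v -> layer v = (\max_u layer u)%N;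
  inode_inj : injective inode;
  codom_inode : forall v, (v \in codom inode) = is_source edge v;
  onode_inj : injective onode;
  codom_onode : forall v, (v \in codom onode) = is_sink edge v }.

Section compositional.
Context {R : realType} {d q : nat}.
Implicit Types (F : compfun R d q).

Definition indeg F (v : node F) : nat := #|[pred u | edge u v]|.

Definition is_input F (v : node F) : bool := is_source (@edge _ _ _ F) v.
Definition is_output F (v : node F) : bool := is_sink (@edge _ _ _ F) v.

(* Values of the nodes when the values of all nodes in layers <= i are given by
   w; the recursion depth needed at v is at most layer v. *)
Fixpoint node_val_rec F (i : nat) (w : node F -> R) (fuel : nat)
    (v : node F) : R :=
  if (layer v <= i)%N then w v
  else if fuel is p.+1 then
    fnode (\row_j node_val_rec i w p (@enum_val _ [pred u | edge u v] j))
  else 0.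

Definition node_val F i w (v : node F) : R := node_val_rec i w (layer v) v.

Lemma node_valE F i w (v : node F) :
  node_val i w v =
    if (layer v <= i)%N then w v
    else fnode (\row_j node_val i w (@enum_val _ [pred u | edge u v] j)).
Proof.
have fuelE p p' u : (layer u <= p)%N -> (layer u <= p')%N ->
    node_val_rec i w p u = node_val_rec i w p' u.
  elim: p p' u => [|p IHp] [|p'] u up up' /=; case: (leqP (layer u) i) => // iu.
  - by move: iu; rewrite ltnNge (leq_trans up).
  - by move: iu; rewrite ltnNge (leq_trans up').
  congr (@fnode _ _ _ F u _); apply/rowP => j; rewrite !mxE.
  have := enum_valP j; rewrite inE => /edge_layer ju.
  by apply: IHp; rewrite -ltnS (leq_trans ju).
rewrite /node_val; case Ev: (layer v) => [|p] /=; rewrite Ev //; case: ifP => // _.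
congr (@fnode _ _ _ F v _); apply/rowP => j; rewrite !mxE.
have := enum_valP j; rewrite inE => /edge_layer; rewrite Ev ltnS => ju.
exact: fuelE.
Qed.

Definition truncation F (i : nat) (w : node F -> R) : 'rV[R]_q :=
  \row_j node_val i w (onode F j).

Definition input_val F (x : 'rV[R]_d) (v : node F) : R :=
  if [pick j | inode F j == v] is Some j then x 0 j else 0.

(* The nodes of layer 0 are exactly the input nodes. *)
Definition ceval F (x : 'rV[R]_d) : 'rV[R]_q := truncation 0 (@input_val F x).

Definition affine_fun k (h : 'rV[R]_k -> R) : Prop :=
  exists (a : 'rV[R]_k) (b : R), forall x, h x = \sum_i a 0 i * x 0 i + b.

Definition is_general F (v : node F) : bool :=
  ~~ is_input v && ~~ `[< affine_fun (@fnode _ _ _ F v) >].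

Definition card_general F : nat := #|[pred v | @is_general F v]|.

(* rad v is the radius of the cube on which the node function of v is
   considered, m v its smoothness; rad is irrelevant on input nodes, m on
   nodes that are not general. *)
Definition assumptionA F (Rb : R) (rad : node F -> R) (m : node F -> nat) :
    Prop :=
  [/\ [/\ 0 < Rb, (0 < d)%N & (0 < q)%N],
      forall v, ~~ is_input v -> 0 < rad v,
      forall v, is_general v ->
        (0 < m v)%N /\ sobolev (m v) (rad v) (@fnode _ _ _ F v)
    & forall u v, edge u v ->
        (is_input u -> Rb < rad v) /\
        (~~ is_input u ->
         forall x, cube (rad u) x -> `|@fnode _ _ _ F u x| < rad v)].

(* The truncation along layer i is defined as long as each free variable
   lies in the domains of the nodes of the remaining layers that read it. *)
Definition trunc_dom F (rad : node F -> R) (i : nat) (w : node F -> R) : Prop :=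
  forall u v, edge u v -> (layer u <= i < layer v)%N -> `|w u| <= rad v.

Definition node_lipschitz F (rad : node F -> R) (v : node F) (L : R) : Prop :=
  forall w w' : node F -> R,
    trunc_dom rad (layer v) w -> trunc_dom rad (layer v) w' ->
    (forall u, u != v -> w u = w' u) ->
    enorm (truncation (layer v) w - truncation (layer v) w')
      <= L * `|w v - w' v|.

(* (r, Lam, Lmax, card_general F) are compositional features. *)
Definition features F (rad : node F -> R) (m : node F -> nat)
    (r Lam Lmax : R) : Prop :=
  [/\ [/\ 0 < r, 0 < Lam, 0 < Lmax & (0 < card_general F)%N],
      forall v : node F, is_general v -> (indeg v)%:R / (m v)%:R <= r,
      forall v : node F, is_general v ->
        ((Num.max (rad v ^+ m v) 1)%:E *
           sobolev_sum (m v) (rad v) (@fnode _ _ _ F v) <= Lam%:E)%E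
    & forall v : node F, is_general v ->
        exists2 L : R, node_lipschitz rad v L & `|L| <= Lmax].

Definition dims F (m : node F -> nat) : set (nat * nat) :=
  [set (indeg v, m v) | v in [set v | is_general v]].

(* The sum at an output node ranges over its predecessors, which lie in
   previous layers. *)
Definition is_nn (sigma : R -> R) F : Prop :=
  [/\ (0 < \max_(v : node F) layer v)%N,
      forall v : node F, is_general v ->
        exists (a : 'rV[R]_(indeg v)) (b : R),
          forall x, fnode x = sigma (\sum_i a 0 i * x 0 i + b)
    & forall v : node F, is_output v ->
        exists a : 'rV[R]_(indeg v), forall x, fnode x = \sum_i a 0 i * x 0 i].

Definition nn_size F : nat :=
  #|[pred v : node F | ~~ is_input v && ~~ is_output v]|.

End compositional.

(* The approximation theorem of Kang and Gong for the activation function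
   sigma, with C D the constant determined by the set D of pairs
   (dimension, smoothness) of the general nodes. *)
Definition kang_gong (R : realType) (sigma : R -> R)
    (C : set (nat * nat) -> R) : Prop :=
  (forall D, 0 < C D) /\
  forall (d q : nat) (F : compfun R d q) (Rb : R) (rad : node F -> R)
      (m : node F -> nat) (r Lam Lmax : R),
    assumptionA Rb rad m -> features rad m r Lam Lmax ->
    forall nw : nat, (0 < nw)%N ->
    exists NN : compfun R d q,
      [/\ is_nn sigma NN, nn_size NN = (nw * card_general F)%N
        & forall x, cube Rb x ->
            enorm (ceval F x - ceval NN x) <=
              C (dims m) * Lam * Lmax * (card_general F)%:R * nw%:R `^ (- r^-1)].

Definition nodes_C2 (R : realType) (d q : nat) (F : compfun R d q) : Prop :=
  forall v : node F, ~~ is_input v -> twice_cont_diff (@fnode _ _ _ F v).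

Section control.
Context {R : realType} {n q N : nat}.

(* R^(qN) is 'rV_(N * q); u_k is the k-th block of length q of U. *)
Definition control (U : 'rV[R]_(N * q)) (k : nat) : 'rV[R]_q :=
  if insub k is Some i then row (i : 'I_N) (vec_mx U) else 0.

Fixpoint state (f : 'rV[R]_n -> 'rV[R]_q -> 'rV[R]_n) (x : 'rV[R]_n)
    (U : 'rV[R]_(N * q)) (k : nat) : 'rV[R]_n :=
  if k is p.+1 then f (state f x U p) (control U p) else x.

Definition cost (f : 'rV[R]_n -> 'rV[R]_q -> 'rV[R]_n) (g : 'rV[R]_n -> R)
    (x : 'rV[R]_n) (U : 'rV[R]_(N * q)) : R := g (state f x U N).

End control.

(* Polynomials in finitely many variables as functions of a list of values. *)
Definition peval (R : realType) k (p : mpoly k R) (s : seq R) : R :=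
  meval (fun i : 'I_k => s`_i) p.

Definition pnonneg (R : realType) k (p : mpoly k R) : Prop :=
  forall s : seq R, all (fun a => 0 <= a) s -> 0 <= peval p s.

(* Main.v *)
From HB Require Import structures.
Require Import Defs.
From mathcomp Require Import all_boot all_order all_algebra.
From mathcomp Require Import all_classical all_reals all_analysis.
From mathcomp Require Import measurable_realfun ring lra.

(** The network performs, for all initial states [x] at once, gradient descent on an
    approximation of the cost [J x U], and outputs the average of the iterates.

    Networks. Affine nodes can be folded into the nodes that read them, so that linear
    arithmetic costs nothing; only the hidden nodes of the approximants of [f] and [g]
    count. [program_substitution] and [program_realization] translate between networks
    and lists of hidden nodes. If the approximants have [nw] hidden nodes per general
    node, one evaluation of the approximate cost needs [nw (N |Vf| + |Vg|)] hidden nodes.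

    Descent. Let [D = q N] be the number of control variables. Gradients are replaced by
    forward differences, at the price of [D + 1] evaluations per step. Convexity and the
    bound [L2] on the Hessian make the gradient cocoercive ([gradient_cocoercive]), and a
    regret estimate for the averaged iterates follows ([average_gap]). The Hessian and the
    approximate cost are controlled in the ball of radius [2 gam] around [U0] only; pulling
    each iterate slightly towards [U0] keeps all points in it ([anchored_step_bound]).
    About [4 L2 gam^2 / eps] steps suffice, provided that the cost is known up to a
    multiple of [eps^4 / (L2^3 gam^6 D)]. If [L2 gam^2 <= eps], the constant control [U0]
    is good enough ([anchor_gap]).

    Approximate cost. The approximate trajectory follows the exact one up to the error of
    the approximant of [f] times a geometric sum of powers of [Lf]. Its last state is close
    to the cube of radius [Rb], but may lie outside of it, where nothing is known about
    the approximant of [g]. Multiplying the state by [1 - eta] with a small [eta] moves it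
    into the cube; estimating the effect by [Lg] would cost a factor [sqrt n], which the
    bound on the size does not have. Instead, [scaled_evaluation] shows that [g] changes
    by [eta] times an explicit linear function, which the network adds back, up to
    [eta |Vg| Lmaxg Lamg]: the affine nodes of [g] account for the linear function, and
    the Sobolev bounds control the general nodes in the sup norm, relative to the radius
    of their domains. This uses that an essential supremum of a continuous function is a
    supremum, because boxes are not null sets ([box_not_null]).

    Size. The error of the approximate cost is at most [nw^(-1/r)] times a constant
    of degree at most one in each feature of [f] and [g] ([surrogate_cost_error]), which
    determines [nw] ([width_exists]); the number of steps, of evaluations per step and of hidden nodes per
    evaluation are multiplied in [size_bound]. *)

Local Open Scope classical_set_scope.
Local Open Scope ring_scope.

(** * The Euclidean norm *)

Section euclidean_theory.
Set Implicit Arguments.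
Unset Strict Implicit.
Context {R : realType}.

Definition dot k (x y : 'rV[R]_k) : R := \sum_i x 0 i * y 0 i.

Section fixed_dimension.
Variable k : nat.
Implicit Types (x y z : 'rV[R]_k) (c : R).

Lemma dotC x y : dot x y = dot y x.
Proof. by apply: eq_bigr => i _; rewrite mulrC. Qed.

Lemma dotDl x y z : dot (x + y) z = dot x z + dot y z.
Proof. by rewrite -big_split/=; apply: eq_bigr => i _; rewrite mxE mulrDl. Qed.

Lemma dotZl c x y : dot (c *: x) y = c * dot x y.
Proof. by rewrite mulr_sumr; apply: eq_bigr => i _; rewrite mxE mulrA. Qed.

Lemma dot0l x : dot 0 x = 0.
Proof. by rewrite -(scale0r x) dotZl mul0r. Qed.

Lemma dotNl x y : dot (- x) y = - dot x y.
Proof. by rewrite -scaleN1r dotZl mulN1r. Qed.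

Lemma dotBl x y z : dot (x - y) z = dot x z - dot y z.
Proof. by rewrite dotDl dotNl. Qed.

Lemma dotDr x y z : dot x (y + z) = dot x y + dot x z.
Proof. by rewrite dotC dotDl !(dotC x). Qed.

Lemma dotZr c x y : dot x (c *: y) = c * dot x y.
Proof. by rewrite dotC dotZl dotC. Qed.

Lemma dotNr x y : dot x (- y) = - dot x y.
Proof. by rewrite dotC dotNl dotC. Qed.

Lemma dotBr x y z : dot x (y - z) = dot x y - dot x z.
Proof. by rewrite dotDr dotNr. Qed.

Lemma dot_suml I (s : seq I) (f : I -> 'rV[R]_k) y :
  dot (\sum_(i <- s) f i) y = \sum_(i <- s) dot (f i) y.
Proof.
elim: s => [|i s IHs]; first by rewrite !big_nil dot0l.
by rewrite !big_cons dotDl IHs.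
Qed.

Lemma dot_deltal i x : dot (delta_mx 0 i) x = x 0 i.
Proof.
rewrite /dot (bigD1 i)//= mxE !eqxx mul1r big1 ?addr0// => j ji.
by rewrite mxE eqxx (negbTE ji) mul0r.
Qed.

Lemma dotxx_ge0 x : 0 <= dot x x.
Proof. by apply: sumr_ge0 => i _; rewrite -expr2 sqr_ge0. Qed.

Lemma enorm_sqr x : enorm x ^+ 2 = dot x x.
Proof.
rewrite /enorm sqr_sqrtr; first by apply: eq_bigr => i _; rewrite expr2.
by apply: sumr_ge0 => i _; rewrite sqr_ge0.
Qed.

Lemma enorm_ge0 x : 0 <= enorm x.
Proof. exact: sqrtr_ge0. Qed.

Lemma enorm_le x c : 0 <= c -> dot x x <= c ^+ 2 -> enorm x <= c.
Proof. by move=> c0; rewrite -enorm_sqr ler_sqr ?nnegrE ?enorm_ge0. Qed.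

Lemma enorm0 : enorm (0 : 'rV[R]_k) = 0.
Proof. by rewrite /enorm big1 ?sqrtr0// => i _; rewrite mxE expr0n. Qed.

Lemma enormZ c x : enorm (c *: x) = `|c| * enorm x.
Proof.
apply/eqP; rewrite -(@eqrXn2 _ 2) ?enorm_ge0 ?mulr_ge0 ?enorm_ge0//.
by rewrite enorm_sqr exprMn enorm_sqr dotZl dotZr mulrA -normrX ger0_norm ?sqr_ge0.
Qed.

Lemma enormN x : enorm (- x) = enorm x.
Proof. by rewrite -scaleN1r enormZ normrN1 mul1r. Qed.

Lemma enormBC x y : enorm (x - y) = enorm (y - x).
Proof. by rewrite -enormN opprB. Qed.

Lemma coord_le_enorm x i : `|x 0 i| <= enorm x.
Proof.
rewrite -(ler_sqr (normr_ge0 _) (enorm_ge0 _)) enorm_sqr /dot (bigD1 i)//=.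
rewrite -normrX ger0_norm ?sqr_ge0// -expr2 lerDl.
by apply: sumr_ge0 => j _; rewrite -expr2 sqr_ge0.
Qed.

Lemma enorm_eq0 x : enorm x = 0 -> x = 0.
Proof.
move=> x0; apply/rowP => i; rewrite mxE; apply/eqP; rewrite -normr_le0 -x0.
exact: coord_le_enorm.
Qed.

(** The squared norm of [|y|^2 x - <x, y> y] is nonnegative. *)
Lemma cauchy_schwarz x y : `|dot x y| <= enorm x * enorm y.
Proof.
have [y0|y0] := eqVneq (enorm y) 0.
  by rewrite y0 mulr0 (enorm_eq0 y0) dotC -(scale0r x) dotZl mul0r normr0.
rewrite -(ler_sqr (normr_ge0 _)) ?nnegrE ?mulr_ge0 ?enorm_ge0// -normrX ger0_norm ?sqr_ge0//.
rewrite exprMn !enorm_sqr.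
have yy : 0 < dot y y by rewrite -enorm_sqr exprn_gt0// lt_neqAle eq_sym y0 enorm_ge0.
have := dotxx_ge0 (dot y y *: x - dot x y *: y).
rewrite dotBl !dotBr !dotZl !dotZr (dotC y x).
rewrite (_ : _ - _ = dot y y * (dot x x * dot y y - dot x y ^+ 2)); last by ring.
by rewrite pmulr_rge0// subr_ge0.
Qed.

Lemma dot_le x y : dot x y <= enorm x * enorm y.
Proof. exact: le_trans (ler_norm _) (cauchy_schwarz x y). Qed.

Lemma enormD x y : enorm (x + y) <= enorm x + enorm y.
Proof.
apply: enorm_le; first by rewrite addr_ge0 ?enorm_ge0.
rewrite dotDl !dotDr sqrrD !enorm_sqr (dotC y x).
by have := dot_le x y; lra.
Qed.

Lemma enorm_triangle y x z : enorm (x - z) <= enorm (x - y) + enorm (y - z).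
Proof. by rewrite -(subrKA y); exact: enormD. Qed.

Lemma enorm_sum I (s : seq I) (f : I -> 'rV[R]_k) :
  enorm (\sum_(i <- s) f i) <= \sum_(i <- s) enorm (f i).
Proof.
elim: s => [|i s IHs]; first by rewrite !big_nil enorm0.
by rewrite !big_cons (le_trans (enormD _ _))// lerD2l.
Qed.

Lemma enorm_le_max x c : 0 <= c -> (forall i, `|x 0 i| <= c) ->
  enorm x <= Num.sqrt k%:R * c.
Proof.
move=> c0 H; apply: enorm_le; first by rewrite mulr_ge0 ?sqrtr_ge0.
rewrite exprMn sqr_sqrtr ?ler0n//.
apply: (@le_trans _ _ (\sum_(i < k) c ^+ 2)); last by rewrite sumr_const card_ord [leRHS]mulr_natl.
apply: ler_sum => i _; rewrite -expr2 -real_normK ?num_real//.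
by rewrite ler_sqr ?nnegrE.
Qed.

End fixed_dimension.

End euclidean_theory.

(** * Continuous partial derivatives imply differentiability *)

Section calculus.
Set Implicit Arguments.
Unset Strict Implicit.
Context {R : realType}.

Lemma is_derive_line k (h : 'rV[R]_k -> R) x v t :
  derivable h (x + t *: v) v ->
  is_derive t 1 (fun s : R => h (x + s *: v)) ('D_v h (x + t *: v)).
Proof.
move=> dh.
have E : (fun s : R => s^-1 *: (h (x + (s *: 1 + t) *: v) - h (x + t *: v))) =
         (fun s : R => s^-1 *: (h (s *: v + (x + t *: v)) - h (x + t *: v))).
  apply/funext => s; congr (_ *: (h _ - _)).
  by rewrite scalerDl addrCA; congr (_ + _); rewrite -mulr_algl mulr1 /GRing.scale/= mulr1.
split; first by rewrite /derivable E.
by rewrite /derive E.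
Qed.

Lemma line_mvt k (h : 'rV[R]_k -> R) x v :
  (forall t, 0 <= t <= 1 -> derivable h (x + t *: v) v) ->
  exists2 t, 0 <= t <= 1 & h (x + v) - h x = 'D_v h (x + t *: v).
Proof.
move=> dh.
have [||t] := @MVT_segment R (fun s : R => h (x + s *: v))
   (fun s => 'D_v h (x + s *: v)) 0 1 ler01.
- by move=> t; rewrite in_itv/= => /andP[t0 t1]; apply/is_derive_line/dh; lra.
- apply: derivable_within_continuous => t; rewrite in_itv/= => t01.
  by apply: ex_derive; apply/is_derive_line/dh.
rewrite in_itv/= => t01; rewrite scale1r scale0r addr0 subr0 mulr1 => E.
by exists t.
Qed.

Lemma is_derive_scaled k (h : 'rV[R]_k -> R) x v (c : R) :
  derivable h x v -> is_derive x (c *: v) h (c * 'D_v h x).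
Proof.
move=> dh; have [->|c0] := eqVneq c 0.
  by rewrite scale0r mul0r; exact: is_derive0.
have L := @is_derive_line k h x v 0; rewrite scale0r addr0 in L.
have {}L := L dh.
have D : is_derive (0 : R) 1 (fun s : R => h (x + s *: (c *: v))) (c * 'D_v h x).
  have -> : (fun s : R => h (x + s *: (c *: v))) =
     (fun s : R => h (x + s *: v)) \o (fun s => c * s).
    by apply/funext => s /=; rewrite scalerA mulrC.
  apply: is_derive_eq.
    apply: is_derive1_comp; rewrite mulr0; exact: L.
  by rewrite /GRing.scale/= mulr1 mulrC.
have E : (fun s : R => s^-1 *: (h (x + (s *: 1 + 0) *: (c *: v)) - h (x + 0 *: (c *: v)))) =
         (fun s : R => s^-1 *: (h (s *: (c *: v) + x) - h x)).
  apply/funext => s; rewrite scale0r !addr0 [x + _]addrC.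
  by rewrite /GRing.scale/= mulr1.
case: D => D1 D2; split.
  by move: D1; rewrite /derivable E.
by rewrite -D2 /derive E.
Qed.

Lemma rV_norm_le k (v : 'rV[R]_k) (c : R) : 0 <= c ->
  (forall i, `|v 0 i| <= c) -> `|v| <= c.
Proof.
move=> c0 H; rewrite [`|v|]mx_normrE.
by apply/bigmax_leP; split=> // -[i j] _ /=; rewrite ord1.
Qed.

Lemma rV_norm_ge k (v : 'rV[R]_k) i : `|v 0 i| <= `|v|.
Proof.
by rewrite [`|v|]mx_normrE; apply: (le_bigmax _ (fun ij => `|v ij.1 ij.2|) (0, i)).
Qed.

(** The corner reached after [m] legs of the path from 0 to [v] that follows the
    coordinate axes one after the other. *)
Definition trunc_rV k (m : nat) (v : 'rV[R]_k) : 'rV[R]_k :=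
  \row_i (if (i < m)%N then v 0 i else 0).

Lemma trunc_rV0 k (v : 'rV[R]_k) : trunc_rV 0 v = 0.
Proof. by apply/rowP => i; rewrite !mxE. Qed.

Lemma trunc_rV_full k (v : 'rV[R]_k) : trunc_rV k v = v.
Proof. by apply/rowP => i; rewrite !mxE ltn_ord. Qed.

Lemma trunc_rVS k (v : 'rV[R]_k) (i : 'I_k) :
  trunc_rV i.+1 v = trunc_rV i v + v 0 i *: delta_mx 0 i.
Proof.
apply/rowP => j; rewrite !mxE eqxx/= ltnS leq_eqVlt -val_eqE /=.
by have [/val_inj->|] := eqVneq (val j) i; rewrite /= ?ltnn ?add0r ?mulr1 ?mulr0 ?addr0.
Qed.

Lemma increment_trunc k (h : 'rV[R]_k -> R) x v :
  h (x + v) - h x =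
  \sum_(i < k) (h (x + trunc_rV i.+1 v) - h (x + trunc_rV i v)).
Proof.
rewrite -(big_mkord xpredT (fun i => h (x + trunc_rV i.+1 v) - h (x + trunc_rV i v))).
by rewrite telescope_sumr // trunc_rV0 trunc_rV_full addr0.
Qed.

(** The mean value theorem on each leg of the coordinate path from [x] to [x + v]:
    only partial derivatives enter, and the points [xi i] tend to [x] with [v]. *)
Lemma increment_sum k (h : 'rV[R]_k -> R) x v :
  (forall (i : 'I_k) y, derivable h y (delta_mx 0 i)) ->
  exists2 xi : 'I_k -> 'rV[R]_k,
    forall i : 'I_k, exists2 t : R, 0 <= t <= 1 &
       xi i = x + (trunc_rV i v + t *: (v 0 i *: delta_mx 0 i)) &
    h (x + v) - h x = \sum_i v 0 i * partial i h (xi i).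
Proof.
move=> dh.
have H (i : 'I_k) : exists xi : 'rV[R]_k, (exists2 t : R, 0 <= t <= 1 &
       xi = x + (trunc_rV i v + t *: (v 0 i *: delta_mx 0 i))) /\
    h (x + trunc_rV i.+1 v) - h (x + trunc_rV i v) = v 0 i * partial i h xi.
  rewrite trunc_rVS addrA.
  have [t|t t01 ->] := @line_mvt k h (x + trunc_rV i v) (v 0 i *: delta_mx 0 i).
    by move=> _; have [] := @is_derive_scaled k h _ _ (v 0 i) (dh i (x + trunc_rV i v + t *: (v 0 i *: delta_mx 0 i))).
  exists (x + trunc_rV i v + t *: (v 0 i *: delta_mx 0 i)); split.
    by exists t => //; rewrite addrA.
  by have [_ ->] := @is_derive_scaled k h _ _ (v 0 i) (dh i (x + trunc_rV i v + t *: (v 0 i *: delta_mx 0 i))).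
have /choice[xi Hxi] := H; exists xi => [i|]; first by case: (Hxi i).
by rewrite increment_trunc; apply: eq_bigr => i _; case: (Hxi i).
Qed.

Lemma norm_trunc_seg k (v : 'rV[R]_k) (i : 'I_k) t j : 0 <= t <= 1 ->
  `|(trunc_rV i v + t *: (v 0 i *: delta_mx 0 i)) 0 j| <= `|v 0 j|.
Proof.
move=> t01; rewrite !mxE eqxx/=; have [->|ji] := eqVneq j i.
  rewrite ltnn add0r mulr1 normrM ler_piMl// ger0_norm; by case/andP: t01.
by rewrite !mulr0 addr0; case: ifP => // _; rewrite normr0.
Qed.

(** By [increment_sum] the error of the linear expansion is a combination of
    increments of the partial derivatives, which are small near [x]. *)
Lemma cont_diff_expansion k (h : 'rV[R]_k -> R) x (e : R) : cont_diff h -> 0 < e ->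
  \forall v \near (0 : 'rV[R]_k),
    `|h (x + v) - h x - \sum_i v 0 i * partial i h x| <= e * `|v|.
Proof.
move=> ch e0; pose e' := e / (k.+1)%:R.
have e'0 : 0 < e' by rewrite divr_gt0.
have : \forall y \near x, forall i, `|partial i h x - partial i h y| < e'.
  apply: (@filter_forall _ _ (fun i y => `|partial i h x - partial i h y| < e') (nbhs x)) => i.
  by have [_ /(_ x) /cvgrPdist_lt /(_ _ e'0)] := ch i.
move=> /nbhs_ballP[d /= d0 hd].
apply/nbhs_ballP; exists d => //= v; rewrite -ball_normE/= sub0r normrN => vd.
have [|xi Hxi ->] := @increment_sum k h x v; first by move=> i y; case: (ch i).
rewrite -sumrB; apply: (le_trans (ler_norm_sum _ _ _)).
apply: (@le_trans _ _ (\sum_(i < k) e' * `|v|)); last first.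
  rewrite sumr_const card_ord -mulr_natl mulrA ler_wpM2r// /e' mulrCA ler_piMr ?(ltW e0)//.
  by rewrite ler_pdivrMr// mul1r ler_nat.
apply: ler_sum => i _; rewrite -mulrBr normrM mulrC ler_pM//; last exact: rV_norm_ge.
have [t t01 Exi] := Hxi i; rewrite distrC ltW// hd// -ball_normE/= Exi opprD addNKr normrN.
apply: le_lt_trans vd; apply: rV_norm_le => // j.
by apply: le_trans (rV_norm_ge v j); exact: norm_trunc_seg.
Qed.

Definition grad_form k (h : 'rV[R]_k -> R) x (v : 'rV[R]_k) : R^o :=
  \sum_i v 0 i * partial i h x.

Lemma grad_form_is_linear k (h : 'rV[R]_k -> R) x : linear (grad_form h x).
Proof.
move=> a u v; rewrite /grad_form scaler_sumr -big_split/=; apply: eq_bigr => i _.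
by rewrite !mxE mulrDl -mulrA.
Qed.
HB.instance Definition _ k (h : 'rV[R]_k -> R) x :=
  GRing.isLinear.Build R 'rV[R]_k R^o _ (grad_form h x) (grad_form_is_linear h x).

Lemma cont_diff_diffE k (h : 'rV[R]_k -> R) x : cont_diff h ->
  differentiable h x /\ 'd h x = grad_form h x :> (_ -> _).
Proof.
move=> ch.
have cg : continuous (grad_form h x : 'rV[R]_k -> R).
  move=> v; rewrite /grad_form; apply: (@cvg_big _ _ _ _ _ _ _ (nbhs v)) => [|i _]; first exact: add_continuous.
  by apply: (@cvgMr_tmp _ _ (nbhs v)); exact: coord_continuous.
have E : h \o shift x = cst (h x) + grad_form h x +o_ 0 id.
  apply/eqaddoP => e e0.
  have := cont_diff_expansion x ch e0; apply: filterS => v.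
  suff -> : (h \o shift x - (cst (h x) + grad_form h x)) v = h (x + v) - h x - grad_form h x v by [].
  by rewrite fctE /= fctE /cst opprD addrA; congr (h _ - _ - _); rewrite /shift addrC.
have D := diff_unique cg E; split; last exact: D.
by apply/diff_locallyP; rewrite D.
Qed.

End calculus.

(** * The chain rule and the symmetry of second derivatives *)

Section chain_rule.
Set Implicit Arguments.
Unset Strict Implicit.
Context {R : realType}.

Lemma cont_diff_continuous k (h : 'rV[R]_k -> R) : cont_diff h -> continuous h.
Proof.
by move=> ch x; apply: differentiable_continuous; have [] := cont_diff_diffE x ch.
Qed.

Lemma derive_grad_form k (h : 'rV[R]_k -> R) (x v : 'rV[R]_k) : cont_diff h ->
  derivable h x v /\ 'D_v h x = grad_form h x v.
Proof.
move=> /(cont_diff_diffE x)[dh E]; split; first exact: diff_derivable.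
by rewrite deriveE// E.
Qed.

Lemma cont_diff_line k (h : 'rV[R]_k -> R) (x v : 'rV[R]_k) (t : R) : cont_diff h ->
  is_derive t 1 (fun s : R => h (x + s *: v)) (grad_form h (x + t *: v) v).
Proof.
move=> ch; have [dh <-] := derive_grad_form (x + t *: v) v ch.
exact: is_derive_line.
Qed.

Lemma cont_diff_mvt k (h : 'rV[R]_k -> R) (x v : 'rV[R]_k) : cont_diff h ->
  exists2 t : R, 0 <= t <= 1 & h (x + v) - h x = grad_form h (x + t *: v) v.
Proof.
move=> ch; have [t _|t t01 ->] := @line_mvt _ _ h x v.
  by have [] := derive_grad_form (x + t *: v) v ch.
by exists t => //; have [] := derive_grad_form (x + t *: v) v ch.
Qed.

Lemma cont_diff_cst k (c : R) : cont_diff (fun _ : 'rV[R]_k => c).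
Proof.
move=> i; split; first by move=> x; exact: derivable_cst.
rewrite (_ : partial i _ = cst 0); first exact: cst_continuous.
by apply/funext => x; exact: derive_cst.
Qed.

Lemma cont_diffD k (h1 h2 : 'rV[R]_k -> R) :
  cont_diff h1 -> cont_diff h2 -> cont_diff (fun x => h1 x + h2 x).
Proof.
move=> c1 c2 i; split; first by move=> x; apply: derivableD; [case: (c1 i)|case: (c2 i)].
rewrite (_ : partial i _ = fun x => partial i h1 x + partial i h2 x).
  by move=> x; apply: (@cvgD _ _ _ (nbhs x)); [case: (c1 i) => _|case: (c2 i) => _]; apply.
by apply/funext => x; apply: deriveD; [case: (c1 i)|case: (c2 i)].
Qed.

Lemma cont_diffM k (h1 h2 : 'rV[R]_k -> R) :
  cont_diff h1 -> cont_diff h2 -> cont_diff (fun x => h1 x * h2 x).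
Proof.
move=> c1 c2 i; split; first by move=> x; apply: derivableM; [case: (c1 i)|case: (c2 i)].
rewrite (_ : partial i _ = fun x => h1 x * partial i h2 x + h2 x * partial i h1 x).
  move=> x; apply: (@cvgD _ _ _ (nbhs x)); apply: (@cvgM _ _ (nbhs x)).
  - exact: cont_diff_continuous c1 x.
  - by case: (c2 i) => _; apply.
  - exact: cont_diff_continuous c2 x.
  - by case: (c1 i) => _; apply.
by apply/funext => x; apply: deriveM; [case: (c1 i)|case: (c2 i)].
Qed.

Lemma cont_diff_sum k I (r : seq I) (h : I -> 'rV[R]_k -> R) :
  (forall j, cont_diff (h j)) -> cont_diff (fun x => \sum_(j <- r) h j x).
Proof.
move=> ch; elim: r => [|j r IHr].
  by rewrite (_ : (fun _ => _) = (fun _ => 0)); [exact: cont_diff_cst|apply/funext => x; rewrite big_nil].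
rewrite (_ : (fun _ => _) = (fun x => h j x + \sum_(j <- r) h j x)).
  exact: cont_diffD.
by apply/funext => x; rewrite big_cons.
Qed.

Lemma twice_cont_diff_cst k (c : R) : twice_cont_diff (fun _ : 'rV[R]_k => c).
Proof.
split=> [|i]; first exact: cont_diff_cst.
rewrite (_ : partial i _ = (fun=> 0)); first exact: cont_diff_cst.
by apply/funext => x; exact: derive_cst.
Qed.

Lemma partial_coord k (i j : 'I_k) (x : 'rV[R]_k) :
  derivable (fun y : 'rV[R]_k => y 0 j) x (delta_mx 0 i) /\
  partial i (fun y : 'rV[R]_k => y 0 j) x = (j == i)%:R.
Proof.
have /= df := @differentiable_coord R 1 k x 0 j; split; first exact: diff_derivable.
rewrite /partial /derive.
rewrite (_ : (fun h => _) = (fun h : R => h^-1 *: (h * (j == i)%:R))); last first.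
  by apply/funext => h; rewrite /= !mxE eqxx/= addrK.
apply/cvg_lim => //.
apply: cvg_near_cst.
by near=> h; rewrite /GRing.scale/= mulKf//; near: h; exact: nbhs_dnbhs_neq.
Unshelve. all: by end_near. Qed.

Lemma twice_cont_diff_coord k (j : 'I_k) : twice_cont_diff (fun y : 'rV[R]_k => y 0 j).
Proof.
have P i : partial i (fun y : 'rV[R]_k => y 0 j) = (fun=> (j == i)%:R).
  by apply/funext => x; case: (partial_coord i j x).
split=> i; last by rewrite P; exact: cont_diff_cst.
by split; [move=> x; case: (partial_coord i j x)|rewrite P; exact: cst_continuous].
Qed.

Section composition.
Variables (k l : nat) (h : 'rV[R]_l -> R) (phi : 'I_l -> 'rV[R]_k -> R).
Let Phi (x : 'rV[R]_k) : 'rV[R]_l := \row_j phi j x.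

Lemma partial_comp i x : cont_diff h -> (forall j, cont_diff (phi j)) ->
  derivable (fun y => h (\row_j phi j y)) x (delta_mx 0 i) /\
  partial i (fun y => h (\row_j phi j y)) x =
     \sum_j partial i (phi j) x * partial j h (\row_j phi j x).
Proof.
move=> ch cphi.
have dP : differentiable Phi x.
  rewrite (_ : Phi = \sum_j (fun y => phi j y *: (delta_mx 0 j : 'rV[R]_l))).
    apply: differentiable_sum => j; apply: differentiableZl.
    by have [] := cont_diff_diffE x (cphi j).
  apply/funext => y; rewrite fct_sumE; apply/rowP => j; rewrite summxE (bigD1 j)//=.
  rewrite !mxE !eqxx mulr1 big1 ?addr0// => j' jj'.
  by rewrite !mxE eqxx/= eq_sym (negbTE jj') mulr0.
have [dh dhE] := cont_diff_diffE (Phi x) ch.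
have dhP : differentiable (h \o Phi) x by exact: differentiable_comp.
split; first exact: diff_derivable.
rewrite /partial -/(h \o Phi) deriveE// diff_comp//= dhE -(deriveE _ dP) derive_mx; last exact: diff_derivable.
have E j : (fun y => Phi y 0 j) = phi j by apply/funext => y; rewrite mxE.
by rewrite /grad_form; apply: eq_bigr => j _; rewrite mxE E.
Qed.

Lemma continuous_row (psi : 'I_l -> 'rV[R]_k -> R) : (forall j, continuous (psi j)) ->
  continuous (fun x => \row_j psi j x : 'rV[R]_l).
Proof.
move=> cpsi x; apply/(@cvg_ballP R _ _ (nbhs x) _) => e e0.
have : \forall y \near x, forall j, `|psi j x - psi j y| < e.
  apply: (@filter_forall _ _ (fun j y => `|psi j x - psi j y| < e) (nbhs x)) => j.
  by have /cvgrPdist_lt /(_ _ e0) := cpsi j x.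
by apply: filterS => y H; split=> // i j /=; rewrite !mxE -ball_normE; exact: H.
Qed.

Lemma cont_diff_comp : cont_diff h -> (forall j, cont_diff (phi j)) ->
  cont_diff (fun y => h (\row_j phi j y)).
Proof.
move=> ch cphi i; split; first by move=> x; have [] := partial_comp i x ch cphi.
rewrite (_ : partial i _ = fun x => \sum_j partial i (phi j) x * partial j h (\row_j phi j x)).
  move=> x; apply: (@cvg_big _ _ _ _ _ _ _ (nbhs x)) => [|j _]; first exact: add_continuous.
  apply: (@cvgM _ _ (nbhs x)); first by case: (cphi j i) => _; apply.
  apply: (@continuous_comp _ _ _ (fun x => \row_j phi j x) (partial j h)).
    by apply: continuous_row => j'; exact: cont_diff_continuous.
  by case: (ch j) => _; apply.
by apply/funext => x; have [] := partial_comp i x ch cphi.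
Qed.

End composition.

Lemma twice_cont_diff_comp k l (h : 'rV[R]_l -> R) (phi : 'I_l -> 'rV[R]_k -> R) :
  twice_cont_diff h -> (forall j, twice_cont_diff (phi j)) ->
  twice_cont_diff (fun y => h (\row_j phi j y)).
Proof.
move=> [ch ch2] cphi; have c1 j : cont_diff (phi j) by case: (cphi j).
split; first exact: cont_diff_comp.
move=> i.
rewrite (_ : partial i _ = fun x => \sum_j partial i (phi j) x * partial j h (\row_j phi j x)).
  apply: cont_diff_sum => j; apply: cont_diffM; first by case: (cphi j).
  exact: cont_diff_comp.
by apply/funext => x; have [] := @partial_comp k l h phi i x ch c1.
Qed.

Definition second_diff k (h : 'rV[R]_k -> R) x a b : R :=
  h (x + a + b) - h (x + a) - h (x + b) + h x.

Lemma second_diffC k (h : 'rV[R]_k -> R) x a b :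
  second_diff h x a b = second_diff h x b a.
Proof. by rewrite /second_diff (addrAC x b a) (addrAC (h (x + a + b))). Qed.

Lemma dist_le_of_halves (a b c e : R) : `|a - c| < e / 2 -> `|b - c| < e / 2 -> `|a - b| <= e.
Proof. by rewrite !ltr_norml ler_norml; lra. Qed.

(** The mean value theorem in direction [i], applied to the increment of [h] along
    [s e_j], and then in direction [j]. *)
Lemma second_difference k (h : 'rV[R]_k -> R) i j x (s : R) :
  cont_diff h -> cont_diff (partial i h) -> 0 < s ->
  exists2 y : 'rV[R]_k, (forall l, `|(y - x) 0 l| <= s + s) &
  second_diff h x (s *: delta_mx 0 i) (s *: delta_mx 0 j) = s ^+ 2 * partial j (partial i h) y.
Proof.
move=> ch chi s0.
have gE (u : 'rV[R]_k -> R) y l : grad_form u y (s *: delta_mx 0 l) = s * partial l u y.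
  rewrite /grad_form (bigD1 l)//= big1 ?addr0 ?mxE ?eqxx ?mulr1// => m ml.
  by rewrite !mxE eqxx/= (negbTE ml) mulr0 mul0r.
pose a : 'rV[R]_k := s *: delta_mx 0 i; pose b : 'rV[R]_k := s *: delta_mx 0 j.
pose u (t : R) := h (x + t *: a + b) - h (x + t *: a).
have du (t : R) : is_derive t 1 u (s * (partial i h (x + t *: a + b) - partial i h (x + t *: a))).
  rewrite mulrBr -!gE; apply: is_deriveB; last exact: cont_diff_line.
  rewrite (_ : (fun y => _) = (fun r : R => h (x + b + r *: a))); last first.
    by apply/funext => r; rewrite addrAC.
  by rewrite addrAC; exact: cont_diff_line.
have [|t] := @MVT_segment R u (fun t => s * (partial i h (x + t *: a + b) - partial i h (x + t *: a))) 0 1 ler01.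
- by apply: derivable_within_continuous => t _; apply: ex_derive; exact: du.
rewrite in_itv/= => t01; rewrite /u scale1r scale0r addr0 subr0 mulr1 opprB addrA => E.
have [r r01 Er] := @cont_diff_mvt k (partial i h) (x + t *: a) b chi.
exists (x + t *: a + r *: b); last first.
  by rewrite /second_diff [LHS]addrAC E Er gE mulrA expr2.
have ab c l m : 0 <= c <= 1 -> `|(c *: (s *: delta_mx (0 : 'I_1) l : 'rV[R]_k)) 0 m| <= s.
  case/andP=> c0 c1; rewrite !mxE !normrM (ger0_norm c0) (gtr0_norm s0) eqxx/=.
  case: (m == l); rewrite ?normr1 ?normr0 ?mulr1 ?mulr0 ?(ltW s0)//.
  by rewrite ler_piMl// ltW.
move=> l; rewrite [_ - x]addrC [- x + _]addrA addKr mxE.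
by apply: (le_trans (ler_normD _ _)); apply: lerD; exact: ab.
Qed.

(** The second difference does not change when [i] and [j] are exchanged; divided by
    [s^2] it is close to either mixed derivative at [x]. *)
Lemma partialC k (h : 'rV[R]_k -> R) i j x : twice_cont_diff h ->
  partial i (partial j h) x = partial j (partial i h) x.
Proof.
move=> [ch ch2]; apply/eqP; rewrite -subr_eq0 -normr_eq0; apply/eqP/le_anti; rewrite normr_ge0 andbT.
apply/ler_addgt0Pl => e e0; rewrite addr0.
have near_ p q : \forall y \near x, `|partial p (partial q h) x - partial p (partial q h) y| < e / 2.
  have [_ /(_ x)/cvgrPdist_lt] := ch2 q p; apply; lra.
have /nbhs_ballP[d /= d0 hd] : nbhs x ([set y | `|partial i (partial j h) x - partial i (partial j h) y| < e / 2] `&` [set y | `|partial j (partial i h) x - partial j (partial i h) y| < e / 2]).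
  by apply: filterI; exact: near_.
pose s : R := d / 3; have s0 : (0 : R) < s by rewrite /s; lra.
have B (y : 'rV[R]_k) : (forall l, `|(y - x) 0 l| <= s + s) -> ball x d y.
  move=> H; rewrite -ball_normE/= distrC; apply: (@le_lt_trans _ _ (s + s)).
    by apply: rV_norm_le => //; lra.
  by rewrite /s; lra.
have [y /B /hd[_ y1] Ey] := @second_difference k h i j x s ch (ch2 i) s0.
have [z /B /hd[z1 _] Ez] := @second_difference k h j i x s ch (ch2 j) s0.
have s20 : s ^+ 2 != 0 :> R by rewrite expf_neq0// gt_eqF.
have Eyz : partial j (partial i h) y = partial i (partial j h) z.
  apply: (mulfI s20 _).
  exact: (etrans (esym Ey) (etrans (second_diffC _ _ _ _) Ez)).
by apply: dist_le_of_halves z1 _; rewrite -Eyz.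
Qed.

End chain_rule.

(** * Null sets, and essential suprema of continuous functions *)

Section null_sets.
Set Implicit Arguments.
Unset Strict Implicit.
Context {R : realType}.

(** The weighted sum of the indicators has mean at most [e / (hi - lo)] over
    [[lo, hi]], so it is not everywhere larger than twice that. The factor 2 makes the
    comparison of the integrals strict. *)
Lemma weighted_cover_point (a b c : nat -> R) (lo hi e : R) :
  lo < hi -> 0 < e -> (forall j, a j <= b j) -> (forall j, 0 <= c j) ->
  (forall p, \sum_(j < p) (b j - a j) * c j <= e) ->
  exists2 t, lo <= t <= hi &
    forall p, \sum_(j < p) (a j <= t <= b j)%R%:R * c j <= e * (2 / (hi - lo)).
Proof.
move=> lohi e0 ab c0 Hsum; apply: contrapT => noT.
pose mu := @lebesgue_measure R.
pose f (j : nat) (t : measurableTypeR R) : \bar R := (c j * \1_(`[a j, b j]%classic) t)%:E.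
have f0 j t : (0 <= f j t)%E by rewrite lee_fin mulr_ge0.
have big t : `[lo, hi]%classic t -> ((e * (2 / (hi - lo)))%:E <= \sum_(0 <= j <oo) f j t)%E.
  rewrite /= in_itv/= => tlh; apply: contrapT => /negP; rewrite -ltNge => Hlt; apply: noT.
  exists t => // p; rewrite -lee_fin; apply/ltW/(le_lt_trans _ Hlt).
  apply: le_trans (nneseries_lim_ge p _) => //.
  rewrite sumEFin lee_fin big_mkord le_eqVlt; apply/orP; left; apply/eqP.
  apply: eq_bigr => j _; rewrite mulrC indicE; congr (_ * _%:R).
  by rewrite mem_setE in_itv.
have mD : measurable (`[lo, hi]%classic : set (measurableTypeR R)) by exact: measurable_itv.
have mf j : measurable_fun (`[lo, hi]%classic : set (measurableTypeR R)) (f j).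
  by apply/measurable_EFinP; exact: measurable_funM.
have := @integral_nneseries _ _ R mu _ mD f mf (fun j t _ => f0 j t).
have int_f j : (\int[mu]_(t in `[lo, hi]) f j t <= ((b j - a j) * c j)%:E)%E.
  rewrite /f; under eq_integral do rewrite EFinM.
  rewrite ge0_integralZl//.
  - rewrite integral_indic//.
    rewrite [(b j - a j) * _]mulrC EFinM lee_wpmul2l ?lee_fin//.
    apply: (le_trans (le_measure _ _ _ (@subIsetl _ _ _))); rewrite ?inE.
    + by apply: measurableI => //; exact: measurable_itv.
    + exact: measurable_itv.
    + by rewrite /mu /= lebesgue_measure_itv/= lte_fin; case: ifPn => // _; rewrite lee_fin subr_ge0.
  - apply/measurable_EFinP; apply: measurable_indic; exact: measurable_itv.
  - by rewrite lee_fin.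
move=> E.
have U : (\sum_(0 <= j <oo) \int[mu]_(t in `[lo, hi]) f j t <= e%:E)%E.
  apply: lime_le.
    by apply: is_cvg_nneseries => j _ _; apply: integral_ge0.
  near=> p; rewrite big_mkord; apply: le_trans (_ : \sum_(j < p) ((b j - a j) * c j)%:E <= _)%E.
    by apply: lee_sum => j _.
  by rewrite sumEFin lee_fin.
have L : ((2 * e)%:E <= \int[mu]_(t in `[lo, hi]) \sum_(0 <= j <oo) f j t)%E.
  have -> : (2 * e)%:E = (\int[mu]_(t in `[lo, hi]) (cst (e * (2 / (hi - lo)))%:E t))%E.
    rewrite integral_cst// /mu /= lebesgue_measure_itv/= lte_fin lohi -EFinM.
    by congr (_%:E); field; rewrite subr_eq0 gt_eqF.
  apply: ge0_le_integral => //.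
  - by move=> t _; rewrite lee_fin mulr_ge0 ?(ltW e0)// divr_ge0// subr_ge0 ltW.
  - by apply: ge0_emeasurable_sum.
have := le_trans L (eq_ind_r (fun z => (z <= e%:E)%E) U E).
by rewrite lee_fin; lra.
Unshelve. all: by end_near. Qed.

(** What box [j] contributes once the coordinates below [m] have been chosen: its
    volume in the remaining coordinates if [x] is compatible with it, 0 otherwise. *)
Definition box_weight k (a b : nat -> 'rV[R]_k) (m : nat) (x : 'rV[R]_k) (j : nat) : R :=
  \prod_(i < k) (if (i < m)%N then (a j 0 i <= x 0 i <= b j 0 i)%R%:R
                  else b j 0 i - a j 0 i).

(** One coordinate at a time, [weighted_cover_point] trades lengths for indicators;
    this replaces integration over the whole box by one-dimensional integrals. *)
Lemma box_weight_point k (a b : nat -> 'rV[R]_k) (lo hi : 'rV[R]_k) (e : R) m :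
  (forall i, lo 0 i < hi 0 i) -> 0 < e -> (forall j i, a j 0 i <= b j 0 i) ->
  (forall p, \sum_(j < p) \prod_i (b j 0 i - a j 0 i) <= e) -> (m <= k)%N ->
  exists2 x : 'rV[R]_k, forall i : 'I_k, (i < m)%N -> lo 0 i <= x 0 i <= hi 0 i &
    forall p, \sum_(j < p) box_weight a b m x j <=
              e * \prod_(i < k | (i < m)%N) (2 / (hi 0 i - lo 0 i)).
Proof.
move=> lohi e0 ab He; elim: m => [_|m IHm mk].
  exists 0 => // p; rewrite big_pred0_eq mulr1; exact: He.
have [x x_lohi Hx] := IHm (ltnW mk).
pose im := Ordinal mk.
pose w j := \prod_(i < k | i != im) (if (i < m)%N then (a j 0 i <= x 0 i <= b j 0 i)%R%:R
                  else b j 0 i - a j 0 i).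
have wE j : box_weight a b m x j = (b j 0 im - a j 0 im) * w j.
  by rewrite /box_weight (bigD1 im)//= ltnn.
have w0 j : 0 <= w j.
  by apply: prodr_ge0 => i _; case: ifP => // _; rewrite subr_ge0.
have e'0 : 0 < e * \prod_(i < k | (i < m)%N) (2 / (hi 0 i - lo 0 i)).
  by rewrite mulr_gt0// prodr_gt0// => i _; rewrite divr_gt0// subr_gt0.
have [||t tlh Ht] := @weighted_cover_point (fun j => a j 0 im) (fun j => b j 0 im) w
  (lo 0 im) (hi 0 im) _ (lohi im) e'0 _ w0.
- by move=> j; exact: ab.
- by move=> p; under eq_bigr do rewrite -wE; exact: Hx.
pose x' : 'rV[R]_k := \row_i (if i == im then t else x 0 i).
have xE (i : 'I_k) : (i < m)%N -> x' 0 i = x 0 i.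
  by move=> im'; rewrite mxE -val_eqE/= ltn_eqF.
have xm : x' 0 im = t by rewrite mxE eqxx.
exists x' => [i|p].
  rewrite ltnS leq_eqVlt => /orP[/eqP iE|iltm]; last by rewrite xE//; exact: x_lohi.
  by rewrite (_ : i = im) ?xm//; exact: val_inj.
have -> : \prod_(i < k | (i < m.+1)%N) (2 / (hi 0 i - lo 0 i)) =
  \prod_(i < k | (i < m)%N) (2 / (hi 0 i - lo 0 i)) * (2 / (hi 0 im - lo 0 im)).
  rewrite (bigD1 im) ?ltnSn//= mulrC; congr (_ * _); apply: eq_bigl => i.
  by rewrite -val_eqE/= ltnS ltn_neqAle andbC.
rewrite [e * _]mulrA; apply: (le_trans _ (Ht p)); apply: ler_sum => j _.
rewrite le_eqVlt; apply/orP; left; apply/eqP.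
rewrite /box_weight (bigD1 im)//= ltnSn xm; congr (_ * _); apply: eq_bigr => i ine.
have -> : (i < m.+1)%N = (i < m)%N by rewrite ltnS leq_eqVlt (negbTE (ine : val i != m)).
by case: ifPn => // iltm; rewrite xE.
Qed.

(** A cover of small volume would leave, by [box_weight_point] with all coordinates
    chosen, a point of the box whose total weight is below 1: a point in no box of the
    cover. *)
Lemma box_not_null k (lo hi : 'rV[R]_k) (A : set 'rV[R]_k) :
  (forall i, lo 0 i < hi 0 i) ->
  [set x : 'rV[R]_k | forall i, lo 0 i <= x 0 i <= hi 0 i] `<=` A -> ~ lebesgue_null A.
Proof.
move=> lohi subA nullA.
pose V := \prod_(i < k) (2 / (hi 0 i - lo 0 i)).
have V0 : 0 < V by apply: prodr_gt0 => i _; rewrite divr_gt0// subr_gt0.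
have e0 : 0 < (2 * V)^-1 by rewrite invr_gt0 mulr_gt0.
have [a [b [ab cov Hsum]]] := nullA _ e0.
have [x x_lohi Hx] := box_weight_point lohi e0 ab Hsum (leqnn k).
have [j _ xj] : (\bigcup_j [set y | forall i, a j 0 i <= y 0 i <= b j 0 i]) x.
  by apply/cov/subA => i; exact: x_lohi.
have VE : \prod_(i < k | (i < k)%N) (2 / (hi 0 i - lo 0 i)) = V.
  by apply: eq_bigl => i; rewrite ltn_ord.
have := Hx j.+1; rewrite big_ord_recr/= VE invfM mulfVK ?gt_eqF//.
have -> : box_weight a b k x j = 1.
  by rewrite /box_weight big1// => i _; rewrite ltn_ord xj.
have : 0 <= \sum_(j' < j) box_weight a b k x j'.
  apply: sumr_ge0 => j' _; apply: prodr_ge0 => i _; case: ifP => // _.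
  by rewrite subr_ge0.
by lra.
Qed.

(** If [|h x|] exceeded the essential bound, it would do so on a neighbourhood of [x].
    As [x] may lie on the boundary, the non-null box is taken around [(1 - s) x]. *)
Lemma continuous_le_ess k (rho : R) (h : 'rV[R]_k -> R) (M : R) x :
  0 < rho -> continuous h -> (ess_norm (cube rho) h < M%:E)%E -> cube rho x -> `|h x| <= M.
Proof.
move=> rho0 ch /ereal_inf_lt[_ [M' nullM' <-]]; rewrite lte_fin => M'M xc.
rewrite leNgt; apply/negP => hM.
have hM' : 0 < `|h x| - M' by lra.
have /nbhs_ballP[d /= d0 hd] : \forall y \near x, M' < `|h y|.
  have /cvgrPdist_lt /(_ _ hM') := ch x; apply: filterS => y hy.
  have := ler_normD (h x - h y) (h y); rewrite subrK; lra.
pose s := Num.min (1 / 2) (d / (4 * rho)).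
have s0 : 0 < s by rewrite lt_min; apply/andP; split; [lra|rewrite divr_gt0//; lra].
have s1 : s <= 1 / 2 by rewrite ge_min lexx.
have sd : s * rho <= d / 4.
  rewrite -ler_pdivlMr// -mulrA -invfM; by rewrite ge_min lexx orbT.
apply: (@box_not_null k (\row_i ((1 - s) * x 0 i - s * rho)) (\row_i ((1 - s) * x 0 i + s * rho)) _ _ _ nullM').
  by move=> i; rewrite !mxE; have := mulr_gt0 s0 rho0; lra.
move=> y /= yb; split.
  move=> i /=; have := yb i; rewrite !mxE => /andP[y1 y2].
  have := xc i; rewrite !ler_norml => /andP[x1 x2]; apply/andP; split; nra.
apply: hd; rewrite -ball_normE/=.
apply: (@le_lt_trans _ _ (d / 2)); last lra.
apply: rV_norm_le => [|i]; first lra.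
have := yb i; rewrite !mxE => /andP[y1 y2].
have := xc i; rewrite !ler_norml => /andP[x1 x2]; apply/andP; split; nra.
Qed.

Lemma ess_norm_ge0 k (rho : R) (h : 'rV[R]_k -> R) : 0 < rho -> (0 <= ess_norm (cube rho) h)%E.
Proof.
move=> rho0; apply: le_ereal_inf_tmp => _ [M nullM <-]; rewrite lee_fin leNgt; apply/negP => M0.
apply: (@box_not_null k (const_mx (- rho)) (const_mx rho) _ _ _ nullM).
  by move=> i; rewrite !mxE; lra.
move=> y /= yb; split=> [i|]; first by have := yb i; rewrite !mxE ler_norml.
exact: lt_le_trans M0 (normr_ge0 _).
Qed.

Definition unit_index k m (i : 'I_k) : {ffun 'I_k -> 'I_m.+1} :=
  [ffun j => if j == i then inord 1 else ord0].

Lemma multi_partial_unit k m (i : 'I_k) (h : 'rV[R]_k -> R) : (0 < m)%N ->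
  multi_partial (unit_index m i) h = partial i h.
Proof.
move=> m0; rewrite /multi_partial.
have H s : uniq s -> foldr (fun j u => iter (unit_index m i j) (partial j) u) h s =
    if i \in s then partial i h else h.
  elim: s => //= j s IHs /andP[js us]; rewrite IHs// in_cons ffunE [i == j]eq_sym.
  case: (eqVneq j i) js => [->|ji] js /=; last by [].
  by rewrite inordK// (negbTE js).
by rewrite H ?enum_uniq// mem_enum.
Qed.

Lemma multi_order_unit k m (i : 'I_k) : (0 < m)%N -> multi_order (unit_index m i) = 1%N.
Proof.
move=> m0; rewrite /multi_order (bigD1 i)//= big1 ?addn0 => [|j ji].
  by rewrite ffunE eqxx inordK.
by rewrite ffunE (negbTE ji).
Qed.

Lemma unit_index_inj k m : (0 < m)%N -> injective (@unit_index k m).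
Proof.
move=> m0 i j /ffunP/(_ i); rewrite !ffunE eqxx; case: (eqVneq i j) => // _.
by move=> /(congr1 val); rewrite /= inordK.
Qed.

(** The indices of order one are among those summed, and no term is negative. *)
Lemma sobolev_sum_ge k m (rho : R) (h : 'rV[R]_k -> R) : (0 < m)%N -> 0 < rho ->
  (\sum_(i < k) ess_norm (cube rho) (partial i h) <= sobolev_sum m rho h)%E.
Proof.
move=> m0 rho0; rewrite /sobolev_sum.
rewrite (bigID (mem [set unit_index m i | i : 'I_k]))/=.
rewrite [X in (_ <= X + _)%E](_ : _ = \sum_(i < k) ess_norm (cube rho) (partial i h))%E.
  by rewrite leeDl// sume_ge0// => a _; exact: ess_norm_ge0.
rewrite (eq_bigl (mem [set unit_index m i | i : 'I_k])); last first.
  move=> a /=; apply/andb_idl => /imsetP[i _ ->]; by rewrite multi_order_unit.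
rewrite big_imset/=; last by move=> i j _ _; exact: unit_index_inj.
by apply: eq_bigr => i _; rewrite multi_partial_unit.
Qed.

(** The weighted Sobolev sum bounds [rho] times the sum of the suprema of the first
    derivatives. This is a Lipschitz estimate for the sup norm, relative to the radius of
    the domain, and therefore free of any factor depending on the dimension. *)
Lemma sobolev_sup_lipschitz k m (rho Lam eta : R) (h : 'rV[R]_k -> R) (p p' : 'rV[R]_k) :
  (0 < m)%N -> 0 < rho -> cont_diff h -> 0 <= eta ->
  ((Num.max (rho ^+ m) 1)%:E * sobolev_sum m rho h <= Lam%:E)%E ->
  cube rho p -> cube rho p' -> (forall i, `|p 0 i - p' 0 i| <= eta * rho) ->
  `|h p - h p'| <= Lam * eta.
Proof.
move=> m0 rho0 ch eta0 HLam pc pc' pp'.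
have max1 : 1 <= Num.max (rho ^+ m) 1 by rewrite le_max lexx orbT.
have maxr : rho <= Num.max (rho ^+ m) 1.
  have [r1|r1] := lerP rho 1; first exact: le_trans r1 max1.
  rewrite le_max; apply/orP; left; rewrite -[leLHS]expr1; apply: ler_weXn2l => //; exact: ltW.
set s := sobolev_sum m rho h in HLam.
have S := @sobolev_sum_ge k m rho h m0 rho0.
have N0 i : (0 <= ess_norm (cube rho) (partial i h))%E by exact: ess_norm_ge0.
have s0 : (0 <= s)%E by apply: le_trans S; exact: sume_ge0.
have sfin : s \is a fin_num.
  rewrite ge0_fin_numE//; apply: le_lt_trans (_ : _ <= Lam%:E)%E (ltry _).
  by apply: le_trans HLam; rewrite -{1}[s]mul1e lee_wpmul2r// lee_fin.
have Mfin i : ess_norm (cube rho) (partial i h) \is a fin_num.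
  rewrite ge0_fin_numE//; apply: le_lt_trans (_ : _ <= s)%E _; last by rewrite -ge0_fin_numE.
  by apply: le_trans S; rewrite (bigD1 i)//= leeDl// sume_ge0.
pose M i := fine (ess_norm (cube rho) (partial i h)).
have sumM : rho * \sum_i M i <= Lam.
  rewrite -lee_fin EFinM -sumEFin.
  apply: le_trans HLam; apply: lee_pmul => //.
  - by rewrite lee_fin ltW.
  - by apply: sume_ge0 => i _; rewrite lee_fin fine_ge0.
  - by apply: le_trans S; apply: lee_sum => i _; rewrite fineK.
have HM i x : cube rho x -> `|partial i h x| <= M i.
  move=> xc; apply/ler_addgt0Pl => e e0; apply: (@continuous_le_ess _ rho) => //.
    by case: (ch i).
  by rewrite -[ltLHS]fineK// lte_fin /M; lra.
have [t t01 Et] := @cont_diff_mvt R k h p' (p - p') ch.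
have -> : h p - h p' = grad_form h (p' + t *: (p - p')) (p - p').
  by rewrite -Et addrCA subrr addr0.
apply: (le_trans (ler_norm_sum _ _ _)).
apply: (@le_trans _ _ (\sum_i (eta * rho) * M i)).
  apply: ler_sum => i _; rewrite normrM ler_pM//; first by rewrite !mxE.
  apply: HM => j; rewrite !mxE.
  have := pc j; have := pc' j; rewrite !ler_norml => /andP[a1 a2] /andP[b1 b2].
  by case/andP: t01 => t0 t1; apply/andP; split; nra.
by rewrite -mulr_sumr -mulrA mulrC ler_wpM2r.
Qed.

End null_sets.

(** * Perturbing the evaluation of a compositional function *)

Section graph.
Set Implicit Arguments.
Unset Strict Implicit.
Context {R : realType} {d q : nat}.
Implicit Types (F : compfun R d q).

Notation pred_val z v := (\row_j z (@enum_val _ [pred u | edge u v] j)).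

Lemma layer_ind F (P : node F -> Prop) :
  (forall v, (forall u, edge u v -> P u) -> P v) -> forall v, P v.
Proof.
move=> IH v; have [n] := ubnP (layer v); elim: n v => // n IHn v vn.
by apply: IH => u /edge_layer uv; apply: IHn; exact: leq_trans uv vn.
Qed.

Lemma edge_enum_val F (v : node F) j : edge (@enum_val _ [pred u | edge u v] j) v.
Proof. by have := enum_valP j; rewrite inE. Qed.

Lemma is_inputP F (v : node F) : is_input v = (layer v == 0%N).
Proof.
apply/idP/idP => [/source_layer ->//|/eqP v0].
by apply/forallP => u; apply/negP => /edge_layer; rewrite v0.
Qed.

Lemma node_val0E F (x : 'rV[R]_d) (v : node F) :
  node_val 0 (input_val x) v =
  if is_input v then input_val x v else fnode (pred_val (node_val 0 (input_val x)) v).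
Proof. by rewrite node_valE is_inputP leqn0. Qed.

Lemma input_val_inode F x j : input_val x (inode F j) = x 0 j.
Proof.
rewrite /input_val; case: pickP => [j' /eqP/inode_inj-> //|/(_ j)]; by rewrite eqxx.
Qed.

Lemma inputP F (v : node F) : is_input v -> exists j, v = inode F j.
Proof. by rewrite /is_input -codom_inode => /codomP. Qed.

Lemma edge_noninput F (u v : node F) : edge u v -> ~~ is_input v.
Proof. by move=> uv; apply/negP => /forallP/(_ u); rewrite uv. Qed.

Lemma node_val_eq F i (w w' : node F -> R) v :
  (forall u, (layer u <= i)%N -> w u = w' u) -> node_val i w v = node_val i w' v.
Proof.
move=> ww'; elim/layer_ind: v => v IH; rewrite !node_valE; case: ifP => [/ww'//|_].
by congr fnode; apply/rowP => j; rewrite !mxE IH//; exact: edge_enum_val.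
Qed.

Section domains.
Variables (F : compfun R d q) (Rb : R) (rad : node F -> R) (m : node F -> nat).
Hypothesis hA : assumptionA Rb rad m.

Definition in_domains (z : node F -> R) := forall u v, edge u v -> `|z u| <= rad v.

Lemma in_domains_pred z v : in_domains z -> cube (rad v) (pred_val z v).
Proof. by move=> zd j; rewrite mxE; apply: zd; exact: edge_enum_val. Qed.

Lemma fnode_in_domain u v (p : 'rV[R]_(indeg u)) : edge u v -> ~~ is_input u ->
  cube (rad u) p -> `|fnode p| < rad v.
Proof. by case: hA => _ _ _ /(_ u v)+ uv => /(_ uv)[_ H] /H; apply. Qed.

Lemma input_in_domain u v (x : 'rV[R]_d) : edge u v -> is_input u -> cube Rb x ->
  `|input_val x u| <= rad v.
Proof.
case: hA => _ _ _ /(_ u v)+ uv => /(_ uv)[H _] ui xc.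
by have [j ->] := inputP ui; rewrite input_val_inode (le_trans (xc j))// ltW// H.
Qed.

Lemma in_domains_ind (z : node F -> R) :
  (forall u v, edge u v -> is_input u -> `|z u| <= rad v) ->
  (forall u v, edge u v -> ~~ is_input u -> cube (rad u) (pred_val z u) -> `|z u| <= rad v) ->
  in_domains z.
Proof.
move=> zi zn u; elim/layer_ind: u => u IH v uv.
have [ui|ui] := boolP (is_input u); first exact: zi.
by apply: zn => // j; rewrite mxE; apply: IH; exact: edge_enum_val.
Qed.

Lemma eval_in_domains x : cube Rb x -> in_domains (node_val 0 (input_val x)).
Proof.
move=> xc; apply: in_domains_ind => u v uv ui; rewrite node_val0E.
  by rewrite ui; exact: input_in_domain.
by rewrite (negbTE ui) => pc; apply/ltW/fnode_in_domain.
Qed.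

Variable Lmax : R.
Hypothesis hLmax : forall v, is_general v -> exists2 L : R, node_lipschitz rad v L & `|L| <= Lmax.

(** The nodes of [s] are changed one at a time, each at the cost of its node
    Lipschitz constant; this is why intermediate values have to stay in the domains. *)
Lemma truncation_change l (s : seq (node F)) (w w' : node F -> R) kap :
  (forall v, v \in s -> is_general v /\ layer v = l) ->
  (forall v, v \in s -> `|w v - w' v| <= kap) ->
  (forall v, v \notin s -> w v = w' v) ->
  trunc_dom rad l w -> trunc_dom rad l w' ->
  enorm (truncation l w - truncation l w') <= (size s)%:R * (Lmax * kap).
Proof.
elim: s w => [|v s IHs] w sgen wk weq wd wd'.
  have -> : w = w' by apply/funext => v; exact: weq.
  by rewrite subrr enorm0 mul0r.
pose w2 u := if u == v then w' v else w u.
have w2d : trunc_dom rad l w2.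
  by move=> u u' uu' lu; rewrite /w2; case: eqP => [<-|_]; [exact: wd'|exact: wd].
have [vgen vl] := sgen _ (mem_head v s).
have [L HL LL] := hLmax vgen.
rewrite -vl in wd w2d.
have step := HL _ _ wd w2d.
apply: (le_trans (enorm_triangle (truncation l w2) _ _)).
have -> : (size (v :: s))%:R * (Lmax * kap) = Lmax * kap + (size s)%:R * (Lmax * kap).
  by rewrite /= mulrS mulrDl mul1r.
apply: lerD; last first.
  apply: IHs => //.
  - by move=> u us; apply: sgen; rewrite in_cons us orbT.
  - move=> u us; rewrite /w2; case: eqP => [->|_]; last by apply: wk; rewrite in_cons us orbT.
    by rewrite subrr normr0 (le_trans (normr_ge0 (w v - w' v)))// wk// mem_head.
  - move=> u us; rewrite /w2; case: eqP => [->//|/eqP uv]; apply: weq.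
    by rewrite in_cons negb_or uv.
  - by rewrite -vl.
rewrite -vl (le_trans (step _))//; first by move=> u uv; rewrite /w2 (negbTE uv).
rewrite /w2 eqxx; apply: (le_trans (ler_wpM2r (normr_ge0 _) (ler_norm L))).
by apply: ler_pM => //; apply: wk; rewrite mem_head.
Qed.

(** Recomputing layer [l + 1] from the values [z] below it changes only the general
    nodes of that layer. *)
Lemma truncation_step l (z : node F -> R) kap : 0 <= kap ->
  in_domains z ->
  (forall v, ~~ is_input v -> ~~ is_general v -> z v = fnode (pred_val z v)) ->
  (forall v, is_general v -> `|z v - fnode (pred_val z v)| <= kap) ->
  enorm (truncation l z - truncation l.+1 z) <=
  #|[pred v : node F | is_general v && (layer v == l.+1)]|%:R * (Lmax * kap).
Proof.
move=> kap0 zd zaff zgen.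
pose w v := if layer v == l.+1 then fnode (pred_val z v) else z v.
have wE v : node_val l z v = node_val l.+1 w v.
  elim/layer_ind: v => v IH; rewrite !node_valE /w.
  have [vl|lv] := leqP (layer v) l.
    by rewrite (leqW vl) ltn_eqF.
  have [vl1|vl1] := leqP (layer v) l.+1; last first.
    by congr fnode; apply/rowP => j; rewrite !mxE IH//; exact: edge_enum_val.
  have -> : layer v == l.+1 by rewrite eqn_leq vl1.
  congr fnode; apply/rowP => j; rewrite !mxE node_valE.
  by have /edge_layer uv := @edge_enum_val F v j; rewrite -ltnS (leq_trans uv vl1).
have -> : truncation l z = truncation l.+1 w by apply/rowP => j; rewrite !mxE wE.
have zwd : trunc_dom rad l.+1 z by move=> u v uv _; exact: zd.
rewrite cardE; apply: truncation_change => //.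
- by move=> v; rewrite mem_enum inE => /andP[vg /eqP vl].
- move=> v; rewrite mem_enum inE => /andP[vg vl]; rewrite /w vl distrC; exact: zgen.
- move=> v; rewrite mem_enum inE negb_and /w; case: ifP => //= /eqP vl; rewrite orbF => vg.
  by rewrite -zaff// is_inputP vl.
- move=> u v uv _; rewrite /w; case: ifP => [/eqP ul|_]; last exact: zd.
  apply/ltW/fnode_in_domain => //; first by rewrite is_inputP ul.
  exact: in_domains_pred.
Qed.

(** Values that violate the recursion of the graph by at most [kap] at each general
    node give nearly the right output: [truncation_step] is summed over the layers. *)
Lemma pseudo_evaluation (z : node F -> R) kap : 0 <= kap ->
  in_domains z ->
  (forall v, ~~ is_input v -> ~~ is_general v -> z v = fnode (pred_val z v)) ->
  (forall v, is_general v -> `|z v - fnode (pred_val z v)| <= kap) ->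
  enorm (truncation 0 z - \row_j z (onode F j)) <= (card_general F)%:R * (Lmax * kap).
Proof.
move=> kap0 zd zaff zgen.
have T l : enorm (truncation 0 z - truncation l z) <=
  #|[pred v : node F | is_general v && (layer v <= l)%N]|%:R * (Lmax * kap).
  elim: l => [|l IHl].
    rewrite subrr enorm0 (_ : #|_| = 0%N) ?mul0r//; apply: eq_card0 => v; rewrite !inE.
    by apply/negP => /andP[/andP[vi _]]; rewrite leqn0 -is_inputP (negbTE vi).
  apply: (le_trans (enorm_triangle (truncation l z) _ _)).
  apply: (le_trans (lerD IHl (truncation_step l kap0 zd zaff zgen))).
  rewrite -mulrDl -natrD -cardUI [X in (_ + X)%N]eq_card0 ?addn0; last first.
    move=> v; rewrite !inE; apply/negP => /andP[/andP[_ vl] /andP[_ /eqP v1]].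
    by move: vl; rewrite v1 ltnn.
  rewrite le_eqVlt; apply/orP; left; apply/eqP; congr (_%:R * _); apply: eq_card => v.
  by rewrite !inE -andb_orr [in RHS]leq_eqVlt ltnS orbC.
pose lmax := (\max_(v : node F) layer v)%N.
have lmaxP (v : node F) : (layer v <= lmax)%N by exact: leq_bigmax.
have := T lmax.
rewrite (_ : truncation lmax z = \row_j z (onode F j)); last first.
  by apply/rowP => j; rewrite !mxE node_valE lmaxP.
rewrite (_ : #|_| = card_general F)//.
by apply: eq_card => v; rewrite !inE lmaxP andbT.
Qed.

End domains.

Definition affine_coef F (v : node F) : 'rV[R]_(indeg v) :=
  xget 0 [set a : 'rV[R]_(indeg v) |
    exists b : R, forall x : 'rV[R]_(indeg v), fnode x = \sum_i a 0 i * x 0 i + b].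

Lemma affine_coefP F (v : node F) : ~~ is_input v -> ~~ is_general v ->
  exists b : R, forall x : 'rV[R]_(indeg v), fnode x = \sum_i affine_coef v 0 i * x 0 i + b.
Proof.
move=> vi; rewrite /is_general negb_and vi/= => /negPn/asboolP[a [b ab]].
rewrite /affine_coef; case: xgetP => [? _ //|/(_ a)[]]; by exists b.
Qed.

(** The part of the evaluation that goes through affine nodes only: constant terms
    are dropped and general nodes output 0. It is again a compositional function on the
    same graph, so that it inherits [node_val] and its recursion. *)
Definition linear_part F : compfun R d q :=
  {| node := node F; edge := @edge _ _ _ F; layer := @layer _ _ _ F;
     inode := inode F; onode := onode F;
     fnode := fun v x => if is_general v then 0 else \sum_i affine_coef v 0 i * x 0 i;
     edge_layer := @edge_layer _ _ _ F; source_layer := @source_layer _ _ _ F;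
     sink_layer := @sink_layer _ _ _ F; inode_inj := @inode_inj _ _ _ F;
     codom_inode := @codom_inode _ _ _ F; onode_inj := @onode_inj _ _ _ F;
     codom_onode := @codom_onode _ _ _ F |}.

Definition linear_val F (x : 'rV[R]_d) (v : node F) : R :=
  @node_val _ _ _ (linear_part F) 0 (@input_val _ _ _ (linear_part F) x) v.

Lemma linear_valE F x (v : node F) : linear_val x v =
  if is_input v then input_val x v else
  if is_general v then 0 else
  \sum_j affine_coef v 0 j * linear_val x (@enum_val _ [pred u | edge u v] j).
Proof.
rewrite {1}/linear_val (node_val0E (F := linear_part F)).
rewrite -[@is_input _ _ _ (linear_part F) v]/(@is_input _ _ _ F v).
case: ifP => // _; rewrite [LHS]/=; case: ifP => // _.
by apply: eq_bigr => j _; rewrite mxE.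
Qed.

Lemma linear_val_sum F x (v : node F) :
  linear_val x v = \sum_i x 0 i * linear_val (delta_mx 0 i) v.
Proof.
elim/layer_ind: v => v IH.
have [vi|vi] := boolP (is_input v).
  have lE x' : linear_val x' v = input_val x' v by rewrite linear_valE vi.
  rewrite lE; under eq_bigr do rewrite lE.
  have [j ->] := inputP vi; rewrite input_val_inode (bigD1 j)//= big1 ?addr0.
    by rewrite input_val_inode mxE !eqxx mulr1.
  by move=> i ij; rewrite input_val_inode mxE eqxx/= eq_sym (negbTE ij) mulr0.
have [vg|vg] := boolP (is_general v).
  have lE x' : linear_val x' v = 0 by rewrite linear_valE (negbTE vi) vg.
  by rewrite lE big1// => i _; rewrite lE mulr0.
have lE x' : linear_val x' v = \sum_j affine_coef v 0 j * linear_val x' (@enum_val _ [pred u | edge u v] j).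
  by rewrite linear_valE (negbTE vi) (negbTE vg).
rewrite lE; under [RHS]eq_bigr do rewrite lE mulr_sumr.
rewrite exchange_big/=; apply: eq_bigr => j _; rewrite (IH _ (edge_enum_val _)) mulr_sumr.
by apply: eq_bigr => i _; rewrite mulrCA.
Qed.

Definition linear_mx F : 'M[R]_(d, q) := \matrix_(i, j) linear_val (delta_mx 0 i) (onode F j).

(** The bound at [x] and at [- x] excludes the constant term. *)
Lemma affine_homogeneous_le k (a x : 'rV[R]_k) (b rho c : R) :
  (forall y, cube rho y -> `|\sum_i a 0 i * y 0 i + b| < c) -> cube rho x ->
  `|\sum_i a 0 i * x 0 i| <= c.
Proof.
move=> H xc; have := H _ xc; have : cube rho (- x) by move=> i; rewrite mxE normrN.
move=> /H; under eq_bigr do rewrite mxE mulrN; rewrite sumrN.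
by rewrite !ltr_norml ler_norml => /andP[? ?] /andP[? ?]; apply/andP; split; lra.
Qed.

(** Pulling the input towards 0 changes the output, up to an explicit linear term, by
    an amount in which the number [d] of inputs does not appear. The values
    [z (1 - eta) y + eta * linear_val y] satisfy the recursion exactly at inputs [y] and
    at affine nodes; at a general node their arguments are off by at most [eta] times the
    radius, so that [sobolev_sup_lipschitz] and [pseudo_evaluation] apply. *)
Lemma scaled_evaluation F (Rb : R) (rad : node F -> R) (m : node F -> nat) (r Lam Lmax : R) :
  nodes_C2 F -> assumptionA Rb rad m -> features rad m r Lam Lmax ->
  forall (y : 'rV[R]_d) (eta : R), cube Rb y -> 0 <= eta <= 1 ->
  enorm (ceval F y - ceval F ((1 - eta) *: y) - eta *: (y *m linear_mx F)) <=
  (card_general F)%:R * (Lmax * (Lam * eta)).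
Proof.
move=> C2 hA [[r0 Lam0 Lmax0 _] _ hLam hLmax] y eta yc /andP[eta0 eta1].
have radP v : ~~ is_input v -> 0 < rad v by case: hA => _ + _ _; apply.
set y' := (1 - eta) *: y.
have y'c : cube Rb y'.
  move=> i; rewrite mxE normrM ger0_norm ?subr_ge0//.
  by rewrite (le_trans _ (yc i))// ler_piMl// gerBl.
pose z' := node_val 0 (@input_val _ _ _ F y').
have z'd : in_domains rad z' := eval_in_domains hA y'c.
have linb : in_domains rad (@linear_val F y).
  apply: in_domains_ind => u v uv ui; rewrite linear_valE; first by rewrite ui (input_in_domain hA).
  rewrite (negbTE ui); case: ifPn => [_ _|ug pc].
    by rewrite normr0 ltW// radP// (edge_noninput uv).
  have [b Eb] := affine_coefP ui ug.
  rewrite (eq_bigr (fun j => affine_coef u 0 j * (pred_val (linear_val y) u : 'rV[R]_(indeg u)) 0 j)); last first.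
    by move=> j _; rewrite mxE.
  apply: (@affine_homogeneous_le _ _ _ b (rad u)) => // p pc'.
  by rewrite -Eb; exact: (fnode_in_domain hA).
pose z v := z' v + eta * linear_val y v.
have zi v : is_input v -> z v = input_val y v.
  move=> vi; rewrite /z /z' node_val0E linear_valE vi.
  have [j ->] := inputP vi; rewrite !input_val_inode mxE; ring.
have zaff v : ~~ is_input v -> ~~ is_general v -> z v = fnode (pred_val z v).
  move=> vi vg; have [b Eb] := affine_coefP vi vg.
  rewrite /z /z' node_val0E linear_valE (negbTE vi) (negbTE vg) !Eb.
  rewrite mulr_sumr addrAC -big_split/=; congr (_ + _).
  by apply: eq_bigr => j _; rewrite !mxE mulrDr; congr (_ + _); rewrite mulrCA.
have zd : in_domains rad z.
  apply: in_domains_ind => u v uv ui; first by rewrite zi//; exact: (input_in_domain hA).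
  move=> pc; have [ug|ug] := boolP (is_general u).
    by rewrite /z linear_valE (negbTE ui) ug mulr0 addr0; exact: z'd.
  by rewrite zaff//; apply/ltW/(fnode_in_domain hA).
have zgen v : is_general v -> `|z v - fnode (pred_val z v)| <= Lam * eta.
  move=> vg; have vi : ~~ is_input v by case/andP: vg.
  have [mv _] : (0 < m v)%N /\ sobolev (m v) (rad v) (@fnode _ _ _ F v) by case: hA => _ _ + _; apply.
  have -> : z v = fnode (pred_val z' v).
    by rewrite /z linear_valE (negbTE vi) vg mulr0 addr0 /z' node_val0E (negbTE vi).
  apply: (@sobolev_sup_lipschitz _ _ (m v) (rad v)) => //.
  - exact: radP.
  - by case: (C2 v vi).
  - exact: hLam.
  - exact: in_domains_pred.
  - exact: in_domains_pred.
  move=> j; rewrite !mxE /z opprD addrA subrr add0r normrN normrM ger0_norm// ler_wpM2l//.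
  by apply: linb; exact: edge_enum_val.
have kap0 : 0 <= Lam * eta by rewrite mulr_ge0// ltW.
have := pseudo_evaluation hA hLmax kap0 zd zaff zgen.
congr (enorm _ <= _); rewrite -addrA; congr (_ + _).
  apply/rowP => j; rewrite !mxE; apply: node_val_eq => v; rewrite leqn0 -is_inputP => vi.
  exact: zi.
rewrite -opprD; congr (- _); apply/rowP => j; rewrite !mxE /z; congr (_ + _ * _).
by rewrite linear_val_sum; apply: eq_bigr => i _; rewrite mxE.
Qed.

End graph.

(** * Networks as programs *)

Section programs.
Set Implicit Arguments.
Unset Strict Implicit.
Context {R : realType} {n : nat}.
Variable sigma : R -> R.
Implicit Types (hs t : seq ('rV[R]_n -> R)) (phi psi : 'rV[R]_n -> R).

Notation nthf hs j := (nth (fun _ => 0) hs j).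

(** The affine functions of the input and of the hidden nodes [hs]. Nodes whose value
    lies in this span need not be built: their readers can read [hs] instead. *)
Definition aff_span hs phi : Prop :=
  exists (a : 'rV[R]_n) (b : R) (c : nat -> R), forall x,
    phi x = \sum_i a 0 i * x 0 i + b + \sum_(j < size hs) c j * nthf hs j x.

(** The hidden nodes of a network as functions of its input, in an order of
    computation. Only their number matters for the size. *)
Inductive program : seq ('rV[R]_n -> R) -> Prop :=
| program_nil : program [::]
| program_affine hs phi : program hs -> aff_span hs phi -> program (rcons hs phi)
| program_act hs phi : program hs -> aff_span hs phi -> program (rcons hs (sigma \o phi)).

Lemma aff_span_cst hs (c : R) : aff_span hs (fun=> c).
Proof.
exists 0, c, (fun=> 0) => x.
by rewrite !big1 ?add0r ?addr0// => i _; rewrite ?mxE mul0r.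
Qed.

Lemma aff_span_coord hs i : aff_span hs (fun x => x 0 i).
Proof.
exists (delta_mx 0 i), 0, (fun=> 0) => x.
rewrite addr0 [X in _ + X]big1 ?addr0; last by move=> j _; rewrite mul0r.
exact/esym/dot_deltal.
Qed.

Lemma aff_spanD hs phi psi : aff_span hs phi -> aff_span hs psi ->
  aff_span hs (fun x => phi x + psi x).
Proof.
move=> [a [b [c E]]] [a' [b' [c' E']]].
exists (a + a'), (b + b'), (fun j => c j + c' j) => x; rewrite E E'.
rewrite [in RHS](eq_bigr (fun i => a 0 i * x 0 i + a' 0 i * x 0 i)); last first.
  by move=> i _; rewrite mxE mulrDl.
rewrite [in RHS](eq_bigr (fun j : 'I_(size hs) => c j * nthf hs j x + c' j * nthf hs j x)); last first.
  by move=> i _; rewrite mulrDl.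
by rewrite !big_split/=; ring.
Qed.

Lemma aff_spanZ hs (k : R) phi : aff_span hs phi -> aff_span hs (fun x => k * phi x).
Proof.
move=> [a [b [c E]]]; exists (k *: a), (k * b), (fun j => k * c j) => x; rewrite E !mulrDr !mulr_sumr.
by congr (_ + _ + _); apply: eq_bigr => i _; rewrite ?mxE mulrA.
Qed.

Lemma aff_span_sum hs I (r : seq I) (k : I -> R) (phi : I -> 'rV[R]_n -> R) :
  (forall i, aff_span hs (phi i)) -> aff_span hs (fun x => \sum_(i <- r) k i * phi i x).
Proof.
move=> H; elim: r => [|i r IHr].
  rewrite (_ : (fun _ => _) = (fun=> 0)); first exact: aff_span_cst.
  by apply/funext => x; rewrite big_nil.
rewrite (_ : (fun _ => _) = (fun x => k i * phi i x + \sum_(i <- r) k i * phi i x)).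
  by apply: aff_spanD => //; exact: aff_spanZ.
by apply/funext => x; rewrite big_cons.
Qed.

Lemma aff_span_cat hs t phi : aff_span hs phi -> aff_span (hs ++ t) phi.
Proof.
elim/last_ind: t => [|t psi IHt]; first by rewrite cats0.
move=> /IHt; rewrite -rcons_cat; move: (hs ++ t) => gs [a [b [c E]]].
exists a, b, (fun j => if j == size gs then 0 else c j) => x.
rewrite E size_rcons big_ord_recr/= eqxx mul0r addr0; congr (_ + _).
apply: eq_bigr => i _; rewrite ltn_eqF ?nth_rcons; last exact: ltn_ord.
by rewrite ltn_ord.
Qed.

Lemma aff_span_nth hs j : (j < size hs)%N -> aff_span hs (nthf hs j).
Proof.
move=> jh; exists 0, 0, (fun i => (i == j)%:R) => x.
rewrite big1 ?add0r; last by move=> i _; rewrite mxE mul0r.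
rewrite (bigD1 (Ordinal jh))//= eqxx mul1r big1 ?addr0// => i ij.
by rewrite -[nat_of_ord i == j]/(i == Ordinal jh) (negbTE ij) mul0r.
Qed.

(** The hidden nodes of [NN], fed with [phi], are appended by increasing layer. The
    output nodes are linear and cost nothing, so that compositions only add up the
    numbers of hidden nodes. *)
Lemma program_substitution d q (NN : compfun R d q) hs (phi : 'I_d -> 'rV[R]_n -> R) :
  is_nn sigma NN -> program hs -> (forall i, aff_span hs (phi i)) ->
  exists t, [/\ size t = nn_size NN, program (hs ++ t) &
    forall j, aff_span (hs ++ t) (fun x => ceval NN (\row_i phi i x) 0 j)].
Proof.
move=> [maxl nngen nnout] phs hphi.
pose val v x := node_val 0 (@input_val _ _ _ NN (\row_i phi i x)) v.
pose hid := [pred v : node NN | ~~ is_input v && ~~ is_output v].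
have predspan s v j : (forall u, edge u v -> hid u -> u \in s) ->
    aff_span (hs ++ map val s) (val (@enum_val _ [pred u | edge u v] j)).
  move=> scl; have uv := @edge_enum_val _ _ _ NN v j; move: (enum_val j) uv => u uv.
  have [ui|ui] := boolP (is_input u).
    have [i Eu] := inputP ui.
    rewrite (_ : val u = phi i); first exact: aff_span_cat.
    by apply/funext => x; rewrite /val node_val0E ui Eu input_val_inode mxE.
  have us : u \in s.
    apply: scl => //; rewrite inE ui/=; apply/negP => /forallP/(_ v); by rewrite uv.
  have := @aff_span_nth (hs ++ map val s) (size hs + index u s).
  rewrite size_cat size_map ltn_add2l index_mem => /(_ us).
  by rewrite nth_cat ltnNge leq_addr/= addKn (nth_map u) ?index_mem// nth_index.
have build k : (k <= #|hid|)%N -> exists s : seq (node NN),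
    [/\ uniq s, size s = k, (forall v, v \in s -> hid v),
        (forall u v, v \in s -> edge u v -> hid u -> u \in s) & program (hs ++ map val s)].
  elim: k => [_|k IHk kh]; first by exists [::]; rewrite cats0; split.
  have [s [us ss shid scl sprog]] := IHk (ltnW kh).
  have [v0 v0P] : exists v0, hid v0 && (v0 \notin s).
    have /subsetPn[v0 v0h v0s] : ~~ (hid \subset s).
      apply/negP => /subset_leq_card; rewrite leqNgt => /negP; apply.
      by rewrite (leq_ltn_trans (card_size s))// ss.
    by exists v0; apply/andP; split.
  (* a missing node of least layer: its hidden predecessors are already there *)
  have := @arg_minnP _ v0 (fun v => hid v && (v \notin s)) (@layer _ _ _ NN) v0P.
  case=> v /andP[vh vs] vmin.
  have vcl u : edge u v -> hid u -> u \in s.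
    move=> uv uh; apply/contraT => us'.
    have := vmin u; rewrite uh us' => /(_ isT); by rewrite leqNgt edge_layer.
  have [vi vo] := andP vh.
  exists (rcons s v); split.
  - by rewrite rcons_uniq vs.
  - by rewrite size_rcons ss.
  - by move=> u; rewrite mem_rcons in_cons => /orP[/eqP->|/shid].
  - move=> u w; rewrite !mem_rcons !in_cons => /orP[/eqP->|ws] uw uh; apply/orP; right.
      exact: vcl.
    exact: scl ws uw uh.
  rewrite map_rcons -rcons_cat.
  have spanv (a : 'rV[R]_(indeg v)) (b : R) : aff_span (hs ++ map val s)
      (fun x => \sum_i a 0 i * val (@enum_val _ [pred u | edge u v] i) x + b).
    apply: aff_spanD; last exact: aff_span_cst.
    by apply: aff_span_sum => i; exact: predspan.
  have valE x : val v x = fnode (\row_j val (@enum_val _ [pred u | edge u v] j) x).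
    by rewrite /val node_val0E (negbTE vi).
  have [vg|vg] := boolP (is_general v).
    have [a [b ab]] := nngen v vg.
    rewrite (_ : val v = sigma \o (fun x => \sum_i a 0 i * val (@enum_val _ [pred u | edge u v] i) x + b)).
      by apply: program_act.
    apply/funext => x; rewrite valE ab/=; congr (sigma (_ + _)).
    by apply: eq_bigr => i _; rewrite mxE.
  have [b ab] := affine_coefP vi vg.
  rewrite (_ : val v = (fun x => \sum_i affine_coef v 0 i * val (@enum_val _ [pred u | edge u v] i) x + b)).
    by apply: program_affine.
  by apply/funext => x; rewrite valE ab/=; congr (_ + _); apply: eq_bigr => i _; rewrite mxE.
have [s [us ss shid scl sprog]] := build _ (leqnn _).
have sall v : hid v -> v \in s.
  have /uniq_min_size : uniq s by [].
  move=> vh; have : s =i enum hid.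
    have [] := uniq_min_size us (_ : {subset s <= enum hid}) _ => //.
      by move=> u /shid; rewrite mem_enum.
    by rewrite -cardE ss.
  by move=> ->; rewrite mem_enum.
exists (map val s); split => //; first by rewrite size_map ss.
move=> j; have jo : is_output (onode NN j) by rewrite /is_output -codom_onode codom_f.
have [a aE] := nnout _ jo.
have joi : ~~ is_input (onode NN j).
  rewrite is_inputP; have := @sink_layer _ _ _ NN (onode NN j).
  by rewrite -/(is_output _) jo => /(_ isT) ->; rewrite -lt0n.
rewrite (_ : (fun _ => _) = (fun x => \sum_i a 0 i * val (@enum_val _ [pred u | edge u (onode NN j)] i) x)).
  by apply: aff_span_sum => i; apply: predspan => u _; exact: sall.
apply/funext => x; rewrite /ceval mxE node_val0E (negbTE joi) aE.
by apply: eq_bigr => i _; rewrite mxE.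
Qed.

Lemma program_nth hs i : program hs -> (i < size hs)%N ->
  exists (act : bool) (a : 'rV[R]_n) (b : R) (c : nat -> R), forall x,
   nthf hs i x = (if act then sigma else id)
     (\sum_l a 0 l * x 0 l + b + \sum_(j < i) c j * nthf hs j x).
Proof.
have main (act : bool) gs (phi : 'rV[R]_n -> R) : aff_span gs phi ->
   ((i < size gs)%N -> exists (act : bool) (a : 'rV[R]_n) (b : R) (c : nat -> R), forall x,
   nthf gs i x = (if act then sigma else id)
     (\sum_l a 0 l * x 0 l + b + \sum_(j < i) c j * nthf gs j x)) ->
   (i < size (rcons gs ((if act then sigma else id) \o phi)))%N ->
   exists (act' : bool) (a : 'rV[R]_n) (b : R) (c : nat -> R), forall x,
   nthf (rcons gs ((if act then sigma else id) \o phi)) i x = (if act' then sigma else id)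
     (\sum_l a 0 l * x 0 l + b + \sum_(j < i) c j * nthf (rcons gs ((if act then sigma else id) \o phi)) j x).
  move=> [a [b [c E]]] IH; rewrite size_rcons ltnS leq_eqVlt => /orP[/eqP iE|ilt].
    exists act, a, b, c => x; rewrite nth_rcons iE ltnn eqxx/= E; congr ((if act then sigma else id) (_ + _)).
    by apply: eq_bigr => j _; rewrite nth_rcons ltn_ord.
  have [act' [a' [b' [c' E']]]] := IH ilt.
  exists act', a', b', c' => x; rewrite nth_rcons ilt E'; congr ((if act' then sigma else id) (_ + _)).
  by apply: eq_bigr => j _; rewrite nth_rcons (ltn_trans (ltn_ord j) ilt).
elim=> // gs phi _ IH phis; [exact: (main false)|exact: (main true)].
Qed.

Section realization.
Variables (q s : nat) (act : 'I_s -> bool) (a : 'I_s -> 'rV[R]_n) (b : 'I_s -> R)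
  (c : 'I_s -> nat -> R) (ao : 'I_q -> 'rV[R]_n) (co : 'I_q -> nat -> R).
Hypotheses (n0 : (0 < n)%N) (q0 : (0 < q)%N).

Let T : finType := (('I_n + 'I_s) + 'I_q)%type.

(** All forward edges are present; a node ignores a predecessor by giving it weight 0. *)
Definition full_edge : rel T := fun u v =>
  match u, v with
  | inl (inl _), inl (inr _) => true
  | inl (inr i), inl (inr j) => (i < j)%N
  | inl _, inr _ => true
  | _, _ => false
  end.

Definition full_layer (u : T) : nat :=
  match u with inl (inl _) => 0 | inl (inr i) => i.+1 | inr _ => s.+1 end.

Definition full_coef (v u : T) : R :=
  match v, u with
  | inl (inr j), inl (inl l) => a j 0 l
  | inl (inr j), inl (inr i) => c j i
  | inr k, inl (inl l) => ao k 0 l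
  | inr k, inl (inr i) => co k i
  | _, _ => 0
  end.

Definition full_bias (v : T) : R := if v is inl (inr j) then b j else 0.
Definition full_act (v : T) : R -> R :=
  if v is inl (inr j) then (if act j then sigma else id) else id.

Definition full_fnode (v : T) (z : 'rV[R]_#|[pred u | full_edge u v]|) : R :=
  full_act v (\sum_j full_coef v (@enum_val _ [pred u | full_edge u v] j) * z 0 j + full_bias v).

Lemma full_edge_layer u v : full_edge u v -> (full_layer u < full_layer v)%N.
Proof. by move: u v => [[l|i]|k] [[l'|j]|k']//= ij; rewrite ltnS ?ltn_ord. Qed.

Let l0 : 'I_n := Ordinal n0.
Let k0 : 'I_q := Ordinal q0.

Lemma full_source v : is_source full_edge v = (if v is inl (inl _) then true else false).
Proof.
case: v => [[l|i]|k].
- by apply/forallP => -[[]|].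
- by apply/negbTE/negP => /forallP/(_ (inl (inl l0))).
- by apply/negbTE/negP => /forallP/(_ (inl (inl l0))).
Qed.

Lemma full_sink v : is_sink full_edge v = (if v is inr _ then true else false).
Proof.
case: v => [[l|i]|k].
- by apply/negbTE/negP => /forallP/(_ (inr k0)).
- by apply/negbTE/negP => /forallP/(_ (inr k0)).
- by apply/forallP => -[[]|].
Qed.

Lemma full_max_layer : (\max_u full_layer u)%N = s.+1.
Proof.
apply/eqP; rewrite eqn_leq; apply/andP; split.
  by apply/bigmax_leqP => -[[l|i]|k]//= _; exact: ltnW (ltn_ord i).
exact: (leq_bigmax (inr k0 : T)).
Qed.

Lemma full_source_layer v : is_source full_edge v -> full_layer v = 0.
Proof. by rewrite full_source; case: v => [[]|]. Qed.

Lemma full_sink_layer v : is_sink full_edge v -> full_layer v = (\max_u full_layer u)%N.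
Proof. by rewrite full_sink full_max_layer; case: v => [[]|]. Qed.

Definition full_inode (l : 'I_n) : T := inl (inl l).
Definition full_onode (k : 'I_q) : T := inr k.

Lemma full_inode_inj : injective full_inode. Proof. by move=> l l' []. Qed.
Lemma full_onode_inj : injective full_onode. Proof. by move=> l l' []. Qed.

Lemma full_codom_inode v : (v \in codom full_inode) = is_source full_edge v.
Proof.
rewrite full_source; case: v => [[l|i]|k]; first exact: codom_f.
- by apply/negP => /codomP[].
- by apply/negP => /codomP[].
Qed.

Lemma full_codom_onode v : (v \in codom full_onode) = is_sink full_edge v.
Proof.
rewrite full_sink; case: v => [[l|i]|k]; last exact: codom_f.
- by apply/negP => /codomP[].
- by apply/negP => /codomP[].
Qed.

Definition full_network : compfun R n q :=
  {| node := T; edge := full_edge; layer := full_layer; inode := full_inode;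
     onode := full_onode; fnode := full_fnode; edge_layer := full_edge_layer;
     source_layer := full_source_layer; sink_layer := full_sink_layer;
     inode_inj := full_inode_inj; codom_inode := full_codom_inode;
     onode_inj := full_onode_inj; codom_onode := full_codom_onode |}.

Lemma full_network_is_nn : is_nn sigma full_network.
Proof.
have fE (v : T) (z : 'rV[R]_#|[pred u | full_edge u v]|) : full_fnode z =
   full_act v (\sum_j (\row_j full_coef v (@enum_val _ [pred u | full_edge u v] j)) 0 j * z 0 j + full_bias v).
  by rewrite /full_fnode; congr (full_act v (_ + _)); apply: eq_bigr => j _; rewrite mxE.
split.
- by rewrite /= full_max_layer.
- move=> v vg.
  exists (\row_j full_coef v (@enum_val _ [pred u | full_edge u v] j)), (full_bias v).
  suff A : full_act v = sigma by move=> x; rewrite -A; exact: fE.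
  case/andP: vg => vi /negP vna; case: v vi vna => [[l|i]|k]/=.
  + by rewrite /is_input/= full_source.
  + move=> _ vna; case: ifP => // ai; exfalso; apply/vna/asboolP.
    exists (\row_j full_coef (inl (inr i)) (@enum_val _ [pred u | full_edge u (inl (inr i))] j)), (b i).
    by move=> x; apply: (etrans (fE (inl (inr i)) x)); rewrite /= ai.
  + move=> _ vna; exfalso; apply/vna/asboolP.
    exists (\row_j full_coef (inr k) (@enum_val _ [pred u | full_edge u (inr k)] j)), 0.
    by move=> x; exact: (fE (inr k) x).
- move=> v; rewrite /is_output/= full_sink; case: v => [[]|k]// _.
  exists (\row_j full_coef (inr k) (@enum_val _ [pred u | full_edge u (inr k)] j)) => x.
  by apply: (etrans (fE (inr k) x)); rewrite /= addr0.
Qed.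

Lemma full_network_size : nn_size full_network = s.
Proof.
rewrite /nn_size -[RHS]card_ord -(card_codom (f := fun i : 'I_s => inl (inr i) : T)); last by move=> i j [].
apply: eq_card => v; rewrite !inE /is_input/is_output/= full_source full_sink.
case: v => [[l|i]|k]/=; apply/esym; last 1 first.
- by apply/negP => /codomP[].
- by apply/negP => /codomP[].
- exact: codom_f.
Qed.

Lemma full_sum (v : T) (g : T -> R) :
  \sum_j full_coef v (@enum_val _ [pred u | full_edge u v] j) * g (@enum_val _ [pred u | full_edge u v] j) =
  \sum_(u | full_edge u v) full_coef v u * g u.
Proof. by rewrite -(big_enum_val (A := [pred u | full_edge u v]) (fun u => full_coef v u * g u)). Qed.

Lemma full_network_eval (h : 'I_s -> 'rV[R]_n -> R) x :
  (forall i, h i x = (if act i then sigma else id)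
     (\sum_l a i 0 l * x 0 l + b i + \sum_(j < s | (j < i)%N) c i j * h j x)) ->
  ceval full_network x =
  \row_k (\sum_l ao k 0 l * x 0 l + \sum_(j < s) co k j * h j x).
Proof.
move=> hE; pose val := node_val 0 (@input_val _ _ _ full_network x).
have vi l : val (inl (inl l)) = x 0 l.
  rewrite /val node_val0E /is_input/= full_source.
  exact: (@input_val_inode _ _ _ full_network x l).
have vh i : val (inl (inr i)) = h i x.
  have [m] := ubnP (nat_of_ord i); elim: m i => // m IHm i im.
  rewrite /val node_val0E /is_input/= full_source -/val /full_fnode hE/=.
  congr ((if act i then sigma else id) _).
  under eq_bigr do rewrite mxE; rewrite (full_sum (inl (inr i)) val).
  rewrite addrAC; congr (_ + _); rewrite big_sumType/= [X in _ + X]big1 ?addr0; last by case.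
  rewrite big_sumType/=; congr (_ + _); first by apply: eq_bigr => l _; rewrite vi.
  by apply: eq_bigr => j ji; rewrite IHm// (leq_trans ji).
apply/rowP => k; rewrite !mxE -/val /= /full_onode.
rewrite /val node_val0E /is_input/= full_source -/val /full_fnode/= addr0.
under eq_bigr do rewrite mxE; rewrite (full_sum (inr k) val).
rewrite big_sumType/= [X in _ + X]big1 ?addr0; last by case.
rewrite big_sumType/=; congr (_ + _); first by apply: eq_bigr => l _; rewrite vi.
by apply: eq_bigr => j ji; rewrite vh.
Qed.
End realization.

(** Output nodes carry no bias; the hidden node with constant value 1 supplies it. *)
Lemma program_realization q hs (psi : 'I_q -> 'rV[R]_n -> R) :
  (0 < n)%N -> (0 < q)%N -> program ((fun=> 1) :: hs) ->
  (forall k, aff_span ((fun=> 1) :: hs) (psi k)) ->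
  exists NN : compfun R n q,
    [/\ is_nn sigma NN, nn_size NN = (size hs).+1 &
       forall x, ceval NN x = \row_k psi k x].
Proof.
move=> n0 q0; set gs := _ :: hs => pgs spsi.
have /choice[act /choice[a /choice[b /choice[c H]]]] : forall i : 'I_(size gs),
  exists (act : bool) (a : 'rV[R]_n) (b : R) (c : nat -> R), forall x,
   nthf gs i x = (if act then sigma else id)
     (\sum_l a 0 l * x 0 l + b + \sum_(j < i) c j * nthf gs j x).
  by move=> i; exact: program_nth.
have /choice[ao /choice[bo /choice[co Ho]]] := spsi.
(* the bias of output k becomes part of the weight of the constant node *)
pose co' k j := if j == 0%N then co k 0%N + bo k else co k j.
exists (full_network act a b c ao co' n0 q0); split.
- exact: full_network_is_nn.
- exact: full_network_size.
move=> x; transitivity (\row_k (\sum_l ao k 0 l * x 0 l +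
    \sum_(j < size gs) co' k j * nthf gs j x)).
  apply: (@full_network_eval _ _ act a b c ao co' n0 q0 (fun i => nthf gs i)) => i.
  by rewrite H (big_ord_widen _ (fun j => c i j * nthf gs j x) (ltnW (ltn_ord i))).
apply/rowP => k; rewrite !mxE Ho -addrA; congr (_ + _).
by rewrite /= !big_ord_recl /co' /= !mulr1 addrA [bo k + _]addrC.
Qed.

End programs.

(** * Anchored gradient descent with inexact gradients *)

Section descent.
Set Implicit Arguments.
Unset Strict Implicit.
Context {R : realType} {k : nat}.
Implicit Types (J h : 'rV[R]_k -> R) (U V v w : 'rV[R]_k).

Lemma enorm_mulmx_bounded (A : 'M[R]_k) :
  has_sup [set enorm (x *m A^T) | x in [set x : 'rV[R]_k | enorm x <= 1]].
Proof.
split; first by exists (enorm ((0 : 'rV[R]_k) *m A^T)), 0 => //=; rewrite enorm0 ler01.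
exists (\sum_i enorm (row i A^T)) => _ [x /= x1 <-].
rewrite mulmx_sum_row; apply: (le_trans (enorm_sum _ _)); apply: ler_sum => i _.
by rewrite enormZ ler_piMl ?enorm_ge0// (le_trans (coord_le_enorm _ _)).
Qed.

Lemma le_opnorm (A : 'M[R]_k) v : enorm (v *m A^T) <= opnorm A * enorm v.
Proof.
have ub x : enorm x <= 1 -> enorm (x *m A^T) <= opnorm A.
  by move=> x1; apply: ub_le_sup; [case: (enorm_mulmx_bounded A)|exists x].
have [v0|v0] := eqVneq (enorm v) 0.
  by rewrite (enorm_eq0 v0) mul0mx enorm0 mulr0.
have vgt0 : 0 < enorm v by rewrite lt_neqAle eq_sym v0 enorm_ge0.
have := ub ((enorm v)^-1 *: v).
rewrite -scalemxAl !enormZ ger0_norm ?invr_ge0 ?enorm_ge0// mulVf// => /(_ (lexx _)).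
by rewrite mulrC ler_pdivrMr.
Qed.

Lemma grad_formE h U v : grad_form h U v = dot v (gradient h U).
Proof. by apply: eq_bigr => i _; rewrite !mxE. Qed.

(** A derivative along a line, with an explicit remainder. *)
Lemma directional_limit h U v (e : R) : cont_diff h -> 0 < e ->
  exists2 d : R, 0 < d & forall t, 0 < t < d ->
    `|h (U + t *: v) - h U - t * grad_form h U v| <= e * t.
Proof.
move=> ch e0; have v1 : 0 < `|v| + 1 by rewrite ltr_pwDr.
have e'0 : 0 < e / (`|v| + 1) by rewrite divr_gt0.
have /nbhs_ballP[d /= d0 hd] := cont_diff_expansion U ch e'0.
exists (d / (`|v| + 1)); first by rewrite divr_gt0.
move=> t /andP[t0 td].
have tv : `|t *: v| <= t * (`|v| + 1).
  by rewrite normrZ gtr0_norm// ler_wpM2l ?(ltW t0)// lerDl.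
have /hd : ball 0 d (t *: v).
  by rewrite -ball_normE/= sub0r normrN (le_lt_trans tv)// -ltr_pdivlMr.
rewrite /= (_ : \sum_i _ = t * grad_form h U v); last first.
  by rewrite /grad_form mulr_sumr; apply: eq_bigr => i _; rewrite mxE mulrA.
move=> /le_trans; apply; apply: (le_trans (ler_wpM2l (ltW e'0) tv)).
by rewrite mulrCA divfK ?gt_eqF// mulrC.
Qed.

Lemma directional_le h U v (c d : R) : cont_diff h -> 0 < d ->
  (forall t, 0 < t < d -> h (U + t *: v) - h U <= c * t) -> grad_form h U v <= c.
Proof.
move=> ch d0 H; apply/ler_addgt0Pl => e e0.
have [d' d'0 H'] := directional_limit U v ch e0.
pose t := Num.min d d' / 2.
have m0 : 0 < Num.min d d' by rewrite lt_min d0.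
have t0 : 0 < t by rewrite divr_gt0.
have tm : t < Num.min d d' by rewrite /t; lra.
move: (tm); rewrite lt_min => /andP[td td'].
have := H t; have := H' t; rewrite t0 td td' => /(_ isT) H1 /(_ isT) H2.
move: H1; rewrite ler_norml => /andP[H1 _].
rewrite -(ler_pM2l t0); lra.
Qed.

Lemma directional_ge h U v (c d : R) : cont_diff h -> 0 < d ->
  (forall t, 0 < t < d -> c * t <= h (U + t *: v) - h U) -> c <= grad_form h U v.
Proof.
move=> ch d0 H; apply/ler_addgt0Pl => e e0.
have [d' d'0 H'] := directional_limit U v ch e0.
pose t := Num.min d d' / 2.
have m0 : 0 < Num.min d d' by rewrite lt_min d0.
have t0 : 0 < t by rewrite divr_gt0.
have tm : t < Num.min d d' by rewrite /t; lra.
move: (tm); rewrite lt_min => /andP[td td'].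
have := H t; have := H' t; rewrite t0 td td' => /(_ isT) H1 /(_ isT) H2.
move: H1; rewrite ler_norml => /andP[_ H1].
rewrite -(ler_pM2l t0); lra.
Qed.

Section convex_cost.
Variables (J : 'rV[R]_k -> R) (UU : set 'rV[R]_k) (U0 : 'rV[R]_k) (gam : R).
Hypotheses (J2 : twice_cont_diff J) (Jcvx : convex_function UU J)
  (gam0 : 0 < gam) (ballUU : eball U0 (3 * gam) `<=` UU).

Lemma convex_gradient_le U V : UU U -> UU V -> J U + dot (V - U) (gradient J U) <= J V.
Proof.
move=> uU uV; rewrite -grad_formE -lerBrDl.
apply: (@directional_le _ _ _ _ 1) => //; first by case: J2.
move=> t /andP[t0 t1].
have Ct := Jcvx (Itv01 (ltW t0) (ltW t1)) (mem_set uV) (mem_set uU).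
move: Ct; rewrite convRE /= /unstable.onem.
have -> : (conv (Itv01 (ltW t0) (ltW t1)) (V : convex_lmodType 'rV[R]_k) U) = U + t *: (V - U).
  rewrite /conv/= /unstable.onem scalerBl scale1r scalerBr.
  by rewrite addrCA.
by lra.
Qed.

Let ball2_interior U v : eball U0 (2 * gam) U ->
  exists2 d : R, 0 < d & forall t, 0 < t < d -> UU (U + t *: v).
Proof.
move=> Ub; have v1 : 0 < enorm v + 1 by have := enorm_ge0 v; lra.
exists (gam / (enorm v + 1)); first by rewrite divr_gt0.
move=> t /andP[t0 td]; apply: ballUU; rewrite /eball/= addrAC.
apply: (le_trans (enormD _ _)); rewrite enormZ gtr0_norm//.
have : t * (enorm v + 1) < gam by rewrite -ltr_pdivlMr.
move: Ub; rewrite /eball/= mulrDr mulr1; lra.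
Qed.

Lemma cont_diff_dot_gradient w : cont_diff (fun x => dot w (gradient J x)).
Proof.
rewrite (_ : (fun _ => _) = fun x => \sum_i w 0 i * partial i J x).
  by apply: cont_diff_sum => i; apply: cont_diffM; [exact: cont_diff_cst|case: J2].
by apply/funext => x; apply: eq_bigr => i _; rewrite mxE.
Qed.

Lemma grad_form_dot_gradient w U v :
  grad_form (fun x => dot w (gradient J x)) U v = dot w (v *m (hessian J U)^T).
Proof.
have ph j x : partial j (fun x => dot w (gradient J x)) x = \sum_i w 0 i * partial j (partial i J) x.
  rewrite (_ : (fun _ => _) = \sum_i (fun x => w 0 i * partial i J x)); last first.
    by apply/funext => y; rewrite fct_sumE; apply: eq_bigr => i _; rewrite mxE.
  rewrite /partial derive_sum; last first.
    move=> i; apply: derivableM; first exact: derivable_cst.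
    by case: J2 => _ /(_ i j)[].
  apply: eq_bigr => i _; rewrite (deriveM (f := cst (w 0 i))).
  + by rewrite derive_cst scaler0 addr0.
  + exact: derivable_cst.
  + by case: J2 => _ /(_ i j)[].
rewrite /grad_form /dot; under eq_bigr do rewrite ph mulr_sumr.
rewrite exchange_big/=; apply: eq_bigr => i _; rewrite mxE mulr_sumr.
by apply: eq_bigr => j _; rewrite !mxE (partialC i j)//; ring.
Qed.

(** The mean value theorem holds for real functions only, hence the test vector [w]. *)
Lemma gradient_increment w U v : exists2 t : R, 0 <= t <= 1 &
  dot w (gradient J (U + v) - gradient J U) = dot w (v *m (hessian J (U + t *: v))^T).
Proof.
have [t t01 E] := cont_diff_mvt U v (cont_diff_dot_gradient w).
by exists t => //; rewrite dotBr E grad_form_dot_gradient.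
Qed.

Lemma hessian_sym U : (hessian J U)^T = hessian J U.
Proof. by apply/matrixP => i j; rewrite !mxE; apply: partialC. Qed.

Lemma hessian_dotC U v w : dot (v *m (hessian J U)^T) w = dot v (w *m (hessian J U)^T).
Proof.
rewrite hessian_sym /dot.
under eq_bigr do rewrite mxE mulr_suml.
rewrite exchange_big/=; apply: eq_bigr => i _; rewrite mxE mulr_sumr.
apply: eq_bigr => j _; rewrite -[in RHS](hessian_sym U) [in RHS]mxE; ring.
Qed.

(** The gradient of a convex function is monotone along every line. *)
Lemma hessian_psd U v : eball U0 (2 * gam) U -> 0 <= dot v (v *m (hessian J U)^T).
Proof.
move=> Ub; have [d d0 Hd] := ball2_interior v Ub.
have uU : UU U by apply: ballUU; move: Ub; have := gam0; rewrite /eball/=; lra.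
rewrite -grad_form_dot_gradient.
apply: (directional_ge (cont_diff_dot_gradient v) d0) => t /andP[t0 td]; rewrite mul0r.
have uV : UU (U + t *: v) by apply: Hd; rewrite t0.
have := convex_gradient_le uU uV; have := convex_gradient_le uV uU.
rewrite opprD addrA subrr add0r [U + _ - U]addrAC subrr add0r dotNl !dotZl => H1 H2.
by rewrite -(pmulr_rge0 _ t0); lra.
Qed.

Variable L : R.
Hypotheses (L0 : 0 < L) (hL : forall U, eball U0 (2 * gam) U -> opnorm (hessian J U) <= L).

Lemma hessian_le U v : eball U0 (2 * gam) U -> enorm (v *m (hessian J U)^T) <= L * enorm v.
Proof.
by move=> Ub; apply: (le_trans (le_opnorm _ _)); rewrite ler_wpM2r ?enorm_ge0// hL.
Qed.

(** The Hessian form is nonnegative at [v - Hv / L]. *)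
Lemma hessian_cocoercive U v : eball U0 (2 * gam) U ->
  dot (v *m (hessian J U)^T) (v *m (hessian J U)^T) <= L * dot v (v *m (hessian J U)^T).
Proof.
move=> Ub; set Hv := v *m _; have := hessian_psd (v - L^-1 *: Hv) Ub.
rewrite mulmxBl -scalemxAl -/Hv dotBl !dotBr !dotZl !dotZr.
rewrite -(hessian_dotC U v Hv) -/Hv.
have HHv : dot Hv (Hv *m (hessian J U)^T) <= L * dot Hv Hv.
  apply: (le_trans (dot_le _ _)); rewrite -enorm_sqr expr2 mulrCA ler_wpM2l ?enorm_ge0//.
  exact: hessian_le.
move=> H; have : L^-1 * (L^-1 * dot Hv (Hv *m (hessian J U)^T)) <= L^-1 * dot Hv Hv.
  rewrite ler_wpM2l ?invr_ge0 ?(ltW L0)//.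
  by rewrite mulrC ler_pdivrMr// mulrC.
by move=> H2; rewrite -ler_pdivrMl//; lra.
Qed.

Lemma ball2_segment U v t : eball U0 (2 * gam) U -> eball U0 (2 * gam) (U + v) ->
  0 <= t <= 1 -> eball U0 (2 * gam) (U + t *: v).
Proof.
rewrite /eball/= => Ub Vb /andP[t0 t1].
rewrite (_ : _ - U0 = (1 - t) *: (U - U0) + t *: (U + v - U0)); last first.
  by apply/rowP => i; rewrite !mxE; ring.
apply: (le_trans (enormD _ _)); rewrite !enormZ ger0_norm ?subr_ge0// ger0_norm//.
have := ler_wpM2l t0 Vb; have t1' : 0 <= 1 - t by lra.
have := ler_wpM2l t1' Ub; lra.
Qed.

(** The map [U - (2 / L) grad J U] is nonexpansive: [gradient_increment] is tested
    against the increment [D] of this map itself, and [hessian_cocoercive] applies at the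
    intermediate point. Expanding the squared norm of [D] gives the claim. The argument
    uses the Hessian on the segment from [V] to [U] only, and so never leaves the ball on
    which it is bounded. *)
Lemma gradient_cocoercive U V : eball U0 (2 * gam) U -> eball U0 (2 * gam) V ->
  dot (gradient J U - gradient J V) (gradient J U - gradient J V) <=
  L * dot (U - V) (gradient J U - gradient J V).
Proof.
move=> Ub Vb; have [g gE] : exists g, g = gradient J U - gradient J V by exists (gradient J U - gradient J V).
rewrite -gE; have : U = V + (U - V) by rewrite addrC subrK.
move: (U - V) => v UE.
pose D := v - (2 / L) *: g.
have [t t01] := gradient_increment D V v; rewrite -UE -gE => E.
have Wb : eball U0 (2 * gam) (V + t *: v) by apply: ball2_segment; rewrite -?UE.
set W := V + t *: v in E Wb; pose Hv := v *m (hessian J W)^T.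
have DD : dot D D = dot D (v - (2 / L) *: Hv).
  by rewrite {2}/D !dotBr !dotZr E.
have vH : enorm (v - (2 / L) *: Hv) <= enorm v.
  apply: enorm_le; first exact: enorm_ge0.
  rewrite enorm_sqr dotBl !dotBr !dotZl !dotZr (dotC Hv v).
  have := @hessian_cocoercive W v Wb; rewrite -/Hv => cH.
  have -> : 2 / L * (2 / L * dot Hv Hv) = (4 / L) * (L^-1 * dot Hv Hv) by field; rewrite gt_eqF.
  have L40 : 0 <= 4 / L by rewrite divr_ge0// ltW.
  have : (4 / L) * (L^-1 * dot Hv Hv) <= (4 / L) * dot v Hv.
    by rewrite ler_wpM2l// ler_pdivrMl.
  lra.
have Dv : enorm D <= enorm v.
  have [->|D0] := eqVneq (enorm D) 0; first exact: enorm_ge0.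
  have Dgt0 : 0 < enorm D by rewrite lt_neqAle eq_sym D0 enorm_ge0.
  rewrite -(ler_pM2l Dgt0) -expr2 enorm_sqr DD (le_trans (dot_le _ _))//.
  by rewrite ler_wpM2l ?enorm_ge0.
have : dot D D <= dot v v by rewrite -!enorm_sqr ler_sqr ?nnegrE ?enorm_ge0.
rewrite {1 2}/D dotBl !dotBr !dotZl !dotZr (dotC g v).
rewrite (_ : 2 / L * (2 / L * dot g g) = (4 / L) * (L^-1 * dot g g)); last by field; rewrite gt_eqF.
move=> H; have L40 : 0 < 4 / L by rewrite divr_gt0.
rewrite -ler_pdivrMl// -(ler_pM2l L40); lra.
Qed.

Lemma gradient_lipschitz U V : eball U0 (2 * gam) U -> eball U0 (2 * gam) V ->
  enorm (gradient J U - gradient J V) <= L * enorm (U - V).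
Proof.
move=> Ub Vb; have := gradient_cocoercive Ub Vb; set g := _ - _ => H.
have [->|g0] := eqVneq (enorm g) 0; first by rewrite mulr_ge0 ?enorm_ge0 ?ltW.
have ggt0 : 0 < enorm g by rewrite lt_neqAle eq_sym g0 enorm_ge0.
rewrite -(ler_pM2r ggt0) -expr2 enorm_sqr (le_trans H)// -mulrA ler_wpM2l ?(ltW L0)//.
exact: dot_le.
Qed.

Section minimizer.
Variable Us : 'rV[R]_k.
Hypotheses (Usb : eball U0 gam Us) (Usmin : forall U, UU U -> J Us <= J U).

Let Usb2 : eball U0 (2 * gam) Us.
Proof. by move: Usb; have := gam0; rewrite /eball/=; lra. Qed.

Lemma ball2_admissible U : eball U0 (2 * gam) U -> UU U.
Proof. by move=> Ub; apply: ballUU; move: Ub; have := gam0; rewrite /eball/=; lra. Qed.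

Lemma gradient_minimizer : gradient J Us = 0.
Proof.
have ge0 v : 0 <= dot v (gradient J Us).
  have [d d0 Hd] := ball2_interior v Usb2.
  rewrite -grad_formE; apply: (directional_ge _ d0); first by case: J2.
  by move=> t /Hd/Usmin; rewrite mul0r subr_ge0.
apply: enorm_eq0; have := ge0 (- gradient J Us); rewrite dotNl oppr_ge0 -enorm_sqr => H.
have E0 : enorm (gradient J Us) ^+ 2 = 0 by apply/le_anti; rewrite H sqr_ge0.
by apply/eqP; rewrite -sqrf_eq0 E0.
Qed.

Lemma gap_le_dot U : eball U0 (2 * gam) U -> J U - J Us <= dot (U - Us) (gradient J U).
Proof.
move=> Ub; have := convex_gradient_le (ball2_admissible Ub) (ball2_admissible Usb2).
by rewrite -(opprB U Us) dotNl; lra.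
Qed.

Lemma anchor_gap : J U0 - J Us <= L * gam ^+ 2.
Proof.
have U0b : eball U0 (2 * gam) U0 by have := gam0; rewrite /eball/= subrr enorm0; lra.
apply: (le_trans (gap_le_dot U0b)); apply: (le_trans (dot_le _ _)).
have E : enorm (U0 - Us) <= gam by rewrite enormBC.
have := gradient_lipschitz U0b Usb2; rewrite gradient_minimizer subr0 => H.
have := enorm_ge0 (U0 - Us); have := enorm_ge0 (gradient J U0).
move: (enorm (U0 - Us)) (enorm (gradient J U0)) E H => a b E H b0 a0.
apply: (@le_trans _ _ (a * (L * a))); first by rewrite ler_wpM2l.
by rewrite mulrCA ler_wpM2l ?(ltW L0)// expr2 ler_pM.
Qed.

Lemma gradient_step U : eball U0 (2 * gam) U ->
  enorm (U - L^-1 *: gradient J U - Us) ^+ 2 <= enorm (U - Us) ^+ 2 - L^-1 * (J U - J Us).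
Proof.
move=> Ub; have := gradient_cocoercive Ub Usb2; rewrite gradient_minimizer subr0.
have := gap_le_dot Ub; set g := gradient J U => H1 H2.
rewrite addrAC; move: (U - Us) H1 H2 => v H1 H2.
rewrite !enorm_sqr dotBl !dotBr !dotZl !dotZr (dotC g).
have L'0 : 0 <= L^-1 by rewrite invr_ge0 ltW.
have H2' : L^-1 * dot g g <= dot v g by rewrite ler_pdivrMl.
have := ler_wpM2l L'0 H1; have := ler_wpM2l L'0 H2'; lra.
Qed.

Section anchored_iteration.
Variables (G : 'rV[R]_k -> 'rV[R]_k) (tau eps1 h : R).
Hypotheses (h0 : 0 < h) (tau01 : 0 < tau <= 1) (eps10 : 0 <= eps1)
  (heps1 : L^-1 * eps1 <= gam * tau ^+ 2) (hh : h <= gam * tau)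
  (hG : forall U, eball U0 (2 * gam - h) U -> enorm (G U - gradient J U) <= eps1).

(** Plain descent would keep the distance to the minimizer from growing, but inexact
    gradients could push the iterates out of the ball of radius [2 gam] around [U0], beyond
    which nothing is known about the Hessian and the surrogate. The pull towards [U0]
    prevents this. *)
Definition anchored_step U := (1 - tau) *: (U - L^-1 *: G U) + tau *: U0.

Let L'0 : 0 <= L^-1. Proof. by rewrite invr_ge0 ltW. Qed.

(** Write [e = eps1 / L]. The step maps distance [a] to the minimizer to at most
    [(1 - tau) (a + e) + tau gam], which preserves [a <= gam + gam tau] because
    [e <= gam tau^2]; and it contracts the distance to [U0] from at most
    [2 gam + gam tau + e] by the factor [1 - tau], which leaves room for [h]. The last
    inequality is [gradient_step] together with the convexity of the square. *)
Lemma anchored_step_bound U : eball U0 (2 * gam - h) U -> enorm (U - Us) <= gam + gam * tau ->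
  [/\ eball U0 (2 * gam - h) (anchored_step U),
     enorm (anchored_step U - Us) <= gam + gam * tau &
     L^-1 * (J U - J Us) <= enorm (U - Us) ^+ 2 - enorm (anchored_step U - Us) ^+ 2
        + (tau * gam ^+ 2 + 4 * gam * (L^-1 * eps1) + (L^-1 * eps1) ^+ 2)].
Proof.
move=> Ub Ug; case/andP: tau01 => t0 t1.
have Ub2 : eball U0 (2 * gam) U by move: Ub; rewrite /eball/=; have := h0; lra.
have step := gradient_step Ub2.
have gap0 : 0 <= L^-1 * (J U - J Us).
  by rewrite mulr_ge0// subr_ge0 Usmin//; exact: ball2_admissible.
have zg : enorm (U0 - Us) <= gam by rewrite enormBC.
pose e := L^-1 * eps1.
have e0 : 0 <= e by rewrite mulr_ge0.
pose a := enorm (U - Us); pose a' := enorm (U - L^-1 *: gradient J U - Us).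
have a'0 : 0 <= a' := enorm_ge0 _.
have a0 : 0 <= a := enorm_ge0 _.
have a'a : a' <= a.
  by rewrite -(ler_sqr a'0 a0) (le_trans step)// lerBlDr lerDl.
have ye : enorm (U - L^-1 *: G U - Us) <= a' + e.
  rewrite (_ : U - L^-1 *: G U - Us = (U - L^-1 *: gradient J U - Us) - L^-1 *: (G U - gradient J U)); last first.
    by apply/rowP => i; rewrite !mxE; ring.
  apply: (le_trans (enormD _ _)); rewrite enormN enormZ ger0_norm// lerD2l.
  by rewrite ler_wpM2l// hG.
have t1' : 0 <= 1 - tau by lra.
have y1 : enorm (anchored_step U - Us) <= (1 - tau) * (a' + e) + tau * gam.
  rewrite (_ : anchored_step U - Us = (1 - tau) *: (U - L^-1 *: G U - Us) + tau *: (U0 - Us)); last first.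
    by apply/rowP => i; rewrite !mxE; ring.
  apply: (le_trans (enormD _ _)); rewrite !enormZ !ger0_norm//; last by lra.
  by apply: lerD; rewrite ler_wpM2l// ltW.
have he : e <= gam * tau ^+ 2 := heps1.
have gt0 : 0 <= gam * tau by rewrite mulr_ge0 ?ltW.
have gtt : gam * tau ^+ 2 <= gam * tau.
  by rewrite ler_wpM2l ?(ltW gam0)// expr2 ler_piMr ?(ltW t0).
have ag : a' + e <= gam + gam * tau + gam * tau ^+ 2 by rewrite -/a in Ug; lra.
split.
- rewrite /eball/= (_ : anchored_step U - U0 = (1 - tau) *: ((U - L^-1 *: G U - Us) - (U0 - Us))); last first.
    by apply/rowP => i; rewrite !mxE; ring.
  rewrite enormZ ger0_norm//.
  have B : enorm (U - L^-1 *: G U - Us - (U0 - Us)) <= 2 * gam + gam * tau + gam * tau ^+ 2.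
    apply: (le_trans (enormD _ _)); rewrite enormN; lra.
  apply: (le_trans (ler_wpM2l t1' B)).
  have -> : (1 - tau) * (2 * gam + gam * tau + gam * tau ^+ 2) = 2 * gam - gam * tau - gam * tau ^+ 2 * tau by ring.
  have : 0 <= gam * tau ^+ 2 * tau by rewrite !mulr_ge0 ?sqr_ge0 ?ltW.
  by have := hh; lra.
- apply: (le_trans y1); have := ler_wpM2l t1' ag.
  have : 0 <= gam * tau ^+ 2 * tau by rewrite !mulr_ge0 ?sqr_ge0 ?ltW.
  rewrite (_ : (1 - tau) * (gam + gam * tau + gam * tau ^+ 2) = gam - gam * tau ^+ 2 * tau); last by ring.
  lra.
rewrite -/e; have Y0 := enorm_ge0 (anchored_step U - Us).
have : enorm (anchored_step U - Us) ^+ 2 <= ((1 - tau) * (a' + e) + tau * gam) ^+ 2.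
  rewrite ler_sqr ?nnegrE//; exact: le_trans y1.
have cv : ((1 - tau) * (a' + e) + tau * gam) ^+ 2 <= (a' + e) ^+ 2 + tau * gam ^+ 2.
  have -> : (a' + e) ^+ 2 + tau * gam ^+ 2 = ((1 - tau) * (a' + e) + tau * gam) ^+ 2
     + (1 - tau) * tau * (a' + e - gam) ^+ 2 + tau * (a' + e) ^+ 2 by ring.
  by rewrite -addrA lerDl addr_ge0// mulr_ge0 ?sqr_ge0// ?mulr_ge0// ltW.
have : a' * e <= 2 * gam * e.
  rewrite ler_wpM2r//; rewrite -/a in Ug.
  have : gam * tau <= gam by rewrite ler_piMr// ltW.
  lra.
rewrite sqrrD in cv; rewrite -/a -/a' in step *.
lra.
Qed.

Definition iterate j := iter j anchored_step U0.

Lemma iterate_bound j : eball U0 (2 * gam - h) (iterate j) /\ enorm (iterate j - Us) <= gam + gam * tau.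
Proof.
case/andP: tau01 => t0 t1; have gt0 : 0 <= gam * tau by rewrite mulr_ge0 ?ltW.
elim: j => [|j [IH1 IH2]] /=.
  rewrite /eball/= subrr enorm0 enormBC; split; last by have := Usb; rewrite /eball/=; lra.
  have : gam * tau <= gam by rewrite ler_piMr// ltW.
  by have := hh; have := gam0; lra.
by have [] := anchored_step_bound IH1 IH2.
Qed.

Definition average K : 'rV[R]_k := K%:R^-1 *: \sum_(j < K) iterate j.

Lemma average_dist (K : nat) (V : 'rV[R]_k) : (0 < K)%N ->
  average K - V = K%:R^-1 *: \sum_(j < K) (iterate j - V).
Proof.
move=> K0; rewrite sumrB sumr_const card_ord scalerBr -[V *+ K]scaler_nat scalerA mulVf ?scale1r//.
by rewrite pnatr_eq0 -lt0n.
Qed.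

Lemma average_ball K : (0 < K)%N -> eball U0 (2 * gam) (average K).
Proof.
move=> K0; have K'0 : 0 < K%:R :> R by rewrite ltr0n.
rewrite /eball/= average_dist// enormZ ger0_norm ?invr_ge0 ?ler0n// ler_pdivrMl//.
apply: (le_trans (enorm_sum _ _)); apply: (@le_trans _ _ (\sum_(j < K) 2 * gam)).
  apply: ler_sum => j _; have [] := iterate_bound j; rewrite /eball/= => + _; have := h0; lra.
by rewrite sumr_const card_ord [leRHS]mulr_natl.
Qed.

(** The bounds of [anchored_step_bound] telescope; the gap of the average is at most
    the average gap by the gradient inequality at the average. *)
Lemma average_gap K : (0 < K)%N ->
  J (average K) - J Us <= L * (gam ^+ 2 / K%:R +
    (tau * gam ^+ 2 + 4 * gam * (L^-1 * eps1) + (L^-1 * eps1) ^+ 2)).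
Proof.
move=> K0; have K'0 : 0 < K%:R :> R by rewrite ltr0n.
set c := tau * _ + _ + _.
have avU := ball2_admissible (average_ball K0).
have jensen : K%:R * (J (average K) - J Us) <= \sum_(j < K) (J (iterate j) - J Us).
  have E : \sum_(j < K) dot (iterate j - average K) (gradient J (average K)) = 0.
    rewrite -dot_suml (_ : \sum_(j < K) _ = 0) ?dot0l// sumrB sumr_const card_ord.
    by rewrite /average -[_ *+ K]scaler_nat scalerA divff ?gt_eqF// scale1r subrr.
  have : \sum_(j < K) dot (iterate j - average K) (gradient J (average K)) <=
     \sum_(j < K) (J (iterate j) - J (average K)).
    apply: ler_sum => j _; have [jb _] := iterate_bound j.
    have jU : UU (iterate j) by apply: ball2_admissible; move: jb; have := h0; rewrite /eball/=; lra.
    by have := convex_gradient_le avU jU; lra.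
  rewrite !sumrB !sumr_const !card_ord E -[J (average K) *+ K]mulr_natl -[J Us *+ K]mulr_natl; lra.
have tele : \sum_(j < K) (L^-1 * (J (iterate j) - J Us)) <= gam ^+ 2 + K%:R * c.
  have H j : L^-1 * (J (iterate j) - J Us) <=
     enorm (iterate j - Us) ^+ 2 - enorm (iterate j.+1 - Us) ^+ 2 + c.
    by have [b1 b2] := iterate_bound j; have [] := anchored_step_bound b1 b2.
  apply: (@le_trans _ _ (\sum_(j < K) (enorm (iterate j - Us) ^+ 2 - enorm (iterate j.+1 - Us) ^+ 2 + c))).
    by apply: ler_sum => j _; exact: H.
  rewrite big_split/= sumr_const card_ord -[c *+ K]mulr_natl lerD2r.
  rewrite -(big_mkord xpredT (fun j => enorm (iterate j - Us) ^+ 2 - enorm (iterate j.+1 - Us) ^+ 2)).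
  rewrite -[leLHS]opprK -sumrN; under eq_bigr do rewrite opprB.
  rewrite telescope_sumr// opprB lerBlDr.
  have : enorm (iterate 0 - Us) ^+ 2 <= gam ^+ 2.
    rewrite ler_sqr ?nnegrE ?enorm_ge0 ?(ltW gam0)// enormBC; exact: Usb.
  by have := sqr_ge0 (enorm (iterate K - Us)); lra.
rewrite -mulr_sumr in tele.
have : L^-1 * (K%:R * (J (average K) - J Us)) <= gam ^+ 2 + K%:R * c.
  by apply: le_trans tele; rewrite ler_wpM2l.
rewrite ler_pdivrMl// => H.
rewrite -(ler_pM2l K'0) (le_trans H)// le_eqVlt; apply/orP; left; apply/eqP.
by field; rewrite gt_eqF.
Qed.

End anchored_iteration.

Section finite_differences.
Variables (Jh : 'rV[R]_k -> R) (h delta : R).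
Hypotheses (h0 : 0 < h) (hJh : forall U, eball U0 (2 * gam) U -> `|Jh U - J U| <= delta).

Definition forward_difference U : 'rV[R]_k :=
  \row_i (h^-1 * (Jh (U + h *: delta_mx 0 i) - Jh U)).

Lemma enorm_delta (i : 'I_k) : enorm (delta_mx 0 i : 'rV[R]_k) = 1.
Proof.
apply/eqP; rewrite -(@eqrXn2 _ 2) ?enorm_ge0//.
by rewrite enorm_sqr dot_deltal mxE !eqxx expr1n.
Qed.

Lemma forward_difference_error U : eball U0 (2 * gam - h) U ->
  enorm (forward_difference U - gradient J U) <= Num.sqrt k%:R * (L * h + 2 * delta / h).
Proof.
move=> Ub.
have shift_ball i t : 0 <= t <= 1 -> eball U0 (2 * gam) (U + t *: (h *: delta_mx 0 i)).
  case/andP=> t0 t1; rewrite /eball/= addrAC; apply: (le_trans (enormD _ _)).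
  rewrite !enormZ enorm_delta mulr1 !ger0_norm ?(ltW h0)//.
  have : t * h <= h by rewrite ler_piMl// ltW.
  by move: Ub; rewrite /eball/=; lra.
have Ub2 : eball U0 (2 * gam) U by move: Ub; have := h0; rewrite /eball/=; lra.
have delta0 : 0 <= delta := le_trans (normr_ge0 _) (hJh Ub2).
apply: enorm_le_max => [|i].
  by rewrite addr_ge0// ?mulr_ge0 ?divr_ge0 ?invr_ge0 ?(ltW L0) ?(ltW h0)// mulr_ge0.
have [t t01 E] := @cont_diff_mvt _ _ J U (h *: delta_mx 0 i) (proj1 J2).
rewrite !mxE; set V := U + h *: delta_mx 0 i in E *; set W := U + t *: _ in E.
have Wb : eball U0 (2 * gam) W by exact: shift_ball.
have Vb : eball U0 (2 * gam) V.
  by have := @shift_ball i 1; rewrite scale1r; apply; rewrite ler01 lexx.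
have E' : J V - J U = h * partial i J W.
  by rewrite E grad_formE dotZl dot_deltal mxE.
have P : `|partial i J W - partial i J U| <= L * h.
  have := coord_le_enorm (gradient J W - gradient J U) i; rewrite !mxE => /le_trans; apply.
  apply: (le_trans (gradient_lipschitz Wb Ub2)); rewrite ler_wpM2l ?(ltW L0)//.
  rewrite /W addrAC subrr add0r !enormZ enorm_delta mulr1; case/andP: t01 => t0 t1.
  by rewrite !ger0_norm ?(ltW h0)// ler_piMl// ltW.
rewrite (_ : _ - _ = (partial i J W - partial i J U) + h^-1 * ((Jh V - J V) - (Jh U - J U))); last first.
  have -> : (Jh V - J V) - (Jh U - J U) = Jh V - Jh U - h * partial i J W by rewrite -E'; ring.
  by field; rewrite gt_eqF.
apply: (le_trans (ler_normD _ _)); apply: lerD => //.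
rewrite normrM gtr0_norm ?invr_gt0// mulrC ler_wpM2r ?invr_ge0 ?(ltW h0)//.
by apply: (le_trans (ler_normB _ _)); have := hJh Vb; have := hJh Ub2; lra.
Qed.

End finite_differences.
End minimizer.
End convex_cost.
End descent.

(** * The cost and its surrogate *)

Section control_cost.
Set Implicit Arguments.
Unset Strict Implicit.
Context {R : realType}.

Lemma subrVE k (a b : 'rV[R]_k) i : (a - b) 0 i = a 0 i - b 0 i.
Proof. by rewrite !mxE. Qed.

Lemma scalerVE k (c : R) (a : 'rV[R]_k) i : (c *: a) 0 i = c * a 0 i.
Proof. by rewrite mxE. Qed.

Lemma enorm_row_mx0 k l (a : 'rV[R]_k) : enorm (row_mx a (0 : 'rV[R]_l)) = enorm a.
Proof.
rewrite /enorm big_split_ord/= [X in _ + X]big1 ?addr0.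
  by congr Num.sqrt; apply: eq_bigr => i _; rewrite row_mxEl.
by move=> i _; rewrite row_mxEr mxE expr0n.
Qed.

Lemma node_val_C2 d p k (F : compfun R d p) (psi : 'I_d -> 'rV[R]_k -> R) :
  nodes_C2 F -> (forall j, twice_cont_diff (psi j)) ->
  forall v : node F, twice_cont_diff (fun U => node_val 0 (input_val (\row_j psi j U)) v).
Proof.
move=> C2 psi2 v; elim/(@layer_ind _ _ _ F): v => v IH.
have [vi|vi] := boolP (is_input v).
  have [j Ev] := inputP vi.
  rewrite (_ : (fun _ => _) = psi j)//.
  by apply/funext => U; rewrite node_val0E vi Ev input_val_inode mxE.
rewrite (_ : (fun _ => _) = (fun U => fnode (\row_j
   (fun j U => node_val 0 (input_val (\row_j psi j U)) (@enum_val _ [pred u | edge u v] j)) j U))).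
  apply: (@twice_cont_diff_comp _ _ _ (@fnode _ _ _ F v)
    (fun j U => node_val 0 (input_val (\row_j psi j U)) (@enum_val _ [pred u | edge u v] j))).
    exact: C2.
  by move=> j; apply: IH; exact: edge_enum_val.
by apply/funext => U; rewrite node_val0E (negbTE vi).
Qed.

Section dynamics.
Variables (n q N : nat) (f : 'rV[R]_n -> 'rV[R]_q -> 'rV[R]_n) (g : 'rV[R]_n -> R).
Variables (F : compfun R (n + q) n) (G : compfun R n 1).
Hypotheses (hF : forall x u, ceval F (row_mx x u) = f x u) (hG : forall x, ceval G x 0 0 = g x).
Implicit Types (x : 'rV[R]_n) (U : 'rV[R]_(N * q)).

(** Each control variable is a coordinate of [U]; the second case of the definition
    of [control] only occurs beyond the horizon. *)
Lemma control_coord p (j : 'I_q) : exists c : 'rV[R]_(N * q) -> R,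
  (forall U, control U p 0 j = c U) /\ (c = (fun=> 0) \/ exists i, c = (fun U => U 0 i)).
Proof.
rewrite /control; case: insubP => [i _ _|_].
  exists (fun U => U 0 (mxvec_index i j)); split; last by right; eexists.
  by move=> U; rewrite mxE -[U in RHS]vec_mxK mxvecE.
by exists (fun=> 0); split => [U|]; [rewrite mxE|left].
Qed.

Lemma control_C2 p (j : 'I_q) : twice_cont_diff (fun U : 'rV[R]_(N * q) => control U p 0 j).
Proof.
have [c [cE cc]] := control_coord p j.
rewrite (_ : (fun _ => _) = c); last by apply/funext.
by case: cc => [->|[i ->]]; [exact: twice_cont_diff_cst|exact: twice_cont_diff_coord].
Qed.

Lemma state_C2 x p i : nodes_C2 F -> twice_cont_diff (fun U => state f x U p 0 i).
Proof.
move=> C2; elim: p i => [|p IHp] i /=; first exact: twice_cont_diff_cst.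
pose psi (j : 'I_(n + q)) (U : 'rV[R]_(N * q)) := (row_mx (state f x U p) (control U p)) 0 j.
rewrite (_ : (fun _ => _) = (fun U => node_val 0 (input_val (\row_j psi j U)) (onode F i))).
  apply: node_val_C2 => // j; rewrite /psi.
  case: (splitP j) => l jl.
    rewrite (_ : (fun _ => _) = (fun U => state f x U p 0 l)); first exact: IHp.
    by apply/funext => U; rewrite (_ : j = lshift _ l) ?row_mxEl//; exact: val_inj.
  rewrite (_ : (fun _ => _) = (fun U => control U p 0 l)); first exact: control_C2.
  by apply/funext => U; rewrite (_ : j = rshift _ l) ?row_mxEr//; exact: val_inj.
apply/funext => U; rewrite -hF /ceval mxE; congr (node_val _ (input_val _) _).
by apply/rowP => j; rewrite mxE.
Qed.

Lemma cost_C2 x : nodes_C2 F -> nodes_C2 G -> twice_cont_diff (cost f g x : 'rV[R]_(N * q) -> R).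
Proof.
move=> CF CG; rewrite (_ : cost f g x = (fun U => node_val 0
   (input_val (\row_j (fun j U => state f x U N 0 j) j U)) (onode G 0))).
  by apply: (@node_val_C2 _ _ _ G (fun j U => state f x U N 0 j)) => // j; exact: state_C2.
apply/funext => U; rewrite /cost -hG /ceval mxE; congr (node_val _ (input_val _) _).
by apply/rowP => j; rewrite mxE.
Qed.

Variables (Fh : compfun R (n + q) n) (Gh : compfun R n 1).

Definition surrogate_state x U p : 'rV[R]_n :=
  state (fun y u => ceval Fh (row_mx y u)) x U p.

(** The approximate terminal state may leave the cube on which [Gh] approximates [g].
    It is pulled back by the factor [1 - eta], and the linear term that [g] loses thereby
    is added again, as in [scaled_evaluation]. *)
Definition surrogate_cost (eta : R) x U : R :=
  let y := surrogate_state x U N in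
  ceval Gh ((1 - eta) *: y) 0 0 + eta * (y *m linear_mx G) 0 0.

Section errors.
Variables (Rb ef eg Lf Lg M : R).
Hypotheses (n0 : (0 < n)%N) (Rb1 : 1 < Rb) (ef0 : 0 <= ef)
  (hFh : forall y, cube Rb y -> enorm (ceval F y - ceval Fh y) <= ef)
  (hGh : forall y, cube Rb y -> enorm (ceval G y - ceval Gh y) <= eg)
  (hLf : elipschitz Lf (cube Rb) (fun y => f (lsubmx y) (rsubmx y)))
  (hLg : forall x y, cube Rb x -> cube Rb y -> `|g x - g y| <= Lg * enorm (x - y))
  (hM : forall y (eta : R), cube Rb y -> 0 <= eta <= 1 ->
     enorm (ceval G y - ceval G ((1 - eta) *: y) - eta *: (y *m linear_mx G)) <= M * eta).

Lemma cube_scale k (rho t : R) (y : 'rV[R]_k) : 0 <= t <= 1 -> cube rho y -> cube rho (t *: y).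
Proof.
move=> /andP[t0 t1] yc i; rewrite mxE normrM ger0_norm// (le_trans _ (yc i))//.
by rewrite ler_piMl.
Qed.

Lemma unit_cube k (y : 'rV[R]_k) : enorm y <= 1 -> cube Rb y.
Proof. by move=> y1 i; rewrite (le_trans (coord_le_enorm y i))// (le_trans y1)// ltW. Qed.

Lemma lipschitz_f_ge0 : 0 <= Lf.
Proof.
pose e : 'rV[R]_(n + q) := delta_mx 0 (lshift q (Ordinal n0)).
have e1 : enorm e = 1 by exact: enorm_delta.
have := @hLf e 0; rewrite subr0 e1 mulr1 => H.
apply: (le_trans (enorm_ge0 _)); apply: H; apply: unit_cube; rewrite ?e1// enorm0.
exact: ler01.
Qed.

Lemma lipschitz_g_ge0 : 0 <= Lg.
Proof.
pose e : 'rV[R]_n := delta_mx 0 (Ordinal n0).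
have e1 : enorm e = 1 by exact: enorm_delta.
have := @hLg e 0; rewrite subr0 e1 mulr1 => H.
apply: (le_trans (normr_ge0 _)); apply: H; apply: unit_cube; rewrite ?e1// enorm0.
exact: ler01.
Qed.

Lemma enorm1 (z : 'rV[R]_1) : enorm z = `|z 0 0|.
Proof. by rewrite /enorm big_ord1 sqrtr_sqr. Qed.

Lemma scaled_g y eta : cube Rb y -> 0 <= eta <= 1 ->
  `|g y - g ((1 - eta) *: y) - eta * (y *m linear_mx G) 0 0| <= M * eta.
Proof. by move=> yc e01; have := hM yc e01; rewrite enorm1 !subrVE scalerVE !hG. Qed.

Let a : 'rV[R]_n := (linear_mx G)^T.

Lemma linear_partE y : (y *m linear_mx G) 0 0 = dot y a.
Proof. by rewrite mxE; apply: eq_bigr => i _; rewrite [a 0 i]mxE. Qed.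

(** The estimate [hM] with [eta = 1] at the unit vector in direction [a], where the
    linear part equals the norm of [a]. *)
Lemma linear_part_le : enorm a <= Lg + M.
Proof.
have M0 : 0 <= M.
  have := @hM 0 1; rewrite mulr1 ler01 lexx => H; apply: (le_trans (enorm_ge0 _)).
  by apply: H => //; apply: unit_cube; rewrite enorm0 ler01.
have [->|a0] := eqVneq (enorm a) 0; first by rewrite addr_ge0// lipschitz_g_ge0.
have agt0 : 0 < enorm a by rewrite lt_neqAle eq_sym a0 enorm_ge0.
pose y := (enorm a)^-1 *: a.
have y1 : enorm y = 1 by rewrite enormZ ger0_norm ?invr_ge0 ?enorm_ge0// mulVf.
have yc : cube Rb y by apply: unit_cube; rewrite y1.
have zc : cube Rb (0 : 'rV[R]_n) by apply: unit_cube; rewrite enorm0 ler01.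
have := @scaled_g y 1 yc; rewrite subrr scale0r mul1r mulr1 ler01 lexx => /(_ isT).
have := hLg yc zc; rewrite subr0 y1 mulr1 linear_partE dotZl -enorm_sqr expr2 mulrA mulVf// mul1r.
by rewrite !ler_norml => /andP[A1 A2] /andP[A3 A4]; lra.
Qed.

Definition geometric_sum (p : nat) : R := \sum_(j < p) Lf ^+ j.

Lemma geometric_sumS p : geometric_sum p.+1 = 1 + Lf * geometric_sum p.
Proof.
rewrite /geometric_sum big_ord_recl expr0 mulr_sumr; congr (_ + _).
by apply: eq_bigr => j _; rewrite exprS.
Qed.

Lemma geometric_sum_ge0 p : 0 <= geometric_sum p.
Proof. by apply: sumr_ge0 => j _; rewrite exprn_ge0// lipschitz_f_ge0. Qed.

Lemma geometric_sum_mono p r : (p <= r)%N -> geometric_sum p <= geometric_sum r.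
Proof.
move=> pr; rewrite /geometric_sum (big_ord_widen _ (fun j => Lf ^+ j) pr) big_mkcond/=.
by apply: ler_sum => j _; case: ifP => // _; rewrite exprn_ge0// lipschitz_f_ge0.
Qed.

Variables (x : 'rV[R]_n) (U : 'rV[R]_(N * q)).
Hypotheses (N0 : (0 < N)%N) (Uc : cube Rb U)
  (htraj : forall p, (p <= N - 1)%N -> cube (Rb / 2) (state f x U p))
  (hterm : cube Rb (state f x U N)).
Let E := ef * geometric_sum N.
Hypothesis (E2 : E <= 1 / 2).

Lemma control_cube p : cube Rb (control U p).
Proof.
move=> j; have [c [cE [c0|[i ci]]]] := control_coord p j; rewrite cE.
  by rewrite c0 normr0 ltW// (lt_trans ltr01).
by rewrite ci; exact: Uc.
Qed.

Lemma row_mx_cube (y : 'rV[R]_n) p : cube Rb y -> cube Rb (row_mx y (control U p)).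
Proof.
move=> yc j; case: (split_ordP j) => l ->; rewrite ?row_mxEl ?row_mxEr; [exact: yc|exact: control_cube].
Qed.

(** The exact trajectory stays in the cube of radius [Rb / 2], and [E <= 1 / 2 < Rb / 2],
    so that the approximate one stays where [Fh] approximates [f]. *)
Lemma surrogate_state_error p : (p <= N)%N ->
  enorm (surrogate_state x U p - state f x U p) <= ef * geometric_sum p.
Proof.
elim: p => [_|p IHp pN]; first by rewrite subrr enorm0 /geometric_sum big_ord0 mulr0.
have {}IHp := IHp (ltnW pN).
have pN1 : (p <= N - 1)%N by rewrite subn1 -ltnS prednK.
set y := surrogate_state x U p in IHp *; pose z := state f x U p.
have zc2 : cube (Rb / 2) z by exact: htraj.
have zc : cube Rb z by move=> i; rewrite (le_trans (zc2 i))//; have := Rb1; lra.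
have yc : cube Rb y.
  move=> i; rewrite -(subrK (z 0 i) (y 0 i)); apply: (le_trans (ler_normD _ _)).
  have := coord_le_enorm (y - z) i; rewrite !mxE => c1.
  have c2 := zc2 i; have : ef * geometric_sum p <= E.
    by rewrite ler_wpM2l// geometric_sum_mono// ltnW.
  move: IHp; rewrite -/z => c3 c4; have := E2; have := Rb1; lra.
rewrite geometric_sumS mulrDr mulr1.
rewrite /surrogate_state /= -/(surrogate_state x U p) -/y -/z -hF.
apply: (le_trans (enorm_triangle (ceval F (row_mx y (control U p))) _ _)); apply: lerD.
  by rewrite enormBC; apply: hFh; exact: row_mx_cube.
have := @hLf _ _ (row_mx_cube p yc) (row_mx_cube p zc).
rewrite !row_mxKl !row_mxKr !hF => /le_trans; apply.
rewrite mulrCA ler_wpM2l ?lipschitz_f_ge0//; apply: le_trans IHp.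
by rewrite -/z opp_row_mx add_row_mx subrr enorm_row_mx0.
Qed.

(** The factor [1 - E] is just enough, since [(1 - E) (Rb + E) <= Rb] for [1 <= Rb]. *)
Lemma surrogate_cost_error :
  `|surrogate_cost E x U - cost f g x U| <= eg + 2 * (Lg + M) * E.
Proof.
have E0 : 0 <= E by rewrite mulr_ge0// geometric_sum_ge0.
have E2' := E2.
have E01 : 0 <= E <= 1 by rewrite E0/=; lra.
have Lg0 := lipschitz_g_ge0.
have aL := linear_part_le.
have M0 : 0 <= M.
  have := @hM 0 1; rewrite mulr1 ler01 lexx => H; apply: (le_trans (enorm_ge0 _)).
  by apply: H => //; apply: unit_cube; rewrite enorm0 ler01.
rewrite /surrogate_cost /cost; set yh := surrogate_state x U N; set y := state f x U N.
have yc : cube Rb y := hterm.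
have dy : enorm (yh - y) <= E by exact: surrogate_state_error.
have y'c : cube Rb ((1 - E) *: y) by apply: cube_scale => //; lra.
have yh'c : cube Rb ((1 - E) *: yh).
  move=> i; have := coord_le_enorm (yh - y) i; rewrite !mxE => c1.
  rewrite normrM ger0_norm; last by lra.
  have c2 : `|yh 0 i| <= Rb + E.
    rewrite -(subrK (y 0 i) (yh 0 i)) addrC; apply: (le_trans (ler_normD _ _)).
    by apply: lerD; [exact: yc|exact: le_trans dy].
  have E1 : 0 <= 1 - E by lra.
  by apply: (le_trans (ler_wpM2l E1 c2)); have := Rb1; nra.
have T1 : `|ceval Gh ((1 - E) *: yh) 0 0 - g ((1 - E) *: yh)| <= eg.
  by have := hGh yh'c; rewrite enormBC enorm1 subrVE hG.
have T2 : `|g ((1 - E) *: yh) - g ((1 - E) *: y)| <= Lg * E.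
  apply: (le_trans (hLg yh'c y'c)); rewrite ler_wpM2l// -scalerBr enormZ ger0_norm; last by lra.
  by apply: (le_trans _ dy); rewrite ler_piMl ?enorm_ge0//; lra.
have T3 := scaled_g yc E01.
have T4 : `|E * ((yh *m linear_mx G) 0 0 - (y *m linear_mx G) 0 0)| <= (Lg + M) * E.
  rewrite !linear_partE -dotBl normrM ger0_norm// mulrC ler_wpM2r//.
  apply: (le_trans (cauchy_schwarz _ _)); apply: (le_trans _ aL).
  by rewrite ler_piMl ?enorm_ge0//; lra.
rewrite (_ : _ - _ = (ceval Gh ((1 - E) *: yh) 0 0 - g ((1 - E) *: yh))
  + (g ((1 - E) *: yh) - g ((1 - E) *: y)) - (g y - g ((1 - E) *: y) - E * (y *m linear_mx G) 0 0)
  + E * ((yh *m linear_mx G) 0 0 - (y *m linear_mx G) 0 0)); last by ring.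
apply: (le_trans (ler_normD _ _)); apply: (@le_trans _ _ ((eg + Lg * E + M * E) + (Lg + M) * E)).
  apply: lerD => //; apply: (le_trans (ler_normB _ _)); apply: lerD => //.
  by apply: (le_trans (ler_normD _ _)); exact: lerD.
by lra.
Qed.

End errors.
End dynamics.
End control_cost.

(** * The network that performs the descent *)

Section descent_network.
Set Implicit Arguments.
Unset Strict Implicit.
Context {R : realType}.
Variables (sigma : R -> R) (n : nat).
Implicit Types (hs t : seq ('rV[R]_n -> R)).

Definition vec_span k hs (V : 'rV[R]_n -> 'rV[R]_k) : Prop :=
  forall i, aff_span hs (fun x => V x 0 i).

Lemma vec_span_cat k hs t (V : 'rV[R]_n -> 'rV[R]_k) : vec_span hs V -> vec_span (hs ++ t) V.
Proof. by move=> H i; exact: aff_span_cat. Qed.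

(** Evaluating [ev] costs [s] further hidden nodes, whatever has been computed before. *)
Definition programmable k (ev : 'rV[R]_n -> 'rV[R]_k -> R) (s : nat) : Prop :=
  forall hs V, program sigma hs -> vec_span hs V ->
  exists t, [/\ size t = s, program sigma (hs ++ t) & aff_span (hs ++ t) (fun x => ev x (V x))].

Section surrogate.
Variables (q N : nat) (Fh : compfun R (n + q) n) (Gh G : compfun R n 1) (eta : R).
Hypotheses (nnF : is_nn sigma Fh) (nnG : is_nn sigma Gh).

Lemma program_surrogate_state hs (V : 'rV[R]_n -> 'rV[R]_(N * q)) p :
  program sigma hs -> vec_span hs V ->
  exists t, [/\ size t = (p * nn_size Fh)%N, program sigma (hs ++ t) &
     vec_span (hs ++ t) (fun x => surrogate_state Fh x (V x) p)].
Proof.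
move=> phs sV; elim: p => [|p [t [st pt spt]]].
  by exists [::]; rewrite cats0; split => // i; exact: aff_span_coord.
pose phi (j : 'I_(n + q)) x := (row_mx (surrogate_state Fh x (V x) p) (control (V x) p)) 0 j.
have sphi j : aff_span (hs ++ t) (phi j).
  rewrite /phi; case: (split_ordP j) => l ->.
    rewrite (_ : (fun _ => _) = (fun x => surrogate_state Fh x (V x) p 0 l)); first exact: spt.
    by apply/funext => x; rewrite row_mxEl.
  have [c [cE cc]] := @control_coord R q N p l.
  rewrite (_ : (fun _ => _) = (fun x => c (V x))); last by apply/funext => x; rewrite row_mxEr cE.
  by case: cc => [->|[i ->]]; [exact: aff_span_cst|apply: aff_span_cat; exact: sV].
have [t' [st' pt' spt']] := program_substitution nnF pt sphi.
exists (t ++ t'); rewrite catA size_cat st st' mulSn addnC; split => // i.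
rewrite (_ : (fun _ => _) = (fun x => ceval Fh (\row_j phi j x) 0 i))//.
apply/funext => x; rewrite /surrogate_state /= -/(surrogate_state Fh x (V x) p).
by congr (ceval Fh _ 0 i); apply/rowP => j; rewrite [in RHS]mxE.
Qed.

Lemma surrogate_programmable :
  programmable (surrogate_cost G Fh Gh eta : 'rV[R]_n -> 'rV[R]_(N * q) -> R)
    (N * nn_size Fh + nn_size Gh).
Proof.
move=> hs V phs sV; have [t [st pt spt]] := @program_surrogate_state hs V N phs sV.
pose phi (j : 'I_n) x := ((1 - eta) *: surrogate_state Fh x (V x) N) 0 j.
have sphi j : aff_span (hs ++ t) (phi j).
  rewrite (_ : phi j = fun x => (1 - eta) * surrogate_state Fh x (V x) N 0 j).
    by apply: aff_spanZ; exact: spt.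
  by apply/funext => x; rewrite /phi scalerVE.
have [t' [st' pt' spt']] := program_substitution nnG pt sphi.
exists (t ++ t'); rewrite catA size_cat st st'; split => //.
apply: aff_spanD.
  rewrite (_ : (fun _ => _) = (fun x => ceval Gh (\row_j phi j x) 0 0))//.
  apply/funext => x; congr (ceval Gh _ 0 0); apply/rowP => j; by rewrite [in RHS]mxE.
apply: aff_spanZ.
rewrite (_ : (fun _ => _) = (fun x => \sum_j linear_mx G j 0 * surrogate_state Fh x (V x) N 0 j)).
  by apply: aff_span_sum => j; apply: aff_span_cat; exact: spt.
by apply/funext => x; rewrite mxE; apply: eq_bigr => j _; rewrite mulrC.
Qed.

End surrogate.

Section iteration.
Variables (k s : nat) (ev : 'rV[R]_n -> 'rV[R]_k -> R).
Hypothesis pev : programmable ev s.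

Lemma program_family hs (V : nat -> 'rV[R]_n -> 'rV[R]_k) m :
  program sigma hs -> (forall l, vec_span hs (V l)) ->
  exists t, [/\ size t = (m * s)%N, program sigma (hs ++ t) &
     forall l, (l < m)%N -> aff_span (hs ++ t) (fun x => ev x (V l x))].
Proof.
move=> phs sV; elim: m => [|m [t [st pt spt]]]; first by exists [::]; rewrite cats0; split.
have [t' [st' pt' spt']] := pev pt (vec_span_cat t (sV m)).
exists (t ++ t'); rewrite catA size_cat st st' mulSn addnC; split => // l.
by rewrite ltnS leq_eqVlt => /orP[/eqP ->//|lm]; apply: aff_span_cat; exact: spt.
Qed.

Variables (U0 : 'rV[R]_k) (L h tau : R).

Definition network_iterate j (x : 'rV[R]_n) : 'rV[R]_k :=
  iterate U0 L (forward_difference (ev x) h) tau j.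

(** The [k] shifted points and the point itself make [k + 1] evaluations; the rest of
    the step is affine. *)
Lemma program_step hs (V : 'rV[R]_n -> 'rV[R]_k) : program sigma hs -> vec_span hs V ->
  exists t, [/\ size t = (k.+1 * s)%N, program sigma (hs ++ t) &
    vec_span (hs ++ t) (fun x => anchored_step U0 L (forward_difference (ev x) h) tau (V x))].
Proof.
move=> phs sV.
(* W l is the point shifted in coordinate l for l < k, and W k is the point itself *)
pose W l x : 'rV[R]_k := V x + (if insub l is Some i then h *: delta_mx 0 (i : 'I_k) else 0).
have sW l : vec_span hs (W l).
  move=> i; rewrite (_ : (fun _ => _) = (fun x => V x 0 i +
     (if insub l is Some i' then h *: delta_mx 0 (i' : 'I_k) else 0 : 'rV[R]_k) 0 i)).
    by apply: aff_spanD; [exact: sV|exact: aff_span_cst].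
  by apply/funext => x; rewrite /W mxE.
have [t [st pt spt]] := @program_family hs W k.+1 phs sW.
exists t; split => // i.
rewrite (_ : (fun _ => _) = (fun x => ((1 - tau) * V x 0 i +
   (- ((1 - tau) * L^-1 * h^-1)) * ev x (W i x)) + ((1 - tau) * L^-1 * h^-1) * ev x (W k x)
   + tau * U0 0 i)).
  apply: aff_spanD; last exact: aff_span_cst.
  apply: aff_spanD; last by apply: aff_spanZ; exact: spt.
  apply: aff_spanD; first by apply: aff_spanZ; apply: aff_span_cat; exact: sV.
  by apply: aff_spanZ; apply: spt; exact: ltnW (ltn_ord i).
apply/funext => x; rewrite /anchored_step /forward_difference !mxE /W.
rewrite valK insubN ?ltnn// addr0; ring.
Qed.

Lemma program_iterate hs K : program sigma hs ->
  exists t, [/\ size t = (K * (k.+1 * s))%N, program sigma (hs ++ t) &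
    forall j, (j <= K)%N -> vec_span (hs ++ t) (network_iterate j)].
Proof.
move=> phs; elim: K => [|K [t [st pt spt]]].
  exists [::]; rewrite cats0; split => // j; rewrite leqn0 => /eqP -> i.
  exact: aff_span_cst.
have [t' [st' pt' spt']] := program_step pt (spt K (leqnn K)).
exists (t ++ t'); rewrite catA size_cat st st' mulSn addnC; split => // j.
rewrite leq_eqVlt => /orP[/eqP ->//|jK]; apply: vec_span_cat; exact: spt.
Qed.

Lemma average_network K : (0 < n)%N -> (0 < k)%N ->
  exists NN : compfun R n k,
    [/\ is_nn sigma NN, nn_size NN = (K * (k.+1 * s)).+1 &
        forall x, ceval NN x = average U0 L (forward_difference (ev x) h) tau K].
Proof.
move=> n0 k0.
have p1 : program sigma [:: (fun=> 1) : 'rV[R]_n -> R].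
  by apply: (@program_affine R n sigma [::]); [exact: program_nil|exact: aff_span_cst].
have [t [st pt spt]] := program_iterate K p1.
pose psi (i : 'I_k) x := average U0 L (forward_difference (ev x) h) tau K 0 i.
have spsi i : aff_span ((fun=> 1) :: t) (psi i).
  rewrite (_ : psi i = (fun x => \sum_(j < K) K%:R^-1 * network_iterate j x 0 i)).
    apply: (@aff_span_sum _ _ _ _ _ (fun=> K%:R^-1) (fun (j : 'I_K) x => network_iterate j x 0 i)) => j.
    by apply: spt; exact: ltnW (ltn_ord j).
  by apply/funext => x; rewrite /psi /average mxE summxE mulr_sumr.
have [NN [nnN sN eN]] := program_realization n0 k0 pt spsi.
exists NN; split => //; first by rewrite sN st.
by move=> x; rewrite eN; apply/rowP => i; rewrite mxE.
Qed.

End iteration.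
End descent_network.

(** * The constants, and the parameters of the descent *)

Section constants.
Set Implicit Arguments.
Unset Strict Implicit.
Context {R : realType}.

Definition mvar k (i : 'I_k) : mpoly k R := mpolyX R (mnm1 i).

Definition multideg_le k (b : 'I_k -> nat) (p : mpoly k R) : bool :=
  all (fun a : multinom k => [forall i, (a i <= b i)%N]) (msupp p).

Lemma multideg_leP k (b : 'I_k -> nat) (p : mpoly k R) :
  reflect (forall a i, a \in msupp p -> (a i <= b i)%N) (multideg_le b p).
Proof.
apply: (iffP allP) => [H a i /H/forallP/(_ i)//|H a ap].
by apply/forallP => i; exact: H.
Qed.

Lemma multideg_le_weaken k (b b' : 'I_k -> nat) p :
  (forall i, (b i <= b' i)%N) -> multideg_le b p -> multideg_le b' p.
Proof.
by move=> bb' /multideg_leP H; apply/multideg_leP => a i /(H a i)/leq_trans; apply.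
Qed.

Lemma multideg_leC k (b : 'I_k -> nat) (c : R) : multideg_le b (mpolyC k c).
Proof.
apply/multideg_leP => a i; rewrite msuppC; case: ifP => // _; rewrite inE => /eqP ->; by rewrite mnm0E.
Qed.

Lemma multideg_leX k (i : 'I_k) : multideg_le (fun j => (i == j) : nat) (mvar i).
Proof. by apply/multideg_leP => a j; rewrite msuppX inE => /eqP ->; rewrite mnm1E. Qed.

Lemma multideg_leD k (b : 'I_k -> nat) (p p' : mpoly k R) :
  multideg_le b p -> multideg_le b p' -> multideg_le b (p + p').
Proof.
move=> /multideg_leP H /multideg_leP H'; apply/multideg_leP => a i /msuppD_le.
by rewrite mem_cat => /orP[/H|/H'].
Qed.

Lemma multideg_leM k (b b' : 'I_k -> nat) (p p' : mpoly k R) :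
  multideg_le b p -> multideg_le b' p' -> multideg_le (fun i => b i + b' i)%N (p * p').
Proof.
move=> /multideg_leP H /multideg_leP H'; apply/multideg_leP => a i /msuppM_le/allpairsP[[a1 a2] /= [h1 h2 ->]].
by rewrite mnmDE leq_add ?H ?H'.
Qed.

Lemma multideg_leXn k (i : 'I_k) m : multideg_le (fun j => (i == j) * m)%N (mvar i ^+ m).
Proof.
elim: m => [|m IHm]; first by rewrite expr0 -mpolyC1; exact: multideg_leC.
rewrite exprS; apply: (multideg_le_weaken _ (multideg_leM (multideg_leX i) IHm)) => j.
by rewrite mulnS.
Qed.

Lemma multideg_le_sum k I (r : seq I) (b : 'I_k -> nat) (p : I -> mpoly k R) :
  (forall j, multideg_le b (p j)) -> multideg_le b (\sum_(j <- r) p j).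
Proof.
move=> H; elim: r => [|j r IHr]; first by rewrite big_nil -mpolyC0; exact: multideg_leC.
by rewrite big_cons; exact: multideg_leD.
Qed.

Definition idx10 (m : nat) : 'I_10 := inord m.
Definition mvar10 (m : nat) : mpoly 10 R := mvar (idx10 m).

(** Variables 0 to 9 stand for [Lg, Cf, Lmaxf, Lamf, Vf, Cg, Lmaxg, Lamg, Vg, Lf]. *)
Definition scaling_bound_g : mpoly 10 R := mvar10 6 * mvar10 7 * mvar10 8.

(** [surrogate_cost_error] bounds the error by [nw^(-1/r)] times
    [2 (Lg + M) S Cf Lmaxf Lamf Vf + Cg M], where [M = Lmaxg Lamg Vg] and [S] is the geometric
    sum of [Lf]. The summand 1 next to [Lg] also keeps the error of the trajectory below
    [1 / 2]. *)
Definition surrogate_constant (N : nat) : mpoly 10 R :=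
  (mpolyC 10 2 * (mpolyC 10 1 + mvar10 0 + scaling_bound_g)) *
  ((\sum_(j < N) mvar10 9 ^+ j) * (mvar10 1 * mvar10 2 * mvar10 3 * mvar10 4))
  + mvar10 5 * scaling_bound_g.

Lemma peval_mvar10 m (s : seq R) : (m < 10)%N -> peval (mvar10 m) s = s`_m.
Proof. by move=> m10; rewrite /peval mevalXU inordK. Qed.

Lemma meval_exp k (v : 'I_k -> R) (p : mpoly k R) m : meval v (p ^+ m) = meval v p ^+ m.
Proof. by elim: m => [|m IHm]; rewrite ?meval1// !exprS mevalM IHm. Qed.

Lemma meval_sum k (v : 'I_k -> R) I (r : seq I) (p : I -> mpoly k R) :
  meval v (\sum_(j <- r) p j) = \sum_(j <- r) meval v (p j).
Proof.
by elim: r => [|j r IHr]; rewrite ?(big_nil, big_cons) ?meval0// mevalD IHr.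
Qed.

Lemma peval_surrogate_constant N (s : seq R) :
  peval (surrogate_constant N) s =
  2 * (1 + s`_0 + s`_6 * s`_7 * s`_8) *
    ((\sum_(j < N) s`_9 ^+ j) * (s`_1 * s`_2 * s`_3 * s`_4)) + s`_5 * (s`_6 * s`_7 * s`_8).
Proof.
have E m : (m < 10)%N -> meval (fun i : 'I_10 => s`_i) (mvar10 m) = s`_m := @peval_mvar10 m s.
rewrite /peval /surrogate_constant /scaling_bound_g !(mevalD, mevalM) !mevalC !E//.
congr (_ * (_ * _) + _); rewrite meval_sum.
by apply: eq_bigr => j _; rewrite meval_exp E.
Qed.

Lemma nth_ge0 (s : seq R) i : all (fun a => 0 <= a) s -> 0 <= s`_i.
Proof.
by move=> /allP s0; have [/mem_nth/s0//|ge_] := ltnP i (size s); rewrite nth_default.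
Qed.

Lemma surrogate_constant_ge0 N : pnonneg (surrogate_constant N).
Proof.
move=> s s0; have H i : 0 <= s`_i by exact: nth_ge0.
rewrite peval_surrogate_constant addr_ge0// ?mulr_ge0// ?addr_ge0 ?mulr_ge0//.
by apply: sumr_ge0 => j _; rewrite exprn_ge0.
Qed.

Lemma surrogate_constant_deg N a (i : 'I_10) : a \in msupp (surrogate_constant N) ->
  (a i <= (if (i < 9)%N then 1 else N))%N.
Proof.
have X m : multideg_le (fun j => (idx10 m == j) : nat) (mvar10 m) by exact: multideg_leX.
have oE m (j : 'I_10) : (m < 10)%N -> (idx10 m == j) = (m == j :> nat).
  by move=> m10; rewrite -val_eqE /= inordK.
pose bg (j : 'I_10) := ((idx10 6 == j) + (idx10 7 == j) + (idx10 8 == j))%N.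
have Dg : multideg_le bg scaling_bound_g by exact: (multideg_leM (multideg_leM (X 6) (X 7)) (X 8)).
pose b1 (j : 'I_10) := ((idx10 0 == j) + bg j)%N.
have D1 : multideg_le b1 (mpolyC 10 2 * (mpolyC 10 1 + mvar10 0 + scaling_bound_g)).
  rewrite -[b1]/(fun j => (0 + b1 j)%N); apply: multideg_leM; first exact: multideg_leC.
  apply: multideg_leD; last by apply: (multideg_le_weaken _ Dg) => j; exact: leq_addl.
  apply: multideg_leD; first exact: multideg_leC.
  by apply: (multideg_le_weaken _ (X 0%N)) => j; exact: leq_addr.
pose b9 (j : 'I_10) := ((idx10 9 == j) * N)%N.
have D9 : multideg_le b9 (\sum_(j < N) mvar10 9 ^+ j).
  apply: multideg_le_sum => j; apply: (multideg_le_weaken _ (multideg_leXn (idx10 9) j)) => l.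
  by rewrite leq_mul2l ltnW ?orbT.
pose b4 (j : 'I_10) := ((idx10 1 == j) + (idx10 2 == j) + (idx10 3 == j) + (idx10 4 == j))%N.
have D4 : multideg_le b4 (mvar10 1 * mvar10 2 * mvar10 3 * mvar10 4).
  exact: (multideg_leM (multideg_leM (multideg_leM (X 1) (X 2)) (X 3)) (X 4)).
have D5 := multideg_leM (X 5) Dg.
pose b (j : 'I_10) := (if (j < 9)%N then 1 else N)%N.
suff /multideg_leP : multideg_le b (surrogate_constant N) by apply.
apply: multideg_leD.
  apply: (multideg_le_weaken _ (multideg_leM D1 (multideg_leM D9 D4))) => j.
  rewrite /b1 /b9 /b4 /bg /b !oE//.
  by case: j => -[|[|[|[|[|[|[|[|[|[|//]]]]]]]]]] _ /=; rewrite ?mul1n ?addn0.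
apply: (multideg_le_weaken _ D5) => j; rewrite /bg /b !oE//.
by case: j => -[|[|[|[|[|[|[|[|[|[|//]]]]]]]]]] _ /=.
Qed.

(** The product of the numerical factors met in [cost_accuracy_le]. *)
Definition accuracy_factor : R := 2 ^+ 13.

Lemma accuracy_factor_gt0 : 0 < accuracy_factor.
Proof. by rewrite exprn_gt0. Qed.

Definition idx3 (m : nat) : 'I_3 := inord m.
Definition accuracy_constant : mpoly 3 R :=
  mpolyC 3 1 + mpolyC 3 accuracy_factor * (mvar (idx3 0) ^+ 6 * mvar (idx3 2) ^+ 3).
Definition steps_constant : mpoly 3 R :=
  mpolyC 3 3 * (mpolyC 3 1 + mpolyC 3 4 * (mvar (idx3 0) * mvar (idx3 0) * mvar (idx3 2))).

Lemma peval_accuracy_constant (s : seq R) :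
  peval accuracy_constant s = 1 + accuracy_factor * (s`_0 ^+ 6 * s`_2 ^+ 3).
Proof.
rewrite /peval; set v := (fun i : 'I_3 => s`_i).
have E i m : meval v (mvar i ^+ m) = v i ^+ m by rewrite meval_exp mevalXU.
have M (p p' : mpoly 3 R) : meval v (p * p') = meval v p * meval v p' by exact: mevalM.
by rewrite mevalD M (M (_ ^+ 6)) !E !mevalC /v /idx3 !inordK.
Qed.

Lemma peval_steps_constant (s : seq R) :
  peval steps_constant s = 3 * (1 + 4 * (s`_0 ^+ 2 * s`_2)).
Proof.
by rewrite /peval mevalM mevalD !mevalM !mevalC !mevalXU /idx3 !inordK// expr2.
Qed.

Lemma accuracy_constant_ge0 : pnonneg accuracy_constant.
Proof.
move=> s s0; rewrite peval_accuracy_constant addr_ge0// mulr_ge0 ?(ltW accuracy_factor_gt0)//.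
by rewrite mulr_ge0// exprn_ge0// nth_ge0.
Qed.

Lemma steps_constant_ge0 : pnonneg steps_constant.
Proof.
by move=> s s0; rewrite peval_steps_constant mulr_ge0// addr_ge0// !mulr_ge0 ?exprn_ge0 ?nth_ge0.
Qed.

End constants.

Section parameters.
Set Implicit Arguments.
Unset Strict Implicit.
Context {R : realType}.

Lemma nat_above_within1 (x : R) : 0 <= x -> exists2 m : nat, x <= m%:R & m%:R <= x + 1.
Proof.
move=> x0; exists (Num.truncn x).+1; first exact/ltW/truncnS_gt.
by rewrite -natr1 lerD2r truncn_le.
Qed.

Variables (L gam eps : R) (D : nat).
Hypotheses (L0 : 0 < L) (gam0 : 0 < gam) (eps01 : 0 < eps < 1) (D0 : (0 < D)%N)
  (big : eps < L * gam ^+ 2).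

(** The choices below let each of the terms in [average_gap] be at most [eps / 4]; the
    accuracy of the cost is what forward differences with this step need in order to
    reach [gradient_accuracy]. *)
Definition anchor_weight := eps / (4 * L * gam ^+ 2).
Definition gradient_accuracy := gam * L * anchor_weight ^+ 2 / 2.
Definition difference_step := gradient_accuracy / (2 * L * Num.sqrt D%:R).
Definition cost_accuracy := eps ^+ 4 / ((1 + accuracy_factor * (gam ^+ 6 * L ^+ 3)) * D%:R).

Let eps0 : 0 < eps. Proof. by case/andP: eps01. Qed.
Let Lg0 : 0 < 4 * L * gam ^+ 2. Proof. by rewrite !mulr_gt0// exprn_gt0. Qed.
Let sD0 : 0 < Num.sqrt (D%:R : R). Proof. by rewrite sqrtr_gt0 ltr0n. Qed.

Lemma anchor_weight_gt0 : 0 < anchor_weight. Proof. exact: divr_gt0. Qed.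

Lemma anchor_weight_lt : anchor_weight <= 1 / 4.
Proof.
rewrite ler_pdivrMr// (_ : 1 / 4 * (4 * L * gam ^+ 2) = L * gam ^+ 2); last by field.
exact: ltW big.
Qed.

Lemma anchor_weightE : L * gam ^+ 2 * anchor_weight = eps / 4.
Proof. by rewrite /anchor_weight; field; rewrite !gt_eqF. Qed.

Lemma gradient_accuracy_gt0 : 0 < gradient_accuracy.
Proof. by rewrite !mulr_gt0 ?exprn_gt0 ?anchor_weight_gt0 ?invr_gt0. Qed.

Lemma difference_step_gt0 : 0 < difference_step.
Proof. by rewrite divr_gt0 ?gradient_accuracy_gt0// !mulr_gt0. Qed.

Lemma gradient_accuracyE : L^-1 * gradient_accuracy = gam * anchor_weight ^+ 2 / 2.
Proof. by rewrite /gradient_accuracy; field; rewrite gt_eqF. Qed.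

Lemma gradient_accuracy_le : L^-1 * gradient_accuracy <= gam * anchor_weight ^+ 2.
Proof.
rewrite gradient_accuracyE; have : 0 <= gam * anchor_weight ^+ 2 by rewrite mulr_ge0 ?sqr_ge0 ?ltW.
by lra.
Qed.

Lemma difference_step_le : difference_step <= gam * anchor_weight.
Proof.
rewrite /difference_step ler_pdivrMr ?mulr_gt0//.
have sD1 : 1 <= Num.sqrt (D%:R : R) by rewrite -[leLHS]sqrtr1 ler_wsqrtr// ler1n.
have w0 := anchor_weight_gt0; have w4 := anchor_weight_lt.
have c0 : 0 <= gam * L * anchor_weight.
  exact: mulr_ge0 (mulr_ge0 (ltW gam0) (ltW L0)) (ltW w0).
rewrite /gradient_accuracy.
have -> : gam * L * anchor_weight ^+ 2 / 2 = (gam * L * anchor_weight) * (anchor_weight / 2) by ring.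
have -> : gam * anchor_weight * (2 * L * Num.sqrt D%:R) =
  (gam * L * anchor_weight) * (2 * Num.sqrt D%:R) by ring.
by rewrite ler_wpM2l//; lra.
Qed.

Lemma cost_accuracy_le : cost_accuracy <= gradient_accuracy ^+ 2 / (8 * L * D%:R).
Proof.
have DR : 0 < D%:R :> R by rewrite ltr0n.
have -> : gradient_accuracy ^+ 2 / (8 * L * D%:R) = eps ^+ 4 / (accuracy_factor * (gam ^+ 6 * L ^+ 3) * D%:R).
  by rewrite /accuracy_factor /gradient_accuracy /anchor_weight; field; rewrite !gt_eqF.
have P0 : 0 < accuracy_factor * (gam ^+ 6 * L ^+ 3).
  by rewrite mulr_gt0 ?accuracy_factor_gt0// mulr_gt0 ?exprn_gt0.
rewrite /cost_accuracy ler_wpM2l ?exprn_ge0 ?(ltW eps0)//.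
rewrite lef_pV2 ?posrE ?mulr_gt0// ?addr_gt0// ler_wpM2r ?(ltW DR)//; lra.
Qed.

Lemma difference_error_le :
  Num.sqrt D%:R * (L * difference_step + 2 * cost_accuracy / difference_step) <= gradient_accuracy.
Proof.
have g0 := gradient_accuracy_gt0; have h0 := difference_step_gt0.
have DR : Num.sqrt (D%:R : R) ^+ 2 = D%:R by rewrite sqr_sqrtr.
have s0 := sD0.
move: h0; rewrite /difference_step; move: (Num.sqrt D%:R) DR s0 => s DR s0 h0.
have D'0 : 0 < D%:R :> R by rewrite ltr0n.
rewrite mulrDr.
have -> : s * (L * (gradient_accuracy / (2 * L * s))) = gradient_accuracy / 2.
  by field; rewrite !gt_eqF.
have -> : s * (2 * cost_accuracy / (gradient_accuracy / (2 * L * s))) =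
  cost_accuracy * (4 * L * D%:R / gradient_accuracy).
  by rewrite -DR; field; rewrite !gt_eqF.
have c0 : 0 <= 4 * L * D%:R / gradient_accuracy by rewrite divr_ge0 ?ltW// !mulr_gt0.
have := ler_wpM2r c0 cost_accuracy_le.
have -> : gradient_accuracy ^+ 2 / (8 * L * D%:R) * (4 * L * D%:R / gradient_accuracy) = gradient_accuracy / 2.
  by field; rewrite !gt_eqF.
by lra.
Qed.

Lemma total_gap_le (K : nat) : 4 * L * gam ^+ 2 / eps <= K%:R ->
  L * (gam ^+ 2 / K%:R + (anchor_weight * gam ^+ 2 +
     4 * gam * (L^-1 * gradient_accuracy) + (L^-1 * gradient_accuracy) ^+ 2)) <= eps.
Proof.
move=> HK; have K0 : 0 < K%:R :> R by apply: lt_le_trans HK; rewrite divr_gt0.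
have t0 := anchor_weight_gt0; have t4 := anchor_weight_lt; have wE := anchor_weightE.
rewrite gradient_accuracyE; set t := anchor_weight in t0 t4 wE *.
have T1 : L * (gam ^+ 2 / K%:R) <= eps / 4.
  rewrite mulrA ler_pdivrMr//.
  by move: HK; rewrite ler_pdivrMr//; lra.
have -> : L * (gam ^+ 2 / K%:R + (t * gam ^+ 2 + 4 * gam * (gam * t ^+ 2 / 2) + (gam * t ^+ 2 / 2) ^+ 2)) =
  L * (gam ^+ 2 / K%:R) + L * gam ^+ 2 * t * (1 + 2 * t + t ^+ 3 / 4) by field; rewrite gt_eqF.
rewrite wE.
have t3 : t ^+ 3 <= 1 by rewrite exprn_ile1 ?(ltW t0)//; lra.
have : eps / 4 * (1 + 2 * t + t ^+ 3 / 4) <= eps / 4 * 2.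
  by rewrite ler_wpM2l ?divr_ge0 ?(ltW eps0)//; lra.
by have := eps0; lra.
Qed.

End parameters.

(** * The size of the network *)

Section sizes.
Set Implicit Arguments.
Unset Strict Implicit.
Context {R : realType}.

Lemma powR_ge1 (a r : R) : 1 <= a -> 0 <= r -> 1 <= a `^ r.
Proof. by move=> a1 r0; rewrite -[leLHS](powRr0 a); exact: ler_powR. Qed.

(** [nw] exceeds [(Q Y)^r] by at most 1; since [Y >= 1], rounding up is absorbed by the
    1 in [1 + Q^r]. *)
Lemma width_exists (Q Y r : R) : 0 < Q -> 1 <= Y -> 0 < r ->
  exists nw : nat, [/\ (0 < nw)%N, nw%:R <= Y `^ r * (1 + Q `^ r) &
    Q * nw%:R `^ (- r^-1) <= Y^-1].
Proof.
move=> Q0 Y1 r0; have Y0 : 0 < Y by exact: lt_le_trans Y1.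
have X0 : 0 < (Q * Y) `^ r by rewrite powR_gt0// mulr_gt0.
have [nw n1 n2] := nat_above_within1 (ltW X0).
have nw0 : 0 < nw%:R :> R by exact: lt_le_trans X0 n1.
exists nw; split; first by rewrite -(ltr0n R).
  apply: (le_trans n2); rewrite mulrDr mulr1 addrC powRM ?(ltW Q0) ?(ltW Y0)// mulrC lerD2r.
  by rewrite powR_ge1// ltW.
have : Q * Y <= nw%:R `^ r^-1.
  have -> : Q * Y = ((Q * Y) `^ r) `^ r^-1.
    by rewrite -powRrM divff ?lt0r_neq0// powRr1// mulr_ge0 ?ltW.
  by apply: ge0_ler_powR; rewrite ?invr_ge0 ?nnegrE ?powR_ge0 ?(ltW r0) ?(ltW nw0).
rewrite powRN => H; rewrite ler_pdivrMr ?powR_gt0//.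
by rewrite -ler_pdivrMl ?invr_gt0// invrK mulrC.
Qed.

Lemma powR_antitone_exponent (nw : nat) (s r : R) : (0 < nw)%N -> 0 < s -> s <= r ->
  nw%:R `^ (- s^-1) <= nw%:R `^ (- r^-1) :> R.
Proof.
move=> nw0 s0 sr; apply: ler_powR; first by rewrite ler1n.
by rewrite lerN2 lef_pV2// posrE// (lt_le_trans s0).
Qed.

Lemma size_bound_ge1 (P S V Q D e r : R) : 1 <= P -> 1 <= S -> 1 <= V -> 1 <= D ->
  0 < e < 1 -> 0 < r ->
  1 <= P `^ r * S * V * (1 + Q `^ r) * D `^ (r + 1) / e `^ (4 * r + 1).
Proof.
move=> P1 S1 V1 D1 /andP[e0 e1] r0.
have mul1 (a b : R) : 1 <= a -> 1 <= b -> 1 <= a * b.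
  by move=> a1 b1; rewrite -[leLHS]mulr1 ler_pM.
have r1 : 0 <= r + 1 by lra.
apply: (mul1 _ _); last first.
  have E1 : 1 `^ (4 * r + 1) = 1 :> R by rewrite powR1.
  rewrite invf_ge1 ?powR_gt0// -[leRHS]E1.
  by apply: ge0_ler_powR; rewrite ?nnegrE; lra.
apply: (mul1 _ _); last exact: powR_ge1.
apply: (mul1 _ _); last by rewrite lerDl powR_ge0.
apply: (mul1 _ _) => //; apply: (mul1 _ _) => //; apply: powR_ge1 => //; exact: ltW.
Qed.

(** Here [D + 1 <= 2 D], the constant node is absorbed by a third [D], and the fourth
    power of [e] in the width becomes the exponent [4 r]. *)
Lemma size_bound (P gL V Q e r : R) (D K nw : nat) (s : R) :
  1 <= P -> 0 <= gL -> 1 <= V -> (0 < D)%N -> 0 < e < 1 -> 0 < r -> (0 < K)%N -> (0 < nw)%N ->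
  K%:R <= 4 * gL / e + 1 ->
  nw%:R <= (P * D%:R / e ^+ 4) `^ r * (1 + Q `^ r) ->
  s = nw%:R * V ->
  K%:R * (D.+1%:R * s) + 1 <=
  P `^ r * (3 * (1 + 4 * gL)) * V * (1 + Q `^ r) * D%:R `^ (r + 1) / e `^ (4 * r + 1).
Proof.
move=> P1 gL0 V1 D0 /andP[e0 e1] r0 K0 nw0 HK Hnw ->.
have K1 : 1 <= K%:R :> R by rewrite ler1n.
have nw1 : 1 <= nw%:R :> R by rewrite ler1n.
have D1 : 1 <= D%:R :> R by rewrite ler1n.
have V0 : 0 <= V by lra.
have Dgt : 0 < D%:R :> R by lra.
have P0 : 0 <= P by lra.
have eV : 0 < e^-1 by rewrite invr_gt0.
have B1 : K%:R <= (1 + 4 * gL) / e.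
  apply: (le_trans HK); have -> : (1 + 4 * gL) / e = 4 * gL / e + e^-1 by ring.
  by rewrite lerD2l invf_ge1// ltW.
apply: (@le_trans _ _ (K%:R * (3 * D%:R) * (nw%:R * V))).
  have nV : 1 <= nw%:R * V by rewrite -[leLHS]mulr1 ler_pM.
  have KnV : 1 <= K%:R * (nw%:R * V) by rewrite -[leLHS]mulr1 ler_pM.
  rewrite -natr1; move: (nw%:R * V) nV KnV => c c1 Kc.
  have -> : K%:R * ((D%:R + 1) * c) + 1 = (K%:R * c) * D%:R + (K%:R * c) + 1 by ring.
  have -> : K%:R * (3 * D%:R) * c = 3 * ((K%:R * c) * D%:R) by ring.
  have : K%:R * c <= K%:R * c * D%:R by rewrite ler_peMr//; lra.
  lra.
have -> : P `^ r * (3 * (1 + 4 * gL)) * V * (1 + Q `^ r) * D%:R `^ (r + 1) / e `^ (4 * r + 1) =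
  (1 + 4 * gL) / e * (3 * D%:R) * (((P * D%:R / e ^+ 4) `^ r * (1 + Q `^ r)) * V).
  rewrite powRM ?mulr_ge0 ?invr_ge0 ?exprn_ge0 ?(ltW e0) ?(ltW Dgt)//.
  rewrite powRM ?(ltW Dgt)//.
  have eE : (e ^+ 4)^-1 `^ r = (e `^ (4 * r))^-1.
    by rewrite -powR_mulrn ?(ltW e0)// -powRN -powRrM mulNr powRN.
  rewrite eE powRD ?(gt_eqF Dgt) ?implybT// powRr1 ?(ltW Dgt)//.
  rewrite [e `^ (4 * r + 1)]powRD ?(gt_eqF e0) ?implybT// [e `^ 1]powRr1 ?(ltW e0)//.
  have : e `^ (4 * r) != 0 by rewrite gt_eqF// powR_gt0.
  have : e != 0 by rewrite gt_eqF.
  move: (e `^ _) (P `^ _) (D%:R `^ _) (Q `^ _) => a b c d ee aa.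
  by field; rewrite ee aa.
apply: ler_pM; rewrite ?mulr_ge0//; last by rewrite ler_wpM2r.
by rewrite ler_wpM2r// mulr_ge0.
Qed.

Lemma opnorm_ge0 k (A : 'M[R]_k) : 0 <= opnorm A.
Proof.
apply: (le_trans (enorm_ge0 ((0 : 'rV[R]_k) *m A^T))).
apply: ub_le_sup; first by case: (enorm_mulmx_bounded A).
by exists 0 => //=; rewrite enorm0 ler01.
Qed.

Lemma constant_network (sigma : R -> R) n k (U : 'rV[R]_k) : (0 < n)%N -> (0 < k)%N ->
  exists NN : compfun R n k, [/\ is_nn sigma NN, nn_size NN = 1 & forall x, ceval NN x = U].
Proof.
move=> n0 k0.
have p1 : program sigma [:: (fun=> 1) : 'rV[R]_n -> R].
  by apply: (@program_affine R n sigma [::]); [exact: program_nil|exact: aff_span_cst].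
have [NN [nnN sN eN]] := @program_realization R n sigma k [::] (fun i _ => U 0 i) n0 k0 p1
  (fun i => aff_span_cst _ (U 0 i)).
by exists NN; split => // x; rewrite eN; apply/rowP => i; rewrite mxE.
Qed.

(** The parameters of the descent depend on [x] neither in number nor in value, so
    that one network serves all initial states. *)
Lemma near_optimal_network (sigma : R -> R) (n k s : nat) (Om : set 'rV[R]_n)
    (J ev : 'rV[R]_n -> 'rV[R]_k -> R) (UU : set 'rV[R]_k) (U0 : 'rV[R]_k)
    (Us : 'rV[R]_n -> 'rV[R]_k) (gam L eps : R) :
  (0 < n)%N -> (0 < k)%N -> programmable sigma ev s ->
  0 < gam -> 0 < L -> 0 < eps < 1 -> eps < L * gam ^+ 2 ->
  eball U0 (3 * gam) `<=` UU ->
  (forall x, Om x -> [/\ twice_cont_diff (J x), convex_function UU (J x),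
     forall U, eball U0 (2 * gam) U -> opnorm (hessian (J x) U) <= L,
     eball U0 gam (Us x) & forall U, UU U -> J x (Us x) <= J x U]) ->
  (forall x U, Om x -> eball U0 (2 * gam) U -> `|ev x U - J x U| <= cost_accuracy L gam eps k) ->
  exists (NN : compfun R n k) (K : nat),
    [/\ is_nn sigma NN, nn_size NN = (K * (k.+1 * s)).+1,
       (0 < K)%N, K%:R <= 4 * (gam ^+ 2 * L) / eps + 1 &
       forall x, Om x -> eball U0 (2 * gam) (ceval NN x) /\
         J x (ceval NN x) - J x (Us x) <= eps].
Proof.
move=> n0 k0 pev gam0 L0 eps01 big ballUU hJ hev.
have e0 : 0 < eps by case/andP: eps01.
pose tau := anchor_weight L gam eps; pose h := difference_step L gam eps k.
have tau0 : 0 < tau := anchor_weight_gt0 L0 gam0 eps01.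
have tau1 : 0 < tau <= 1.
  by rewrite tau0 (le_trans (anchor_weight_lt L0 gam0 big))// ler_pdivrMr// mul1r ler1n.
have h0 : 0 < h := difference_step_gt0 L0 gam0 eps01 k0.
have g0 := gradient_accuracy_gt0 L0 gam0 eps01.
have gL0 : 0 < gam ^+ 2 * L by rewrite mulr_gt0// exprn_gt0.
have K'0 : 0 < 4 * (gam ^+ 2 * L) / eps by rewrite divr_gt0// mulr_gt0.
have [K K1 K2] := nat_above_within1 (ltW K'0).
have K0 : (0 < K)%N by rewrite -(ltr0n R) (lt_le_trans _ K1).
have K1' : 4 * L * gam ^+ 2 / eps <= K%:R by rewrite -[4 * L * _]mulrA [L * _]mulrC.
have [NN [nnN sN eN]] := average_network pev U0 L h tau K n0 k0.
exists NN, K; split => // x Ox; rewrite eN.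
have [J2 Jcvx JL Usb Usmin] := hJ x Ox.
have hG U : eball U0 (2 * gam - h) U ->
    enorm (forward_difference (ev x) h U - gradient (J x) U) <= gradient_accuracy L gam eps.
  move=> Ub; apply: (le_trans _ (difference_error_le L0 gam0 eps01 k0)).
  by apply: (forward_difference_error J2 Jcvx gam0 ballUU L0 JL h0) => // V; exact: hev.
have hacc := gradient_accuracy_le eps L0 gam0.
have hstep := difference_step_le L0 gam0 eps01 k0 big.
split.
  exact: (average_ball J2 Jcvx gam0 ballUU L0 JL Usb Usmin h0 tau1 (ltW g0) hacc hstep hG K0).
apply: (le_trans _ (total_gap_le L0 gam0 eps01 big K1')).
exact: (average_gap J2 Jcvx gam0 ballUU L0 JL Usb Usmin h0 tau1 (ltW g0) hacc hstep hG K0).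
Qed.

End sizes.

Theorem theorem4p5 (R : realType) (sigma : R -> R) (C : set (nat * nat) -> R)
    (hKG : kang_gong sigma C) :
  exists (P1 P2 : mpoly 3 R) (Q : nat -> mpoly 10 R),
  [/\ pnonneg P1, pnonneg P2, forall N, pnonneg (Q N),
      forall N a (i : 'I_10), a \in msupp (Q N) ->
        (a i <= (if (i < 9)%N then 1 else N))%N &
  forall (n q N : nat) (hn : (0 < n)%N) (hq : (0 < q)%N) (hN : (0 < N)%N)
    (f : 'rV[R]_n -> 'rV[R]_q -> 'rV[R]_n) (g : 'rV[R]_n -> R)
    (F : compfun R (n + q) n) (G : compfun R n 1)
    (hF : forall x u, ceval F (row_mx x u) = f x u)
    (hG : forall x, ceval G x 0 0 = g x)
    (hF2 : nodes_C2 F) (hG2 : nodes_C2 G)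
    (Om : set 'rV[R]_n) (hOm : compact Om)
    (UU : set 'rV[R]_(N * q)) (hUU : convex_set UU)
    (hJ : forall x, Om x -> convex_function UU (cost f g x))
    (U0 : 'rV[R]_(N * q)) (gam : R) (hU0 : UU U0) (hgam : 0 < gam)
    (h3gam : eball U0 (3 * gam) `<=` UU)
    (Ustar : 'rV[R]_n -> 'rV[R]_(N * q))
    (hUstar : forall x, Om x -> eball U0 gam (Ustar x) /\
       ereal_inf [set (cost f g x U)%:E | U in UU] = (cost f g x (Ustar x))%:E)
    (Rb : R) (hRb : 1 < Rb)
    (hball : eball U0 (2 * gam) `<=` cube Rb)
    (htraj : forall x U k, Om x -> eball U0 (2 * gam) U -> (k <= N - 1)%N ->
       cube (Rb / 2) (state f x U k))
    (* g is the function [-Rb, Rb]^n -> R with the features below, so that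
       J = g (f^N) presupposes that f^N lies in its domain *)
    (hterm : forall x U, Om x -> eball U0 (2 * gam) U ->
       cube Rb (state f x U N))
    (radf : node F -> R) (mf : node F -> nat)
    (radg : node G -> R) (mg : node G -> nat)
    (hAf : assumptionA Rb radf mf) (hAg : assumptionA Rb radg mg)
    (rf Lamf Lmaxf : R) (hfeatf : features radf mf rf Lamf Lmaxf)
    (rg Lamg Lmaxg : R) (hfeatg : features radg mg rg Lamg Lmaxg)
    (Lf : R) (hLf : elipschitz Lf (cube Rb) (fun y => f (lsubmx y) (rsubmx y)))
    (Lg : R) (hLg : forall x y, cube Rb x -> cube Rb y ->
       `|g x - g y| <= Lg * enorm (x - y))
    (L1 : R) (hL1 : is_max
       [set y | exists x U, [/\ Om x, eball U0 (3 * gam) U &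
          y = enorm (gradient (cost f g x) U)]] L1)
    (L2 : R) (hL2 : is_max
       [set y | exists x U, [/\ Om x, eball U0 (2 * gam) U &
          y = opnorm (hessian (cost f g x) U)]] L2)
    (eps : R) (heps : 0 < eps < 1),
  let r := Num.max rf rg in
  let C1 := peval P1 [:: gam; L1; L2] in
  let C2 := peval P2 [:: gam; L1; L2] in
  let VGf := (card_general F)%:R in
  let VGg := (card_general G)%:R in
  let CC := peval (Q N)
    [:: Lg; C (dims mf); Lmaxf; Lamf; VGf; C (dims mg); Lmaxg; Lamg; VGg; Lf] in
  exists NN : compfun R n (N * q),
    [/\ is_nn sigma NN,
        forall x, Om x -> UU (ceval NN x),
        forall x, Om x ->
          cost f g x (ceval NN x) - cost f g x (Ustar x) <= eps
      & (nn_size NN)%:R <= C1 `^ r * C2 * (N%:R * VGf + VGg) * (1 + CC `^ r) *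
          (q * N)%:R `^ (r + 1) / eps `^ (4 * r + 1)]].
Proof.
case: hKG => C0 KG.
exists accuracy_constant, steps_constant, surrogate_constant; split.
- exact: accuracy_constant_ge0.
- exact: steps_constant_ge0.
- exact: surrogate_constant_ge0.
- exact: surrogate_constant_deg.
move=> n q N hn hq hN f g F G hF hG hF2 hG2 Om hOm UU hUU hJ U0 gam hU0 hgam h3gam Ustar hUstar
  Rb hRb hball htraj hterm radf mf radg mg hAf hAg rf Lamf Lmaxf hfeatf rg Lamg Lmaxg hfeatg
  Lf hLf Lg hLg L1 _ L2 hL2 eps heps r C1 C2 VGf VGg CC.
have [e0 e1] := andP heps.
have [[rf0 Lamf0 Lmaxf0 VF0] _ _ _] := hfeatf.
have [[rg0 Lamg0 Lmaxg0 VG0] _ _ _] := hfeatg.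
have r0 : 0 < r by rewrite /r lt_max rf0.
have rfr : rf <= r by rewrite /r le_max lexx.
have rgr : rg <= r by rewrite /r le_max lexx orbT.
have D0 : (0 < N * q)%N by rewrite muln_gt0 hN.
have VF1 : 1 <= VGf by rewrite ler1n.
have VG1 : 1 <= VGg by rewrite ler1n.
have V1 : 1 <= N%:R * VGf + VGg.
  by rewrite -[leLHS]add0r lerD// mulr_ge0.
have hL2x x U : Om x -> eball U0 (2 * gam) U -> opnorm (hessian (cost f g x) U) <= L2.
  by move=> Ox Ub; case: hL2 => _; apply; exists x, U; split.
have L20 : 0 <= L2 by case: hL2 => -[x [U [_ _ ->]]] _; exact: opnorm_ge0.
have Usmin x : Om x -> forall U, UU U -> cost f g x (Ustar x) <= cost f g x U.
  move=> Ox U uU; rewrite -lee_fin; have [_ <-] := hUstar x Ox.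
  by apply: ereal_inf_lbound; exists U.
have Usb x (Ox : Om x) : eball U0 gam (Ustar x) by case: (hUstar x Ox).
have J2 x : twice_cont_diff (cost f g x : 'rV[R]_(N * q) -> R) by exact: cost_C2 hF2 hG2.
have ball23 : eball U0 (2 * gam) `<=` UU.
  move=> U Ub; apply: h3gam; move: Ub; rewrite /eball/= => /le_trans; apply.
  by rewrite ler_wpM2r ?(ltW hgam)// ler_nat.
have CCE : CC = 2 * (1 + Lg + Lmaxg * Lamg * VGg) *
    ((\sum_(j < N) Lf ^+ j) * (C (dims mf) * Lmaxf * Lamf * VGf)) + C (dims mg) * (Lmaxg * Lamg * VGg).
  exact: peval_surrogate_constant.
have C1E : C1 = 1 + accuracy_factor * (gam ^+ 6 * L2 ^+ 3) by exact: peval_accuracy_constant.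
have C2E : C2 = 3 * (1 + 4 * (gam ^+ 2 * L2)) by exact: peval_steps_constant.
have gL0 : 0 <= gam ^+ 2 * L2 by rewrite mulr_ge0 ?sqr_ge0.
have C11 : 1 <= C1.
  by rewrite C1E lerDl mulr_ge0 ?(ltW accuracy_factor_gt0)// mulr_ge0// exprn_ge0// ltW.
(* Below this threshold no descent is needed, and the Hessian bound is relaxed to
   eps / gam^2, which is positive. *)
have [small|big] := lerP (L2 * gam ^+ 2) eps.
  have [NN [nnN sN eN]] := constant_network sigma U0 hn D0.
  exists NN; split => //.
  - by move=> x _; rewrite eN.
  - move=> x Ox; rewrite eN.
    have g2 : 0 < gam ^+ 2 by rewrite exprn_gt0.
    have L'0 : 0 < eps / gam ^+ 2 by rewrite divr_gt0.
    have L'2 U : eball U0 (2 * gam) U -> opnorm (hessian (cost f g x) U) <= eps / gam ^+ 2.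
      by move=> Ub; rewrite (le_trans (hL2x _ _ Ox Ub))// ler_pdivlMr.
    have := anchor_gap (J2 x) (hJ x Ox) hgam h3gam L'0 L'2 (Usb x Ox) (Usmin x Ox).
    by rewrite divfK// gt_eqF.
  - rewrite sN; apply: size_bound_ge1 => //; first by move: gL0; rewrite C2E; clear; lra.
    by rewrite ler1n mulnC.
have Lgt0 : 0 < L2.
  by have := lt_trans e0 big; rewrite pmulr_lgt0// exprn_gt0.
pose Lg' := lipschitz_g_ge0 hn hRb hLg.
pose Lf' := lipschitz_f_ge0 hn hRb hLf.
have Lg0 : 0 <= Lg := Lg'.
have Lf0 : 0 <= Lf := Lf'.
have Cf0 := C0 (dims mf); have Cg0 := C0 (dims mg).
pose S := geometric_sum Lf N.
have S0 : 0 <= S := geometric_sum_ge0 hn hRb hLf N.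
pose cf := C (dims mf) * Lamf * Lmaxf * VGf.
pose cg := C (dims mg) * Lamg * Lmaxg * VGg.
pose M := VGg * (Lmaxg * Lamg).
have VF0' : 0 < VGf by exact: lt_le_trans VF1.
have VG0' : 0 < VGg by exact: lt_le_trans VG1.
have cf0 : 0 < cf by rewrite !mulr_gt0.
have cg0 : 0 < cg by rewrite !mulr_gt0.
have M0 : 0 < M by rewrite !mulr_gt0.
have CCE' : CC = 2 * (1 + Lg + M) * (S * cf) + cg.
  rewrite CCE /S /geometric_sum /cf /cg /M; ring.
have CC0 : 0 < CC.
  rewrite CCE' ltr_wpDl// mulr_ge0 ?(mulr_ge0 S0) ?(ltW cf0)// mulr_ge0//.
  by rewrite !addr_ge0// ltW.
pose D := (N * q)%N.
have DR : 1 <= D%:R :> R by rewrite ler1n.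
have e40 : 0 < eps ^+ 4 by rewrite exprn_gt0.
(* Y is the inverse of the accuracy that the descent requires of the cost. *)
pose Y := C1 * D%:R / eps ^+ 4.
have Y1 : 1 <= Y.
  rewrite ler_pdivlMr// mul1r (@le_trans _ _ 1)//; first by rewrite exprn_ile1// ltW.
  by rewrite -[leLHS]mulr1 ler_pM.
have [nw [nw0 nwle nwacc]] := width_exists CC0 Y1 r0.
set nu := nw%:R `^ (- r^-1) in nwacc.
have nu0 : 0 <= nu := powR_ge0 _ _.
have Yinv : Y^-1 = cost_accuracy L2 gam eps D.
  by rewrite /Y /cost_accuracy -C1E invf_div.
have [Fh [nnF sF eF]] := KG _ _ F Rb radf mf rf Lamf Lmaxf hAf hfeatf nw nw0.
have [Gh [nnG sG eG]] := KG _ _ G Rb radg mg rg Lamg Lmaxg hAg hfeatg nw nw0.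
pose ef := cf * nu; pose eg := cg * nu.
have ef0 : 0 <= ef by rewrite mulr_ge0// ltW.
have hFh y : cube Rb y -> enorm (ceval F y - ceval Fh y) <= ef.
  move=> /eF /le_trans; apply; rewrite ler_wpM2l ?(ltW cf0)//.
  exact: powR_antitone_exponent.
have hGh y : cube Rb y -> enorm (ceval G y - ceval Gh y) <= eg.
  move=> /eG /le_trans; apply; rewrite ler_wpM2l ?(ltW cg0)//.
  exact: powR_antitone_exponent.
have hM y eta : cube Rb y -> 0 <= eta <= 1 ->
    enorm (ceval G y - ceval G ((1 - eta) *: y) - eta *: (y *m linear_mx G)) <= M * eta.
  by move=> yc et; have := scaled_evaluation hG2 hAg hfeatg yc et; rewrite /M -!mulrA.
(* E bounds the error of the approximate trajectory and is also the factor by which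
   its last state is pulled towards 0. *)
pose E := ef * geometric_sum Lf N.
have EE : E = S * cf * nu by rewrite /E /ef -/S; ring.
have Scf0 : 0 <= S * cf * nu by rewrite mulr_ge0// mulr_ge0// ltW.
have Yle1 : Y^-1 <= 1 by rewrite invf_le1// (lt_le_trans ltr01).
have Enu : 2 * (1 + Lg + M) * E + eg <= Y^-1.
  apply: le_trans nwacc; rewrite le_eqVlt; apply/orP; left; apply/eqP.
  by rewrite CCE' EE /eg; ring.
have E2 : E <= 1 / 2.
  have eg0 : 0 <= eg by rewrite mulr_ge0// ltW.
  have EM : E <= (1 + Lg + M) * E.
    by rewrite ler_peMl ?EE// -addrA lerDl addr_ge0// ltW.
  by move: EM Enu Yle1 eg0; clear; rewrite -mulrA; lra.
have E0 : 0 <= E by rewrite EE.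
pose delta := cost_accuracy L2 gam eps D.
have hJh x U : Om x -> eball U0 (2 * gam) U ->
    `|surrogate_cost G Fh Gh E x U - cost f g x U| <= delta.
  move=> Ox Ub.
  have := surrogate_cost_error hF hG hn hRb ef0 hFh hGh hLf hLg hM hN (hball _ Ub)
    (fun p => htraj x U p Ox Ub) (hterm x U Ox Ub) E2.
  move=> /le_trans; apply; rewrite /delta -Yinv; apply: le_trans Enu.
  have -> : 2 * (1 + Lg + M) * E + eg = eg + 2 * (Lg + M) * E + 2 * E by ring.
  by rewrite lerDl mulr_ge0.
have pev := surrogate_programmable (N := N) G E nnF nnG.
have hJx x : Om x -> [/\ twice_cont_diff (cost f g x : 'rV[R]_(N * q) -> R), convex_function UU (cost f g x),
     forall U, eball U0 (2 * gam) U -> opnorm (hessian (cost f g x) U) <= L2,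
     eball U0 gam (Ustar x) & forall U, UU U -> cost f g x (Ustar x) <= cost f g x U].
  by move=> Ox; split; [exact: J2|exact: hJ|move=> U; exact: hL2x|exact: Usb|exact: Usmin].
have [NN [K [nnN sN K0 K2 hNN]]] :=
  near_optimal_network hn D0 pev hgam Lgt0 heps big h3gam hJx hJh.
exists NN; split => //.
- by move=> x /hNN[/ball23].
- by move=> x /hNN[].
rewrite sN -natr1 [(K * _)%:R]natrM [((N * q).+1 * _)%:R]natrM C2E [(q * N)%N]mulnC.
apply: (size_bound C11 gL0 V1 D0 heps r0 K0 nw0 K2 nwle).
by rewrite sF sG natrD !natrM /VGf /VGg; ring.
Qed.
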